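(* Let $T>0$, $\gamma\in(\frac13,1]$, $\alpha>0$ and $R>0$. Let $(\mathbf{X}^n)_{n\in\mathbb{N}}$ be a sequence of random variables with values in $\mathscr{C}^\gamma([0,T],\mathcal{C}^\alpha_R(\mathbb{R}^d,\mathbb{R}^d))$. If there is a $p\ge1$ such that $$\sup_{n\in\mathbb{N}}\mathbb{E}\big[|\mathbf{X}^n|^p_{\mathcal{C}^\gamma\oplus\mathcal{C}^{2\gamma}}\big]<\infty,$$ and if the finite-dimensional space-time distributions of any (two) weak limit points of $(\mathbf{X}^n)_{n\in\mathbb{N}}$ coincide, then there is a random variable $\mathbf{X}\in\mathscr{C}^{\gamma-}([0,T],\mathcal{C}^{\alpha-}_R(\mathbb{R}^d,\mathbb{R}^d))$ such that $\mathbf{X}^n\Rightarrow\mathbf{X}$ weakly, i.e. weakly in $\mathscr{C}^{\gamma'}([0,T],\mathcal{C}^{\alpha'}_R(\mathbb{R}^d,\mathbb{R}^d))$ for all $\gamma'<\gamma$, $\alpha'<\alpha$.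
   Context: $\mathcal{C}^\alpha_b(\mathbb{R}^d,E)$ (for a normed space $E$, $\alpha>0$) is the Hölder space with norm $\sup_{|\ell|\le\lfloor\alpha\rfloor}\sup_x|D^\ell f(x)|+\sup_{|\ell|=\lfloor\alpha\rfloor}\sup_{x\ne y}\frac{|D^\ell f(x)-D^\ell f(y)|}{|x-y|^{\alpha-\lfloor\alpha\rfloor}}$. $\mathcal{C}^\alpha_R(\mathbb{R}^d,\mathbb{R}^d)$ is the subspace of $f\in\mathcal{C}_b^\alpha(\mathbb{R}^d,\mathbb{R}^d)$ whose support is contained in the closed ball of radius $R$ about $0$. The tensor product of such a space with itself is the completion of the algebraic tensor product under the norm induced by the embedding $f\otimes g\mapsto\big((x,y)\mapsto f(x)\otimes g(y)\big)$ into $\mathcal{C}_b^\alpha(\mathbb{R}^d,\mathcal{C}_b^\alpha(\mathbb{R}^d,\mathbb{R}^d\otimes\mathbb{R}^d))$; its elements are identified with functions of $(x,y)\in\mathbb{R}^d\times\mathbb{R}^d$. For a Banach space $E$ (with tensor product $E\otimes E$), $\mathscr{C}^\gamma([0,T],E)$ is the set of pairs $\mathbf{X}=(X,\mathbb{X})$ with $X:[0,T]\to E$ $\gamma$-Hölder, $X_0=0$, and $\mathbb{X}:\{(s,t):0\le s\le t\le T\}\to E\otimes E$ with $|\mathbb{X}|_{2\gamma}=\sup_{s<t}\|\mathbb{X}_{s,t}\|/|t-s|^{2\gamma}<\infty$, satisfying Chen's relation $\mathbb{X}_{s,t}-\mathbb{X}_{s,u}-\mathbb{X}_{u,t}=X_{s,u}\otimes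 X_{u,t}$ for $s\le u\le t$, where $X_{s,t}=X_t-X_s$. It is a complete metric space under the metric induced by $|\mathbf{X}|_{\mathcal{C}^\gamma\oplus\mathcal{C}^{2\gamma}}=|X|_{\mathcal{C}^\gamma}+|\mathbb{X}|_{2\gamma}$. Write $\mathbb{X}_t=\mathbb{X}_{0,t}$. Superscripts $\gamma-$, $\alpha-$ mean: for all $\gamma'<\gamma$, $\alpha'<\alpha$; weak limit points are understood in these spaces. Two such random rough paths $\mathbf{X}=(X,\mathbb{X})$, $\mathbf{Y}=(Y,\mathbb{Y})$ are equal in finite-dimensional (space-time) distributions if, for each $m\in\mathbb{N}$, $0\le t_1<\dots<t_m\le T$ and $x^i_1,\dots,x^i_m\in\mathbb{R}^d$ ($i=1,2$), the random vectors $\big(X_{t_j}(x^1_j),\mathbb{X}_{t_j}(x^1_j,x^2_j)\big)_{j=1}^m$ and $\big(Y_{t_j}(x^1_j),\mathbb{Y}_{t_j}(x^1_j,x^2_j)\big)_{j=1}^m$ in $\big(\mathbb{R}^d\oplus(\mathbb{R}^d\otimes\mathbb{R}^d)\big)^m$ have the same law. *)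

(* Defs.v *)
From HB Require Import structures.
From mathcomp Require Import all_boot all_order all_algebra.
From mathcomp Require Import all_classical all_reals all_analysis.
From mathcomp Require Import ring lra.

Set Implicit Arguments.
Unset Strict Implicit.
Unset Printing Implicit Defensive.

Import Order.TTheory GRing.Theory Num.Theory.
Import numFieldNormedType.Exports.

Local Open Scope classical_set_scope.
Local Open Scope ring_scope.

(* The library norms matrices by the largest entry; [emx] is a copy of the
   matrix type that carries the Euclidean norm instead. *)
Definition emx (R : realType) (m n : nat) : Type := 'M[R]_(m, n).

HB.instance Definition _ (R : realType) (m n : nat) :=
  GRing.Lmodule.copy (emx R m n) 'M[R]_(m, n).

Definition euclid_norm (R : realType) m n (A : 'M[R]_(m, n)) : R :=
  Num.sqrt (\sum_(p : 'I_m * 'I_n) A p.1 p.2 ^+ 2).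

Section euclid_norm.
Context {R : realType} {m n : nat}.
Implicit Types A B : 'M[R]_(m, n).

Let S A : R := \sum_(p : 'I_m * 'I_n) A p.1 p.2 ^+ 2.

Let S_ge0 A : 0 <= S A.
Proof. by apply: sumr_ge0 => p _; exact: sqr_ge0. Qed.

Lemma euclid_normD A B :
  euclid_norm (A + B) <= euclid_norm A + euclid_norm B.
Proof.
rewrite /euclid_norm -!/(S _).
set a := Num.sqrt (S A); set b := Num.sqrt (S B).
have a0 : 0 <= a by exact: sqrtr_ge0.
have b0 : 0 <= b by exact: sqrtr_ge0.
have a2 : a ^+ 2 = S A by rewrite sqr_sqrtr.
have b2 : b ^+ 2 = S B by rewrite sqr_sqrtr.
rewrite -(ler_pXn2r (ltn0Sn 1)) ?nnegrE ?sqrtr_ge0 ?addr_ge0//.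
rewrite sqr_sqrtr// sqrrD a2 b2.
pose D := \sum_(p : 'I_m * 'I_n) A p.1 p.2 * B p.1 p.2.
have -> : S (A + B) = S A + D *+ 2 + S B.
  rewrite /S /D -sumrMnl -!big_split/=; apply: eq_bigr => p _.
  by rewrite mxE sqrrD.
rewrite lerD2r lerD2l lerMn2r/=.
have key : 0 <= S (b *: A - a *: B) by [].
have keyE : S (b *: A - a *: B) = (a * b) * (a * b - D) *+ 2.
  have -> : S (b *: A - a *: B) = b ^+ 2 * S A - (a * b * D) *+ 2 + a ^+ 2 * S B.
    rewrite /S /D !mulr_sumr -sumrMnl -sumrN -!big_split/=.
    apply: eq_bigr => p _; rewrite !mxE sqrrB !exprMn; congr (_ - _ *+ 2 + _).
    by rewrite mulrACA [b * a]mulrC.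
  by rewrite -a2 -b2; ring.
have [ab0|] := ltrP 0 (a * b).
  by move: key; rewrite keyE pmulrn_lge0// pmulr_rge0// subr_ge0.
move=> ab0; have {}ab0 : a * b = 0.
  by apply/eqP; rewrite eq_le ab0 mulr_ge0.
rewrite ab0.
have z M : Num.sqrt (S M) = 0 -> forall p : 'I_m * 'I_n, M p.1 p.2 = 0.
  move=> /eqP; rewrite sqrtr_eq0 => M0 p.
  have : S M == 0 by rewrite eq_le M0 S_ge0.
  rewrite psumr_eq0 => [/allP/(_ p)|q _]; last exact: sqr_ge0.
  by rewrite mem_index_enum => /(_ isT)/=; rewrite sqrf_eq0 => /eqP.
rewrite /D big1// => p _.
by move/eqP: ab0; rewrite mulf_eq0 => /orP[] /eqP /z ->; rewrite ?mul0r ?mulr0.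
Qed.

Lemma euclid_normZ (l : R) A : euclid_norm (l *: A) = `|l| * euclid_norm A.
Proof.
rewrite /euclid_norm -sqrtr_sqr -sqrtrM ?sqr_ge0// mulr_sumr.
by congr Num.sqrt; apply: eq_bigr => p _; rewrite mxE exprMn.
Qed.

Lemma euclid_norm0_eq0 A : euclid_norm A = 0 -> A = 0.
Proof.
move=> /eqP; rewrite sqrtr_eq0 => A0; apply/matrixP => i j; rewrite mxE.
have : S A == 0 by rewrite eq_le A0 S_ge0.
rewrite psumr_eq0 => [/allP/(_ (i, j))|q _]; last exact: sqr_ge0.
by rewrite mem_index_enum => /(_ isT)/=; rewrite sqrf_eq0 => /eqP.
Qed.

End euclid_norm.

HB.instance Definition _ (R : realType) (m n : nat) :=
  @Lmodule_isNormed.Build R (emx R m n) (@euclid_norm R m n)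
    (@euclid_normD R m n) (@euclid_normZ R m n) (@euclid_norm0_eq0 R m n).

Notation euclid R d := (emx R 1 d).

(* R^(n.+1) throughout, so that the dimension is at least one. *)
Section hoelder_def.
Context {R : realType} {n : nat} {W : normedModType R}.
Local Notation E := (euclid R n.+1).
Implicit Types (f g : E -> W) (s : seq 'I_n.+1) (l : {ffun 'I_n.+1 -> nat}).

Definition basis_vec (i : 'I_n.+1) : E := delta_mx 0 i.

(* iterated partial derivatives, in the directions listed in s *)
Definition pderiv s f : E -> W :=
  foldr (fun i g x => 'D_(basis_vec i) g x) f s.

(* f is k times continuously differentiable with values in the normed space W *)
Definition Ck (k : nat) f : Prop := forall s, (size s <= k)%N ->
  continuous (pderiv s f) /\
  ((size s < k)%N -> forall i x, derivable (pderiv s f) x (basis_vec i)).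

(* |l| for a multi-index l, and D^l *)
Definition mlen l : nat := (\sum_i l i)%N.

Definition mseq l : seq 'I_n.+1 :=
  flatten [seq nseq (l i) i | i <- enum 'I_n.+1].

Definition mderiv l f : E -> W := pderiv (mseq l) f.

Definition deriv_sup (k : nat) f : \bar R :=
  ereal_sup [set e | exists l x, (mlen l <= k)%N /\ e = `|mderiv l f x|%:E].

Definition deriv_hoelder_sup (k : nat) (theta : R) f : \bar R :=
  ereal_sup [set e | exists l x y, [/\ mlen l = k, x != y &
    e = (`|mderiv l f x - mderiv l f y| / `|x - y| `^ theta)%:E]].

(* When alpha is an integer, theta = 0 and [x `^ 0 = 1]. The value is +oo when f
   has unbounded derivatives, and it is meaningful for f in C^k only. *)
Definition hoelder_enorm (alpha : R) f : \bar R :=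
  let k := Num.truncn alpha in
  (deriv_sup k f + deriv_hoelder_sup k (alpha - k%:R) f)%E.

Definition is_hoelder (alpha : R) f : Prop :=
  Ck (Num.truncn alpha) f /\ (hoelder_enorm alpha f < +oo)%E.

Lemma size_mseq l : size (mseq l) = mlen l.
Proof.
rewrite size_flatten /shape -map_comp sumnE big_map big_enum/=.
by apply: eq_bigr => i _; rewrite /= size_nseq.
Qed.

Lemma CkS k s f : Ck k f -> (size s <= k)%N -> continuous (pderiv s f).
Proof. by move=> + sk => /(_ s sk)[]. Qed.

Lemma pderivD k s f g : Ck k f -> Ck k g -> (size s <= k)%N ->
  pderiv s (f + g) = pderiv s f + pderiv s g.
Proof.
move=> fk gk; elim: s => //= i s ih sk.
apply/funext => x; rewrite (ih (ltnW sk)) deriveD//.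
- by have [_ /(_ sk)] := fk s (ltnW sk).
- by have [_ /(_ sk)] := gk s (ltnW sk).
Qed.

Lemma CkD k f g : Ck k f -> Ck k g -> Ck k (f + g).
Proof.
move=> fk gk s sk; rewrite (pderivD fk gk)//.
have [cf df] := fk s sk; have [cg dg] := gk s sk; split=> [x|{}sk i x].
  exact: (cvgD (cf x) (cg x)).
by apply: derivableD; [exact: df|exact: dg].
Qed.

Let mindex0 (k : nat) : exists l : {ffun 'I_n.+1 -> nat}, mlen l = k.
Proof.
exists [ffun i => if i == ord0 then k else 0%N].
rewrite /mlen (bigD1 ord0)//= ffunE eqxx big1 ?addn0// => i i0.
by rewrite ffunE (negbTE i0).
Qed.

Lemma basis_vec_neq0 i : basis_vec i != 0.
Proof.
apply/eqP => /(congr1 (fun A : 'rV[R]_n.+1 => A 0 i)).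
by rewrite !mxE !eqxx => /eqP; rewrite oner_eq0.
Qed.

Lemma deriv_sup_ge0 k f : (0 <= deriv_sup k f)%E.
Proof.
have [l lk] := mindex0 k.
apply: le_ereal_sup_tmp; exists (`|mderiv l f 0|%:E); last by rewrite lee_fin.
by exists l, 0; rewrite lk.
Qed.

Lemma deriv_hoelder_sup_ge0 k theta f : (0 <= deriv_hoelder_sup k theta f)%E.
Proof.
have [l lk] := mindex0 k.
apply: le_ereal_sup_tmp; eexists.
  by exists l, (basis_vec ord0), 0; split => //; exact: basis_vec_neq0.
by rewrite lee_fin divr_ge0// powR_ge0.
Qed.

Lemma hoelder_enorm_ge0 alpha f : (0 <= hoelder_enorm alpha f)%E.
Proof. by rewrite adde_ge0 ?deriv_sup_ge0 ?deriv_hoelder_sup_ge0. Qed.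

Lemma hoelder_enormD alpha f g :
  Ck (Num.truncn alpha) f -> Ck (Num.truncn alpha) g ->
  (hoelder_enorm alpha (f + g)%R <= hoelder_enorm alpha f + hoelder_enorm alpha g)%E.
Proof.
move=> fk gk; rewrite /hoelder_enorm.
set k := Num.truncn alpha in fk gk *; set theta := alpha - _.
have mD l : (mlen l <= k)%N -> mderiv l (f + g) = mderiv l f + mderiv l g.
  by move=> lk; apply: (pderivD fk gk); rewrite size_mseq.
rewrite addeACA; apply: leeD; apply: ge_ereal_sup.
- move=> _ [l [x [lk ->]]]; rewrite mD//.
  apply: (@le_trans _ _ (`|mderiv l f x|%:E + `|mderiv l g x|%:E)%E).
    by rewrite -EFinD lee_fin ler_normD.
  by apply: leeD; apply: ereal_sup_ubound; exists l, x.
- move=> _ [l [x [y [lk xy ->]]]]; rewrite mD ?lk//.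
  apply: (@le_trans _ _
    ((`|mderiv l f x - mderiv l f y| / `|x - y| `^ theta)%:E +
     (`|mderiv l g x - mderiv l g y| / `|x - y| `^ theta)%:E)%E).
    rewrite -EFinD lee_fin -mulrDl ler_wpM2r ?invr_ge0 ?powR_ge0//.
    by rewrite !fctE opprD addrACA ler_normD.
  by apply: leeD; apply: ereal_sup_ubound; exists l, x, y.
Qed.

Lemma hoelder_enorm_sup alpha f x : (`|f x|%:E <= hoelder_enorm alpha f)%E.
Proof.
have [l l0] := mindex0 0%N.
apply: (@le_trans _ _ (deriv_sup (Num.truncn alpha) f)).
  apply: ereal_sup_ubound; exists l, x; rewrite l0; split => //.
  have /size0nil ms : size (mseq l) = 0%N by rewrite size_mseq.
  by rewrite /mderiv ms.
by rewrite leeDl// deriv_hoelder_sup_ge0.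
Qed.

End hoelder_def.

Section hoelder_comp.
Context {R : realType} {n : nat} {V W : normedModType R}.
Local Notation E := (euclid R n.+1).
Variables (L : {linear V -> W}) (C : R).
Hypothesis LC : forall v, `|L v| <= C * `|v|.
Implicit Types (f : E -> V) (s : seq 'I_n.+1).

Lemma bounded_continuous : continuous L.
Proof.
apply: bounded_linear_continuous; apply/ex_bound; exists (`|C| * 1).
apply/nbhs_ballP; exists 1 => //= z; rewrite -ball_normE/= sub0r normrN => z1.
apply: le_trans (LC z) _; apply: (@le_trans _ _ (`|C| * `|z|)).
  by rewrite ler_wpM2r// ler_norm.
by rewrite ler_wpM2l// ltW.
Qed.

Lemma derivable_compL f x v : derivable f x v ->
  derivable (L \o f) x v /\ 'D_v (L \o f) x = L ('D_v f x).
Proof.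
move=> fx.
have : (fun h => h^-1 *: (((L \o f) \o shift x) (h *: v) - (L \o f) x)) @ 0^'
    --> L ('D_v f x).
  have -> : (fun h => h^-1 *: (((L \o f) \o shift x) (h *: v) - (L \o f) x)) =
      L \o (fun h => h^-1 *: ((f \o shift x) (h *: v) - f x)).
    by apply/funext => h /=; rewrite [in RHS]linearZ/= [in RHS]linearB.
  exact: (cvg_comp _ L fx (bounded_continuous (x := 'D_v f x))).
by move=> c; split; [apply/cvg_ex; eexists; exact: c|exact: cvg_lim c].
Qed.

Lemma pderiv_comp k s f : Ck k f -> (size s <= k)%N ->
  pderiv s (L \o f) = L \o pderiv s f.
Proof.
move=> fk; elim: s => //= i s ih sk; apply/funext => x.
rewrite (ih (ltnW sk)) (derivable_compL _).2//.
by have [_ /(_ sk)] := fk s (ltnW sk).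
Qed.

Lemma Ck_comp k f : Ck k f -> Ck k (L \o f).
Proof.
move=> fk s sk; rewrite (pderiv_comp fk)//; have [cf df] := fk s sk.
split=> [x|{}sk i x].
  exact: (cvg_comp _ L (cf x) (bounded_continuous (x := pderiv s f x))).
by apply: (derivable_compL _).1; exact: df.
Qed.

Lemma hoelder_enorm_comp alpha f : 0 <= C -> Ck (Num.truncn alpha) f ->
  (hoelder_enorm alpha (L \o f) <= C%:E * hoelder_enorm alpha f)%E.
Proof.
move=> C0 fk; rewrite /hoelder_enorm.
set k := Num.truncn alpha in fk *; set theta := alpha - _.
have mL l : (mlen l <= k)%N -> mderiv l (L \o f) = L \o mderiv l f.
  by move=> lk; apply: (pderiv_comp fk); rewrite size_mseq.
rewrite ge0_muleDr ?deriv_sup_ge0 ?deriv_hoelder_sup_ge0//.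
apply: leeD; apply: ge_ereal_sup.
- move=> _ [l [x [lk ->]]]; rewrite mL//=.
  apply: (@le_trans _ _ (C%:E * `|mderiv l f x|%:E)%E).
    by rewrite -EFinM lee_fin.
  by rewrite lee_wpmul2l ?lee_fin//; apply: ereal_sup_ubound; exists l, x.
- move=> _ [l [x [y [lk xy ->]]]]; rewrite mL ?lk//=.
  apply: (@le_trans _ _ (C%:E *
    (`|mderiv l f x - mderiv l f y| / `|x - y| `^ theta)%:E)%E).
    rewrite -EFinM lee_fin mulrA ler_wpM2r ?invr_ge0 ?powR_ge0//.
    by rewrite -linearB.
  by rewrite lee_wpmul2l ?lee_fin//; apply: ereal_sup_ubound; exists l, x, y.
Qed.

Lemma is_hoelder_comp alpha f : 0 <= C -> is_hoelder alpha f ->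
  is_hoelder alpha (L \o f).
Proof.
move=> C0 [fk fy]; split; first exact: Ck_comp.
apply: (le_lt_trans (hoelder_enorm_comp C0 fk)).
have := hoelder_enorm_ge0 alpha f; move: fy.
by case: (hoelder_enorm alpha f) => // r _ _; rewrite -EFinM ltry.
Qed.

End hoelder_comp.

Section hoelder_lmod.
Context {R : realType} {n : nat} {W : normedModType R}.
Local Notation E := (euclid R n.+1).
Implicit Types f g : E -> W.

Lemma is_hoelderZ alpha (a : R) f : is_hoelder alpha f ->
  is_hoelder alpha (a *: f).
Proof.
move=> fh; apply: (@is_hoelder_comp _ _ _ _ ( *:%R a : {linear W -> W}) `|a|) => //.
by move=> v; rewrite /= normrZ.
Qed.

Lemma is_hoelderD alpha f g : is_hoelder alpha f -> is_hoelder alpha g ->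
  is_hoelder alpha (f + g).
Proof.
move=> [fk fy] [gk gy]; split; first exact: CkD.
by apply: (le_lt_trans (hoelder_enormD fk gk)); exact: lte_add_pinfty.
Qed.

Lemma is_hoelder0 alpha : is_hoelder alpha (0 : E -> W).
Proof.
have p0 s : pderiv s (0 : E -> W) = 0.
  elim: s => //= i s ->; apply/funext => x; exact: derive_cst.
split.
  move=> s _; rewrite p0; split=> [x|_ i x]; first exact: cst_continuous.
  exact: derivable_cst.
apply: (@le_lt_trans _ _ (0 + 0)%E); last by rewrite adde0 ltry.
apply: leeD; apply: ge_ereal_sup.
- by move=> _ [l [x [_ ->]]]; rewrite /mderiv p0 normr0.
- by move=> _ [l [x [y [_ _ ->]]]]; rewrite /mderiv p0 subrr normr0 mul0r.
Qed.

End hoelder_lmod.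

(* C_b^alpha(R^(n.+1), W) *)
Section hoelder_type.
Context {R : realType}.
Variables (n : nat) (alpha : R) (W : normedModType R).

Definition hoelder_pred : {pred euclid R n.+1 -> W} :=
  [pred f | `[< is_hoelder alpha f >]].

Fact hoelder_pred_submod : submod_closed hoelder_pred.
Proof.
split; first by rewrite inE; exact: is_hoelder0.
move=> a f g; rewrite !inE => fh gh.
by apply: is_hoelderD => //; exact: is_hoelderZ.
Qed.

HB.instance Definition _ :=
  GRing.isSubmodClosed.Build R (euclid R n.+1 -> W) hoelder_pred
    hoelder_pred_submod.

Record hoelder := Hoelder {
  hoelder_fun :> euclid R n.+1 -> W;
  _ : hoelder_fun \in hoelder_pred }.

HB.instance Definition _ := [isSub for hoelder_fun].
HB.instance Definition _ := [Choice of hoelder by <:].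
HB.instance Definition _ := [SubChoice_isSubLmodule of hoelder by <:].

Lemma hoelderP (f : hoelder) : is_hoelder alpha f.
Proof. by case: f => f fP; exact: asboolW fP. Qed.

Definition hoelder_norm (f : hoelder) : R := fine (hoelder_enorm alpha f).

Lemma hoelder_normE (f : hoelder) :
  (hoelder_norm f)%:E = hoelder_enorm alpha f.
Proof.
rewrite fineK// ge0_fin_numE ?hoelder_enorm_ge0//.
by have [] := hoelderP f.
Qed.

Lemma hoelder_norm_sup (f : hoelder) x : `|f x| <= hoelder_norm f.
Proof. by rewrite -lee_fin hoelder_normE hoelder_enorm_sup. Qed.

Lemma hoelder_normD (f g : hoelder) :
  hoelder_norm (f + g) <= hoelder_norm f + hoelder_norm g.
Proof.
rewrite -lee_fin EFinD !hoelder_normE.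
by apply: hoelder_enormD; [have [] := hoelderP f|have [] := hoelderP g].
Qed.

Lemma hoelder_normZ_le (a : R) (f : hoelder) :
  hoelder_norm (a *: f) <= `|a| * hoelder_norm f.
Proof.
rewrite -lee_fin EFinM !hoelder_normE.
apply: (@hoelder_enorm_comp _ _ _ _ ( *:%R a : {linear W -> W}) `|a|) => //.
  by move=> v; rewrite /= normrZ.
by have [] := hoelderP f.
Qed.

Lemma hoelder_normZ (a : R) (f : hoelder) :
  hoelder_norm (a *: f) = `|a| * hoelder_norm f.
Proof.
apply/eqP; rewrite eq_le hoelder_normZ_le/=.
have [->|a0] := eqVneq a 0.
  by rewrite normr0 mul0r -lee_fin hoelder_normE hoelder_enorm_ge0.
rewrite -ler_pdivlMl ?normr_gt0// -normfV.
by apply: le_trans (hoelder_normZ_le _ _); rewrite scalerA mulVf// scale1r.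
Qed.

Lemma hoelder_norm0_eq0 (f : hoelder) : hoelder_norm f = 0 -> f = 0.
Proof.
move=> f0; apply/val_inj/funext => x; apply/eqP; rewrite -normr_le0.
by apply: le_trans (hoelder_norm_sup f x) _; rewrite f0.
Qed.

HB.instance Definition _ := @Lmodule_isNormed.Build R hoelder hoelder_norm
  hoelder_normD hoelder_normZ hoelder_norm0_eq0.

End hoelder_type.

Section tensor.
Context {R : realType} {d : nat}.
Implicit Types x y : euclid R d.

(* x (x) y as the matrix (x_i y_j)_(i, j) *)
Definition tensor x y : emx R d d := (x : 'rV[R]_d)^T *m (y : 'rV[R]_d).

Lemma norm_tensor x y : `|tensor x y| = `|x| * `|y|.
Proof.
rewrite /Num.norm/= /euclid_norm -sqrtrM; last first.
  by apply: sumr_ge0 => p _; exact: sqr_ge0.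
congr Num.sqrt; rewrite -!(pair_bigA _ (fun i j => _ i j ^+ 2))/=.
rewrite !big_ord1 mulr_suml; apply: eq_bigr => i _.
rewrite mulr_sumr; apply: eq_bigr => j _.
by rewrite mxE big_ord1 mxE exprMn.
Qed.

Fact tensor_linearr x : linear (tensor x).
Proof. by move=> a u v; rewrite /tensor linearP. Qed.

HB.instance Definition _ x :=
  GRing.isLinear.Build R (euclid R d) (emx R d d) _ (tensor x)
    (tensor_linearr x).

Lemma tensor_linearl y : linear (tensor ^~ y).
Proof.
by move=> a u v; rewrite /tensor linearP/= mulmxDl -scalemxAl.
Qed.

End tensor.

Section hoelder_tensor.
Context {R : realType} {n : nat} {alpha : R}.
Local Notation E := (euclid R n.+1).
Local Notation EE := (emx R n.+1 n.+1).
Implicit Types f g : hoelder n alpha E.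

Fact tensor_comp_subproof (u : E) g : (tensor u \o g) \in @hoelder_pred R n alpha EE.
Proof.
rewrite inE; apply: (@is_hoelder_comp _ _ _ _ (tensor u) `|u|) => //.
  by move=> v; rewrite norm_tensor.
exact: hoelderP.
Qed.

(* y |-> u (x) g(y) *)
Definition tensor_comp g (u : E) : hoelder n alpha EE :=
  Hoelder (tensor_comp_subproof u g).

Fact tensor_comp_linear g : linear (tensor_comp g).
Proof. by move=> a u v; apply/val_inj/funext => y /=; rewrite tensor_linearl. Qed.

HB.instance Definition _ g :=
  GRing.isLinear.Build R E (hoelder n alpha EE) _ (tensor_comp g)
    (tensor_comp_linear g).

Fact hoelder_tensor_subproof f g :
  (tensor_comp g \o f) \in @hoelder_pred R n alpha (hoelder n alpha EE).
Proof.
rewrite inE; apply: (@is_hoelder_comp _ _ _ _ (tensor_comp g) `|g|) => //.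
  move=> u; rewrite mulrC -lee_fin EFinM !hoelder_normE.
  apply: (@hoelder_enorm_comp _ _ _ _ (tensor u) `|u|) => //.
    by move=> v; rewrite norm_tensor.
  by have [] := hoelderP g.
exact: hoelderP.
Qed.

(* x |-> (y |-> f(x) (x) g(y)) *)
Definition hoelder_tensor f g : hoelder n alpha (hoelder n alpha EE) :=
  Hoelder (hoelder_tensor_subproof f g).

Lemma hoelder_tensorE f g x y : hoelder_tensor f g x y = tensor (f x) (g y).
Proof. by []. Qed.

(* C_rho^alpha: the support is contained in the closed ball of radius rho *)
Definition hoelder_supported (rho : R) : set (hoelder n alpha E) :=
  [set f | closure [set x | f x != 0] `<=` [set x | `|x| <= rho]].

End hoelder_tensor.

Section time.
Context {R : realType}.
Variable T : R.

Definition time := {t : R | 0 <= t <= T}.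

Definition simplex := {p : time * time | sval p.1 <= sval p.2}.

Definition spx (s t : time) (st : sval s <= sval t) : simplex :=
  exist (fun p => sval p.1 <= sval p.2) (s, t) st.

Fact time0_subproof (t : time) : 0 <= (0 : R) <= T.
Proof. by case: t => t /= /andP[t0 tT]; rewrite lexx (le_trans t0 tT). Qed.

Fact from0_subproof (t : time) : 0 <= sval t.
Proof. by case: t => t /= /andP[]. Qed.

(* the pair (0, t) *)
Definition from0 (t : time) : simplex :=
  @spx (exist _ 0 (time0_subproof t)) t (from0_subproof t).

Definition gap (p : simplex) : R := sval (sval p).2 - sval (sval p).1.

End time.

Section two_param.
Context {R : realType} {T : R} {W : normedModType R}.
Implicit Types (A B : simplex T -> W).

Definition holder_seminorm (beta : R) A : \bar R :=
  ereal_sup [set e | exists p, 0 < gap p /\ e = (`|A p| / gap p `^ beta)%:E].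

Definition increment (X : time T -> W) : simplex T -> W :=
  fun p => X (sval p).2 - X (sval p).1.

Local Notation N beta A := (fine (holder_seminorm beta A)).

Lemma holder_seminorm_le beta A M : 0 <= M ->
  (forall p, 0 < gap p -> `|A p| <= M * gap p `^ beta) ->
  (holder_seminorm beta A < +oo)%E /\ N beta A <= M.
Proof.
move=> M0 AM.
have : (holder_seminorm beta A <= M%:E)%E.
  apply: ge_ereal_sup => _ [p [p0 ->]].
  by rewrite lee_fin ler_pdivrMr ?powR_gt0 ?AM.
by case: (holder_seminorm beta A) => //= r; rewrite lee_fin ltry.
Qed.

Lemma holder_seminorm_bound beta A p : (holder_seminorm beta A < +oo)%E ->
  0 < gap p -> `|A p| <= N beta A * gap p `^ beta.
Proof.
move=> Ay p0; rewrite -ler_pdivrMr ?powR_gt0//.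
have : ((`|A p| / gap p `^ beta)%:E <= holder_seminorm beta A)%E.
  by apply: ereal_sup_ubound; exists p.
by case: (holder_seminorm beta A) Ay => //= r _; rewrite lee_fin.
Qed.

Lemma fine_holder_seminorm_ge0 beta A : 0 <= N beta A.
Proof.
have [[p p0]|np] := pselect (exists p : simplex T, 0 < gap p).
  have : ((`|A p| / gap p `^ beta)%:E <= holder_seminorm beta A)%E.
    by apply: ereal_sup_ubound; exists p.
  move=> h; apply: fine_ge0; apply: le_trans h.
  by rewrite lee_fin divr_ge0// powR_ge0.
rewrite /holder_seminorm (_ : [set e | _] = set0) ?ereal_sup0//.
by apply/seteqP; split=> // e [p [p0 _]]; apply: np; exists p.
Qed.

Lemma holder_seminormB beta A B :
  (holder_seminorm beta A < +oo)%E -> (holder_seminorm beta B < +oo)%E ->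
  (holder_seminorm beta (A - B)%R < +oo)%E /\
  N beta (A - B) <= N beta A + N beta B.
Proof.
move=> Ay By; apply: holder_seminorm_le.
  by rewrite addr_ge0 ?fine_holder_seminorm_ge0.
move=> p p0; rewrite mulrDl (le_trans (ler_normB _ _))//.
by rewrite lerD ?holder_seminorm_bound.
Qed.

Lemma holder_seminorm_sym beta A B :
  (holder_seminorm beta A < +oo)%E -> (holder_seminorm beta B < +oo)%E ->
  N beta (A - B) <= N beta (B - A).
Proof.
move=> Ay By; have [BAy _] := holder_seminormB By Ay.
apply: (holder_seminorm_le _ _).2 => [|p p0].
  exact: fine_holder_seminorm_ge0.
by rewrite !fctE distrC; exact: (holder_seminorm_bound BAy p0).
Qed.

Lemma holder_seminorm_triangle beta A B C :
  (holder_seminorm beta A < +oo)%E -> (holder_seminorm beta B < +oo)%E ->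
  (holder_seminorm beta C < +oo)%E ->
  N beta (A - C) <= N beta (A - B) + N beta (B - C).
Proof.
move=> Ay By Cy; have [ABy _] := holder_seminormB Ay By.
have [BCy _] := holder_seminormB By Cy.
apply: (holder_seminorm_le _ _).2 => [|p p0].
  by rewrite addr_ge0 ?fine_holder_seminorm_ge0.
rewrite mulrDl (_ : (A - C) p = (A - B) p + (B - C) p); last first.
  by rewrite !fctE addrA subrK.
by rewrite (le_trans (ler_normD _ _))// lerD ?holder_seminorm_bound.
Qed.

Lemma incrementB (X Y : time T -> W) :
  increment (X - Y) = increment X - increment Y.
Proof.
apply/funext => p; rewrite /increment !fctE !opprD !opprK addrACA.
by [].
Qed.

End two_param.

Section rough_path_def.
Context {R : realType} {V W : normedModType R}.
Variables (T gamma : R) (tens : V -> V -> W) (A : set V).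

(* the image in W of the algebraic tensor product of A with itself *)
Definition alg_tensor : set W :=
  [set w | exists k (f g : 'I_k -> V),
    (forall i, A (f i) /\ A (g i)) /\ w = \sum_i tens (f i) (g i)].

(* W is meant to be complete, so that this closure is the completion for the
   norm induced by W *)
Definition tensor_space : set W := closure alg_tensor.

Local Notation rough_data := ((time T -> V) * (simplex T -> W))%type.

Definition chen (X : rough_data) : Prop :=
  forall (s u t : time T) (su : sval s <= sval u) (ut : sval u <= sval t),
    X.2 (spx (le_trans su ut)) - X.2 (spx su) - X.2 (spx ut) =
    tens (increment X.1 (spx su)) (increment X.1 (spx ut)).

Definition is_rough_path (X : rough_data) : Prop :=
  [/\ (forall t, A (X.1 t)) /\
        (holder_seminorm gamma (increment X.1) < +oo)%E,
      forall t, sval t = 0 -> X.1 t = 0,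
      (forall p, tensor_space (X.2 p)) /\
        (holder_seminorm (2 * gamma) X.2 < +oo)%E
    & chen X].

(* [fine] loses nothing: both suprema are finite on rough paths,
   and the set of gaps is nonempty as soon as 0 < T. *)
Definition rough_norm (X : rough_data) : R :=
  fine (holder_seminorm gamma (increment X.1)) +
  fine (holder_seminorm (2 * gamma) X.2).

Record rough_path := RoughPath {
  rough_path_data :> rough_data;
  _ : `[< is_rough_path rough_path_data >] }.

HB.instance Definition _ := [isSub for rough_path_data].
HB.instance Definition _ := [Choice of rough_path by <:].

Lemma rough_pathP (X : rough_path) : is_rough_path X.
Proof. by case: X => X XP; exact: asboolW XP. Qed.

Definition rough_dist (X Y : rough_path) : R :=
  rough_norm (rough_path_data X - rough_path_data Y).

Lemma rough_dist_ge0 X Y : 0 <= rough_dist X Y.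
Proof. by rewrite addr_ge0 ?fine_holder_seminorm_ge0. Qed.

Let distE (X Y : rough_path) : rough_dist X Y =
  fine (holder_seminorm gamma (increment X.1 - increment Y.1)) +
  fine (holder_seminorm (2 * gamma) (X.2 - Y.2)).
Proof. by rewrite -incrementB. Qed.

Let finite1 (X : rough_path) :
  (holder_seminorm gamma (increment X.1) < +oo)%E.
Proof. by have [[]] := rough_pathP X. Qed.

Let finite2 (X : rough_path) : (holder_seminorm (2 * gamma) X.2 < +oo)%E.
Proof. by have [_ _ []] := rough_pathP X. Qed.

Lemma rough_distxx X : rough_dist X X = 0.
Proof.
rewrite distE !subrr.
have z (U : normedModType R) b : fine (holder_seminorm b (0 : simplex T -> U)) = 0.
  apply/eqP; rewrite eq_le fine_holder_seminorm_ge0 andbT.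
  by apply: (holder_seminorm_le _ _).2 => // p _; rewrite normr0 mul0r.
by rewrite !z addr0.
Qed.

Lemma rough_dist_eq0 X Y : rough_dist X Y = 0 -> X = Y.
Proof.
rewrite distE => /eqP; rewrite paddr_eq0 ?fine_holder_seminorm_ge0//.
move=> /andP[/eqP d1 /eqP d2].
have [f1 _] := holder_seminormB (finite1 X) (finite1 Y).
have [f2 _] := holder_seminormB (finite2 X) (finite2 Y).
have [_ X0 _ XC] := rough_pathP X; have [_ Y0 _ YC] := rough_pathP Y.
have e1 p : 0 < gap p -> increment X.1 p = increment Y.1 p.
  move=> /(holder_seminorm_bound f1); rewrite d1 mul0r normr_le0 subr_eq0.
  by move/eqP.
have e2 p : 0 < gap p -> X.2 p = Y.2 p.
  move=> /(holder_seminorm_bound f2); rewrite d2 mul0r normr_le0 subr_eq0.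
  by move/eqP.
apply/val_inj; rewrite /= [LHS]surjective_pairing [RHS]surjective_pairing.
congr pair; apply/funext.
  move=> t; have [t0|t0] := eqVneq (sval t) 0; first by rewrite X0// Y0.
  have : 0 < gap (from0 t).
    by rewrite /gap/= subr0 lt_neqAle eq_sym t0 from0_subproof.
  move=> /e1; rewrite /increment/=.
  by rewrite (X0 (exist _ 0 _))// (Y0 (exist _ 0 _))// !subr0.
case=> -[s t] st /=; have [ts|ts] := ltrP 0 (gap (spx st)); first exact: e2.
have {}ts : s = t.
  apply/val_inj/eqP; rewrite eq_le; apply/andP; split => //.
  by move: ts; rewrite /gap/= subr_le0.
move: st; rewrite ts => st.
have E (Z : rough_path) : chen Z -> Z.2 (spx st) = - tens 0 0.
  move=> /(_ t t t st st); rewrite /increment/= subrr => <-.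
  by rewrite (_ : le_trans st st = st) ?subrr ?sub0r ?opprK.
by rewrite -/(spx st) (E _ XC) (E _ YC).
Qed.

Lemma rough_dist_sym X Y : rough_dist X Y = rough_dist Y X.
Proof.
by apply/eqP; rewrite eq_le !distE !lerD ?holder_seminorm_sym.
Qed.

Lemma rough_dist_triangle Y X Z :
  rough_dist X Z <= rough_dist X Y + rough_dist Y Z.
Proof. by rewrite !distE addrACA lerD ?holder_seminorm_triangle. Qed.

HB.instance Definition _ := isMetric.Build R rough_path
  rough_distxx rough_dist_eq0 rough_dist_sym rough_dist_triangle.

End rough_path_def.

(* C^gamma([0,T], C_rho^alpha(R^d, R^d)) with d = n.+1 *)
Notation hoelder_rough_path T gamma n alpha rho :=
  (rough_path T gamma (@hoelder_tensor _ n alpha) (@hoelder_supported _ n alpha rho)).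

(* Rough paths of different regularities are compared through the functions
   (t, x) |-> X_t(x) and (s, t, x, y) |-> XX_(s, t)(x, y). *)
Definition space_time_field (R : realType) (T : R) (n : nat) : Type :=
  ((time T -> euclid R n.+1 -> euclid R n.+1) *
   (simplex T -> euclid R n.+1 -> euclid R n.+1 -> emx R n.+1 n.+1))%type.

Definition field_of (R : realType) (T gamma : R) (n : nat) (alpha rho : R)
    (X : hoelder_rough_path T gamma n alpha rho) : space_time_field T n :=
  (fun t x => X.1 t x, fun p x y => X.2 p x y).

Definition borel_measurable d (Omega : measurableType d) (S : topologicalType)
    (X : Omega -> S) : Prop :=
  forall B : set S, <<s @open S >> B -> measurable (X @^-1` B).

(* The X_k may live on different probability spaces. *)
Definition weak_cvg (R : realType) (S : topologicalType)
    (d_ : nat -> measure_display) (Omega_ : forall k, measurableType (d_ k))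
    (P_ : forall k, probability (Omega_ k) R) (X_ : forall k, Omega_ k -> S)
    d (Omega : measurableType d) (P : probability Omega R) (X : Omega -> S) :
    Prop :=
  forall f : S -> R, continuous f -> (exists M : R, forall x, `|f x| <= M) ->
    (fun k => 'E_(P_ k)[f \o X_ k])%E @ \oo --> ('E_P[f \o X])%E.

Section random_field.
Context {R : realType} {T : R} {n : nat}.
Variable rho : R.

(* Z, seen as a map into C^gamma([0,T], C_rho^alpha), is Y *)
Definition represents (gamma alpha : R) (Omega : Type)
    (Y : Omega -> hoelder_rough_path T gamma n alpha rho)
    (Z : Omega -> space_time_field T n) : Prop :=
  forall omega, field_of (Y omega) = Z omega.

Definition random_rough_path (gamma alpha : R) d (Omega : measurableType d)
    (Z : Omega -> space_time_field T n) : Prop :=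
  exists Y : Omega -> hoelder_rough_path T gamma n alpha rho,
    represents Y Z /\ borel_measurable Y.

(* random variables with values in C^(gamma-)([0,T], C_rho^(alpha-)) *)
Definition random_rough_path_minus (gamma alpha : R) d
    (Omega : measurableType d) (Z : Omega -> space_time_field T n) : Prop :=
  forall gamma' alpha', 0 < gamma' < gamma -> 0 < alpha' < alpha ->
    random_rough_path gamma' alpha' Z.

Definition weak_cvg_in (gamma alpha : R)
    (d_ : nat -> measure_display) (Omega_ : forall k, measurableType (d_ k))
    (P_ : forall k, probability (Omega_ k) R)
    (Z_ : forall k, Omega_ k -> space_time_field T n)
    d (Omega : measurableType d) (P : probability Omega R)
    (Z : Omega -> space_time_field T n) : Prop :=
  exists (Y_ : forall k, Omega_ k -> hoelder_rough_path T gamma n alpha rho)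
         (Y : Omega -> hoelder_rough_path T gamma n alpha rho),
    [/\ forall k, represents (Y_ k) (Z_ k) /\ borel_measurable (Y_ k),
        represents Y Z /\ borel_measurable Y
      & weak_cvg P_ Y_ P Y].

Definition weak_cvg_minus (gamma alpha : R)
    (d_ : nat -> measure_display) (Omega_ : forall k, measurableType (d_ k))
    (P_ : forall k, probability (Omega_ k) R)
    (Z_ : forall k, Omega_ k -> space_time_field T n)
    d (Omega : measurableType d) (P : probability Omega R)
    (Z : Omega -> space_time_field T n) : Prop :=
  forall gamma' alpha', 0 < gamma' < gamma -> 0 < alpha' < alpha ->
    weak_cvg_in gamma' alpha' P_ Z_ P Z.

Definition weak_limit_point_minus (gamma alpha : R)
    (d_ : nat -> measure_display) (Omega_ : forall k, measurableType (d_ k))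
    (P_ : forall k, probability (Omega_ k) R)
    (Z_ : forall k, Omega_ k -> space_time_field T n)
    d (Omega : measurableType d) (P : probability Omega R)
    (Z : Omega -> space_time_field T n) : Prop :=
  random_rough_path_minus gamma alpha Z /\
  exists phi : nat -> nat, {homo phi : i j / (i < j)%N} /\
    weak_cvg_minus gamma alpha
      (fun k => P_ (phi k)) (fun k => Z_ (phi k)) P Z.

(* the vector of the (X_(t_j)(x1_j), XX_(0, t_j)(x1_j, x2_j)) *)
Definition fdd_vector m (t : 'I_m -> time T) (x1 x2 : 'I_m -> euclid R n.+1)
    (Z : space_time_field T n) :
    {ptws 'I_m -> (euclid R n.+1 * emx R n.+1 n.+1)%type} :=
  fun j => (Z.1 (t j) (x1 j), Z.2 (from0 (t j)) (x1 j) (x2 j)).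

Definition equal_fdd
    d1 (Omega1 : measurableType d1) (P1 : probability Omega1 R)
    (Z1 : Omega1 -> space_time_field T n)
    d2 (Omega2 : measurableType d2) (P2 : probability Omega2 R)
    (Z2 : Omega2 -> space_time_field T n) : Prop :=
  forall m (t : 'I_m -> time T) (x1 x2 : 'I_m -> euclid R n.+1),
    (forall i j : 'I_m, (i < j)%N -> sval (t i) < sval (t j)) ->
    forall B, <<s @open {ptws 'I_m -> (euclid R n.+1 * emx R n.+1 n.+1)%type} >> B ->
      P1 ((fdd_vector t x1 x2 \o Z1) @^-1` B) =
      P2 ((fdd_vector t x1 x2 \o Z2) @^-1` B).

End random_field.

(* Main.v *)
(* The time-space points at which a rough path is sampled become dense as the mesh goes
   to zero, and on a ball of the gamma, alpha-norm the rounded samples at a fine mesh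
   determine a rough path up to a small error in every weaker norm, by interpolation. So
   a rough path is coded by the sequence of its rounded samples, an infinite word whose
   letters are bounded on the ball, hence tight by the moment bound. Along a subsequence
   the laws of all finite prefixes converge; the limit word is realised on [0, 1] by
   nested intervals, and decoding it gives a limit of the rough paths in all weaker
   norms at once. The decoding of a random field is determined by its samples, thus its
   law by the finite-dimensional distributions, and all subsequential limits agree. *)
From HB Require Import structures.
Require Import Defs.
From mathcomp Require Import all_boot all_order all_algebra.
From mathcomp Require Import all_classical all_reals all_analysis.
From mathcomp Require Import measurable_realfun ring lra zify.

Set Implicit Arguments.
Unset Strict Implicit.
Unset Printing Implicit Defensive.

Import Order.TTheory GRing.Theory Num.Theory.
Import numFieldNormedType.Exports.

Local Open Scope classical_set_scope.
Local Open Scope ring_scope.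
Local Notation hoelder := Defs.hoelder.

(** Hölder spaces are not separable, so laws are compared only through integer variables, for which
    convergence of each mass to that of a probability suffices. Rounding is discontinuous: the
    letters of a limit need not be limits of the letters. Hence a word is decoded through elements
    that are merely near its letters, with twice the rounding error as tolerance, and the letters of
    the decoded field lead back to the same limit. Those letters depend on the field alone, and the
    finite-dimensional distributions determine their laws. These distributions allow one pair of
    space points per time, at strictly increasing times, and see only the area started at time 0:
    the samples are spread over distinct times, and Chen's relation restores the area between two
    times. The strict loss of exponents enters twice: it turns smallness of values into smallness of
    norms, and it makes bounded sets relatively compact in the weaker metric, so that a continuous
    test function may be replaced there, uniformly, by a function of a single letter. *)

Section zmod_reflection.

(** * Identities in abelian groups by reflection *)

Inductive zexp := ZVar of nat | ZAdd of zexp & zexp | ZOpp of zexp | ZZero.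

Fixpoint zcoef (e : zexp) (i : nat) : int :=
  match e with
  | ZVar j => if i == j then 1 else 0
  | ZAdd a b => zcoef a i + zcoef b i
  | ZOpp a => - zcoef a i
  | ZZero => 0
  end.

Fixpoint zeval (V : zmodType) (env : seq V) (e : zexp) : V :=
  match e with
  | ZVar j => nth 0 env j
  | ZAdd a b => zeval env a + zeval env b
  | ZOpp a => - zeval env a
  | ZZero => 0
  end.

Lemma zevalE (V : zmodType) (env : seq V) e :
  zeval env e = \sum_(i < size env) nth 0 env i *~ zcoef e i.
Proof.
elim: e => [j|a iha b ihb|a iha|] /=; rewrite ?iha ?ihb.
- have [js|js] := ltnP j (size env).
    rewrite (bigD1 (Ordinal js))//= eqxx big1 ?addr0// => i.
    by rewrite -val_eqE/= => /negbTE ->.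
  rewrite nth_default// big1// => i _; case: ifP => // /eqP ij.
  by move: (ltn_ord i); rewrite ij ltnNge js.
- by rewrite -big_split; apply: eq_bigr => i _; rewrite mulrzDr.
- by rewrite -sumrN; apply: eq_bigr => i _; rewrite mulrNz.
- by rewrite big1.
Qed.

(** Comparing integer coefficients decides the identity by computation. Indices below [size env] are
    enough, because a variable beyond the environment evaluates to zero. *)
Lemma zeval_eq (V : zmodType) (env : seq V) e1 e2 :
  all (fun i => zcoef e1 i == zcoef e2 i) (iota 0 (size env)) ->
  zeval env e1 = zeval env e2.
Proof.
move=> /allP h; rewrite !zevalE; apply: eq_bigr => i _.
by rewrite (eqP (h i _))// mem_iota/=.
Qed.

End zmod_reflection.

(* Atoms are compared up to unification, because they may carry different
   canonical structure paths. *)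
Ltac zinsert e l :=
  lazymatch l with
  | nil => constr:(cons e l)
  | cons ?x ?l' =>
    match constr:(tt) with
    | _ => let _ := constr:(erefl x : x = e) in l
    | _ => let l'' := zinsert e l' in constr:(cons x l'')
    end
  end.

Ltac zatoms e l :=
  lazymatch e with
  | (?a + ?b)%R => let l := zatoms a l in zatoms b l
  | (- ?a)%R => zatoms a l
  | 0%R => l
  | _ => zinsert e l
  end.

Ltac zindex e l :=
  lazymatch l with
  | cons ?x ?l' =>
    match constr:(tt) with
    | _ => let _ := constr:(erefl x : x = e) in constr:(0%N)
    | _ => let n := zindex e l' in constr:(S n)
    end
  end.

Ltac zreify e l :=
  lazymatch e with
  | (?a + ?b)%R =>
    let a := zreify a l in let b := zreify b l in constr:(ZAdd a b)
  | (- ?a)%R => let a := zreify a l in constr:(ZOpp a)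
  | 0%R => constr:(ZZero)
  | _ => let n := zindex e l in constr:(ZVar n)
  end.

Ltac zmod :=
  lazymatch goal with
  | |- @eq ?V ?a ?b =>
    let l := zatoms a (@nil V) in
    let l := zatoms b l in
    let ea := zreify a l in
    let eb := zreify b l in
    exact: (@zeval_eq _ l ea eb)
  end.

(** * The mean value inequality in normed spaces *)

Section mean_value.
Context {R : realType}.

(** The radius [d] depends on [t], so a continuity argument is run: let [c] be the supremum of the
    times up to which the bound from 0 holds. The local bound at [c], used to the left, shows that
    the bound holds up to [c]; used to the right, it goes beyond [c] unless [c = 1]. *)
Lemma pointwise_lipschitz (W : normedModType R) (g : R -> W) (M : R) :
  (forall t : R, 0 <= t <= 1 -> exists2 d : R, 0 < d &
    forall s : R, `|s - t| < d -> `|g s - g t| <= M * `|s - t|) ->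
  `|g 1 - g 0| <= M.
Proof.
move=> gM.
pose S := [set t : R | 0 <= t <= 1 /\
  forall s : R, 0 <= s <= t -> `|g s - g 0| <= M * s].
have S0 : S 0.
  split; first by rewrite lexx ler01.
  move=> s; rewrite -eq_le => /eqP <-.
  by rewrite subrr normr0 mulr0.
have Sb : ubound S 1 by move=> t [/andP[]].
have hS : has_sup S by split; [exists 0|exists 1].
pose c := sup S.
have c0 : 0 <= c by apply: ub_le_sup => //; exists 1.
have c1 : c <= 1 by apply: ge_sup => //; exists 0.
have [d d0 cd] := gM c (introT andP (conj c0 c1)).
have cS s : 0 <= s < c -> `|g s - g 0| <= M * s.
  move=> /andP[s0 sc]; rewrite -subr_gt0 in sc.
  have [t [_ St] st] := sup_adherent sc hS.
  by apply: St; rewrite s0 ltW//; move: (st); rewrite -/c opprB addrC subrK.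
have cc : `|g c - g 0| <= M * c.
  move: c0; rewrite le_eqVlt => /predU1P[<-|c0].
    by rewrite subrr normr0 mulr0.
  pose s := Num.max 0 (c - d / 2).
  have s0 : 0 <= s by rewrite le_max lexx.
  have sc : s < c by rewrite gt_max c0/= ltrBlDr ltrDl divr_gt0.
  have sd : `|s - c| < d.
    rewrite distrC ger0_norm ?subr_ge0 1?ltW// ltrBlDr -ltrBlDl lt_max.
    by apply/orP; right; lra.
  have := cd s sd; rewrite [`|s - c|]distrC (ger0_norm (ltW _)) ?subr_gt0// distrC.
  move=> h1; have := cS s; rewrite s0 sc => /(_ isT) h2.
  rewrite -(subrK (g s) (g c)) -addrA (le_trans (ler_normD _ _))//.
  by rewrite (le_trans (lerD h1 h2))// -mulrDr subrK.
have Sc r : 0 <= r < d -> c + r <= 1 -> S (c + r).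
  move=> /andP[r0 rd] cr1; split; first by rewrite cr1 addr_ge0.
  move=> s /andP[s0 sr]; have [sc|cs] := ltP s c.
    by apply: cS; rewrite s0.
  have sd : `|s - c| < d.
    by rewrite ger0_norm ?subr_ge0// (le_lt_trans _ rd)// lerBlDl.
  have := cd s sd; rewrite (ger0_norm (_ : 0 <= s - c)) ?subr_ge0// => h1.
  rewrite -(subrK (g c) (g s)) -addrA (le_trans (ler_normD _ _))//.
  by rewrite (le_trans (lerD h1 cc))// -mulrDr subrK.
move: c1; rewrite le_eqVlt => /predU1P[c1|c1]; first by move: cc; rewrite c1 mulr1.
pose r := Num.min (d / 2) (1 - c).
have r0 : 0 < r by rewrite lt_min divr_gt0//= subr_gt0.
have : S (c + r).
  apply: Sc; last by rewrite -lerBrDl ge_min lexx orbT.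
  rewrite ltW//= gt_min ltr_pdivrMr//.
  by rewrite mulr_natr mulr2n ltrDl d0.
move=> /(ub_le_sup (ex_intro _ 1 Sb)); rewrite -/c -subr_ge0 opprD addrA subrr sub0r.
by rewrite oppr_ge0 leNgt r0.
Qed.

Context {V W : normedModType R}.
Implicit Types (f : V -> W) (x v : V).

(** With the quotient multiplied out, the condition is trivial at [h = 0], so that no punctured
    neighbourhood is left. *)
Lemma derivableP_eps f x v (D : W) : derivable f x v /\ 'D_v f x = D <->
  forall e : R, 0 < e -> exists2 d : R, 0 < d &
    forall h : R, `|h| < d -> `|f (x + h *: v) - f x - h *: D| <= e * `|h|.
Proof.
have E (h : R) : h != 0 -> `|f (x + h *: v) - f x - h *: D| =
    `|h| * `|h^-1 *: (f (h *: v + x) - f x) - D|.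
  move=> h0; rewrite -normrZ scalerBr scalerA divff// scale1r.
  by rewrite [h *: v + x]addrC.
split.
  move=> [fx DE] e e0.
  have := fx; rewrite /derivable => /cvgrPdist_le /(_ e e0).
  rewrite -/('D_v f x) DE => /nbhs_ballP[d /= d0 dP].
  exists d => // h hd; have [->|h0] := eqVneq h 0.
    by rewrite scale0r addr0 subrr scale0r subrr !normr0 mulr0.
  rewrite E// mulrC ler_wpM2r// distrC.
  apply: dP => //; by rewrite /ball/= sub0r normrN.
move=> fD.
have : (fun h => h^-1 *: (((f \o shift x) (h *: v)) - f x)) @ 0^' --> D.
  apply/cvgrPdist_le => e e0; have [d d0 dP] := fD e e0.
  apply/nbhs_ballP; exists d => //= h; rewrite /ball/= sub0r normrN => hd h0.
  have := dP h hd; rewrite E// mulrC ler_pM2r ?normr_gt0//.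
  by rewrite distrC.
by move=> c; split; [apply/cvg_ex; exists D|exact: cvg_lim c].
Qed.

(** The vector [A] is free: the derivative at the centre for remainder estimates, 0 for Lipschitz
    bounds, a limit of derivatives for completeness. The bound comes from the local estimate for [f]
    minus the affine path of slope [A], after an arbitrarily small increase of the constant. *)
Lemma mean_value_le f x v (h : R) (A : W) (M : R) :
  (forall u : R, `|u| <= `|h| -> derivable f (x + u *: v) v /\
     `|'D_v f (x + u *: v) - A| <= M) ->
  `|f (x + h *: v) - f x - h *: A| <= M * `|h|.
Proof.
move=> fM; apply/ler_addgt0Pr => e e0.
have [h0|h0] := eqVneq h 0.
  rewrite h0 scale0r addr0 subrr scale0r subrr !normr0 mulr0 add0r; exact: ltW.
pose g (t : R) := f (x + (t * h) *: v) - (t * h) *: A.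
have hp : 0 < `|h| by rewrite normr_gt0.
have -> : f (x + h *: v) - f x - h *: A = g 1 - g 0.
  by rewrite /g mul1r mul0r !scale0r addr0 subr0 addrAC.
apply: pointwise_lipschitz => t /andP[t0 t1].
have [|dt Mt] := fM (t * h).
  by rewrite normrM ler_piMl// ger0_norm.
(* The quotient [e / |h|] compensates for the rescaling of the segment to the unit interval. *)
have [d d0 dP] := (derivableP_eps _ _ _ _).1 (conj dt erefl) _ (divr_gt0 e0 hp).
exists (d / `|h|); first by rewrite divr_gt0.
move=> s; rewrite ltr_pdivlMr// -normrM => sd.
have := dP _ sd.
rewrite -[x + _ + _]addrA -scalerDl -mulrDl [t + _]addrC subrK => /= h1.
set D := 'D_v f _ in Mt h1.
have -> : g s - g t = (f (x + (s * h) *: v) - f (x + (t * h) *: v)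
    - ((s - t) * h) *: D) + ((s - t) * h) *: (D - A).
  rewrite /g scalerBr addrA subrK mulrBl scalerBl !opprB.
  by rewrite [_ *: A - f _]addrC addrACA [- _ + _ *: A]addrC.
apply: (le_trans (ler_normD _ _)).
rewrite normrZ.
apply: (@le_trans _ _ (e / `|h| * `|(s - t) * h| + `|(s - t) * h| * M)).
  by rewrite lerD// ler_wpM2l.
rewrite normrM.
by rewrite le_eqVlt; apply/orP; left; apply/eqP; field; rewrite gt_eqF.
Qed.

End mean_value.

(** * Symmetry of mixed derivatives *)

Section schwarz.
Context {R : realType} {V W : normedModType R}.

(** The mean value inequality is applied twice: in direction [u] to the difference [phi] of [f]
    along [v], then in direction [v] to the derivative of [f] along [u]. *)
Lemma second_difference (f : V -> W) (u v x : V) :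
  (forall y, derivable f y u) -> (forall y, derivable ('D_u f) y v) ->
  {for x, continuous ('D_v ('D_u f))} ->
  forall e : R, 0 < e -> exists2 d : R, 0 < d & forall h : R, `|h| <= d ->
    `|f (x + h *: u + h *: v) - f (x + h *: u) - (f (x + h *: v) - f x)
      - h *: (h *: 'D_v ('D_u f) x)| <= e * `|h| * `|h|.
Proof.
move=> fu fuv /cvgrPdist_le fc e e0.
have /nbhs_ballP[r /= r0 rP] := fc e e0.
(* A point of the parallelogram spanned by [h u] and [h v] is within [|h| c] of [x]; the summand 1
   keeps [c] positive. *)
pose c := `|u| + `|v| + 1.
have c0 : 0 < c by rewrite ltr_wpDl// addr_ge0.
exists (r / (2 * c)); first by rewrite divr_gt0// mulr_gt0.
move=> h hd.
pose phi y := f (y + h *: v) - f y.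
have near_x (a b : R) : `|a| <= `|h| -> `|b| <= `|h| ->
    `|'D_v ('D_u f) (x + a *: u + b *: v) - 'D_v ('D_u f) x| <= e.
  move=> ah bh; rewrite distrC; apply: rP; rewrite -ball_normE/=.
  rewrite -addrA opprD addrA subrr sub0r normrN.
  apply: (le_lt_trans (ler_normD _ _)); rewrite !normrZ.
  apply: (@le_lt_trans _ _ (`|h| * c)).
    rewrite /c mulrDr mulr1 mulrDr -addrA lerD ?ler_wpM2r//.
    by rewrite -[leLHS]addr0 lerD ?ler_wpM2r.
  rewrite (@le_lt_trans _ _ (r / 2))//; last by lra.
  move: hd; rewrite ler_pdivlMr ?mulr_gt0// [2 * c]mulrC mulrA => hd.
  by rewrite ler_pdivlMr.
have phiD y : derivable phi y u /\ 'D_u phi y = 'D_u f (y + h *: v) - 'D_u f y.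
  apply/derivableP_eps => e1 e10.
  have e120 : 0 < e1 / 2 by rewrite divr_gt0.
  have [d1 d10 d1P] := (derivableP_eps _ _ _ _).1 (conj (fu (y + h *: v)) erefl) _ e120.
  have [d2 d20 d2P] := (derivableP_eps _ _ _ _).1 (conj (fu y) erefl) _ e120.
  exists (Num.min d1 d2); first by rewrite lt_min d10.
  move=> k; rewrite lt_min => /andP[k1 k2].
  rewrite [e1]splitr mulrDl.
  apply: le_trans (lerD (d1P k k1) (d2P k k2)).
  apply: le_trans (ler_normB _ _).
  rewrite /phi le_eqVlt; apply/orP; left; apply/eqP; congr `|_|.
    rewrite scalerBr [y + k *: u + _]addrAC.
  zmod.
have -> : f (x + h *: u + h *: v) - f (x + h *: u) - (f (x + h *: v) - f x) =
  phi (x + h *: u) - phi x by [].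
apply: mean_value_le => a ah; split; first exact: (phiD _).1.
rewrite (phiD _).2.
apply: (@mean_value_le _ _ _ ('D_u f) (x + a *: u) v h) => b bh.
by split; [exact: fuv|exact: near_x].
Qed.

(** The second difference is symmetric in [u] and [v], and either mixed derivative is its
    coefficient at [h ^ 2] up to a small error. *)
Lemma schwarz (f : V -> W) (u v x : V) :
  (forall y, derivable f y u) -> (forall y, derivable f y v) ->
  (forall y, derivable ('D_u f) y v) -> (forall y, derivable ('D_v f) y u) ->
  {for x, continuous ('D_v ('D_u f))} -> {for x, continuous ('D_u ('D_v f))} ->
  'D_v ('D_u f) x = 'D_u ('D_v f) x.
Proof.
move=> fu fv fuv fvu cuv cvu.
apply/eqP; rewrite -subr_eq0 -normr_le0; apply/ler_addgt0Pr => e e0.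
rewrite add0r.
have e20 : 0 < e / 2 by rewrite divr_gt0.
have [d1 d10 d1P] := second_difference fu fuv cuv e20.
have [d2 d20 d2P] := second_difference fv fvu cvu e20.
pose h := Num.min d1 d2.
have h0 : 0 < h by rewrite lt_min d10.
have hE : `|h| = h by rewrite gtr0_norm.
have := d1P h; rewrite hE ge_min lexx => /(_ isT) h1.
have := d2P h; rewrite hE ge_min lexx orbT => /(_ isT) h2.
have := lerD h1 h2; rewrite -2!mulrDl -splitr => h3.
rewrite -(ler_pM2r h0) -(ler_pM2r h0).
apply: le_trans h3.
have -> : `|'D_v ('D_u f) x - 'D_u ('D_v f) x| * h * h =
    `|h *: (h *: 'D_v ('D_u f) x) - h *: (h *: 'D_u ('D_v f) x)|.
  by rewrite -!scalerBr !normrZ hE mulrC [_ * h]mulrC.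
apply: le_trans (ler_normB _ _).
rewrite distrC le_eqVlt; apply/orP; left; apply/eqP; congr `|_|.
rewrite [x + h *: v + _]addrAC.
have -> : f (x + h *: u + h *: v) - f (x + h *: v) - (f (x + h *: u) - f x) =
    f (x + h *: u + h *: v) - f (x + h *: u) - (f (x + h *: v) - f x).
  zmod.
have cancel (X a b : W) : a - b = X - b - (X - a) by zmod.
exact: cancel.
Qed.

End schwarz.

(** * Orders of differentiation and Lipschitz bounds *)

Section partial_derivatives.
Context {R : realType} {n : nat} {W : normedModType R}.
Local Notation E := (euclid R n.+1).
Implicit Types (f : E -> W) (s : seq 'I_n.+1).

(** The Hölder norm controls derivatives in the sorted order [mseq l] only, whereas an induction on
    the order prepends an arbitrary direction. Permuting directions reconciles the two. *)
Lemma pderiv_swap k f s i j : Ck k f -> (size s + 2 <= k)%N ->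
  pderiv (i :: j :: s) f = pderiv (j :: i :: s) f.
Proof.
rewrite addn2 => fk sk; apply/funext => x /=.
have sk1 := ltnW sk; have sk0 := ltnW sk1.
have [_ /(_ sk1) d0] := fk s sk0.
have [_ /(_ sk) di] := fk (i :: s) sk1.
have [_ /(_ sk) dj] := fk (j :: s) sk1.
have [cij _] := fk (i :: j :: s) sk.
have [cji _] := fk (j :: i :: s) sk.
exact: schwarz (d0 j) (d0 i) (dj i) (di j) (cij x) (cji x).
Qed.

Lemma pderiv_rem k f s i : Ck k f -> (size s <= k)%N -> i \in s ->
  pderiv s f = pderiv (i :: rem i s) f.
Proof.
move=> fk; elim: s => [//|a s ih] sk; rewrite inE /=.
rewrite [i == a]eq_sym; have [->//|ai] := eqVneq a i; move=> /= si.
have -> : (fun x => 'D_(basis_vec a) (pderiv s f) x) =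
    pderiv (a :: i :: rem i s) f by rewrite (ih (ltnW sk) si).
apply: (@pderiv_swap k) => //; rewrite size_rem// addn2 prednK//.
by case: (s) si.
Qed.

Lemma pderiv_perm k f s s' : Ck k f -> (size s <= k)%N -> perm_eq s s' ->
  pderiv s f = pderiv s' f.
Proof.
move=> fk; elim: s s' => [|i s ih] s' sk.
  by rewrite perm_sym => /perm_nilP ->.
move=> ss'; have is' : i \in s' by rewrite -(perm_mem ss') mem_head.
rewrite (pderiv_rem fk (_ : (size s' <= k)%N) is') -?(perm_size ss')//=.
rewrite (ih (rem i s') (ltnW sk))//.
by rewrite -(perm_cons i) (perm_trans ss')// perm_to_rem.
Qed.

Lemma count_mseq (l : {ffun 'I_n.+1 -> nat}) i : count_mem i (mseq l) = l i.
Proof.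
rewrite /mseq count_flatten -map_comp sumnE big_map big_enum/=.
rewrite (bigD1 i)//= big1 => [|j ji].
  by rewrite count_nseq/= eqxx mul1n addn0.
by rewrite count_nseq/= (negbTE ji).
Qed.

Lemma perm_mseq s : perm_eq (mseq [ffun i => count_mem i s]) s.
Proof. by apply/allP => i _; rewrite /= count_mseq ffunE. Qed.

Lemma pderiv_mderiv k f s : Ck k f -> (size s <= k)%N ->
  exists2 l, mlen l = size s & pderiv s f = mderiv l f.
Proof.
move=> fk sk; exists [ffun i => count_mem i s].
  by rewrite -size_mseq (perm_size (perm_mseq s)).
by apply: pderiv_perm fk sk _; rewrite perm_sym perm_mseq.
Qed.

Lemma entry_le_norm (m p : nat) (A : emx R m p) i j :
  `|(A : 'M[R]_(m, p)) i j| <= `|A|.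
Proof.
rewrite [leRHS]/Num.norm/= /euclid_norm -sqrtr_sqr ler_wsqrtr//.
rewrite (bigD1 (i, j))//= lerDl; apply: sumr_ge0 => q _; exact: sqr_ge0.
Qed.

Lemma norm_le_entries (m p : nat) (A : emx R m p) (a : R) : 0 <= a ->
  (forall i j, `|(A : 'M[R]_(m, p)) i j| <= a) -> `|A| <= (m * p)%:R * a.
Proof.
move=> a0 Aa; rewrite [leLHS]/Num.norm/= /euclid_norm.
have mpa0 : 0 <= (m * p)%:R * a by rewrite mulr_ge0.
rewrite -(ger0_norm mpa0) -sqrtr_sqr ler_wsqrtr//.
apply: (@le_trans _ _ (\sum_(q : 'I_m * 'I_p) a ^+ 2)).
  apply: ler_sum => q _; rewrite -real_normK ?num_real// ler_pXn2r ?nnegrE//.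
rewrite sumr_const card_prod !card_ord exprMn -[leLHS]mulr_natl ler_wpM2r ?sqr_ge0//.
by rewrite -natrX ler_nat; case: (m * p)%N => // k; rewrite leq_pmulr.
Qed.

(** One walks from [y] to [x] along one coordinate at a time; each of the [n + 1] legs costs at most
    [N] times the distance of [x] and [y]. *)
Lemma lipschitz_partial f (N : R) :
  (forall x i, derivable f x (basis_vec i) /\ `|'D_(basis_vec i) f x| <= N) ->
  forall x y, `|f x - f y| <= n.+1%:R * N * `|x - y|.
Proof.
move=> fN x y.
have N0 : 0 <= N by apply: le_trans (fN 0 ord0).2.
pose d : E := x - y.
have steps s : `|f (y + \sum_(i <- s) (d : 'rV[R]_n.+1) 0 i *: basis_vec i) - f y| <=
    (size s)%:R * (N * `|d|).
  elim: s => [|i s ih]; first by rewrite big_nil addr0 subrr normr0 mul0r.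
  rewrite big_cons addrCA [_ *: _ + _]addrC.
  set z := y + \sum_(_ <- _) _ in ih *.
  rewrite -(subrK (f z) (f (z + _))) -addrA (le_trans (ler_normD _ _))//.
  have -> : (size (i :: s))%:R = 1 + (size s)%:R :> R by rewrite -(natrD _ 1).
  rewrite mulrDl mul1r lerD//.
  have := @mean_value_le _ _ _ f z (basis_vec i) ((d : 'rV[R]_n.+1) 0 i) 0 N.
  rewrite scaler0 subr0 => h; apply: le_trans (h _) _.
    by move=> u _; split; [exact: (fN _ _).1|rewrite subr0; exact: (fN _ _).2].
  by rewrite ler_wpM2l// entry_le_norm.
have := steps (enum 'I_n.+1).
rewrite size_enum_ord big_enum -mulrA/=.
suff -> : y + \sum_(i : 'I_n.+1) (d : 'rV[R]_n.+1) 0 i *: basis_vec i = x by [].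
have <- : d = \sum_(i : 'I_n.+1) (d : 'rV[R]_n.+1) 0 i *: basis_vec i.
  exact: (@row_sum_delta R n.+1 d).
by rewrite /d addrC subrK.
Qed.

End partial_derivatives.

(** * Smallness of powers *)

Section powR_smallness.
Context {R : realType}.
Implicit Types (b M e r : R).

Lemma powR_small b M e : 0 < b -> 0 < e ->
  exists2 h : R, 0 < h & forall r : R, 0 <= r <= h -> M * r `^ b <= e.
Proof.
move=> b0 e0; pose c := e / (`|M| + 1).
have M0 : 0 < `|M| + 1 by rewrite ltr_wpDl.
have c0 : 0 < c by rewrite divr_gt0.
exists (c `^ b^-1); first by rewrite powR_gt0.
move=> r /andP[r0 rh]; apply: (@le_trans _ _ ((`|M| + 1) * r `^ b)).
  rewrite ler_wpM2r ?powR_ge0// (le_trans (ler_norm _))// lerDl//.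
rewrite mulrC -ler_pdivlMr// -/c.
have -> : c = (c `^ b^-1) `^ b by rewrite -powRrM mulVf ?gt_eqF// powRr1// ltW.
by rewrite ge0_ler_powR ?nnegrE ?powR_ge0// ltW.
Qed.

(** Below a threshold [h] the factor [r ^ (b - b')] is small enough to absorb [M]; above it,
    [r ^ b'] is at least [h ^ b'] and the uniform bound [d] suffices. *)
Lemma powR_interpolation b b' M e : 0 <= b' < b -> 0 < e ->
  exists2 d : R, 0 < d & forall a r : R, 0 <= r ->
    a <= M * r `^ b -> a <= d -> a <= e * r `^ b'.
Proof.
move=> /andP[b'0 bb'] e0.
have [||h h0 hP] := @powR_small (b - b') M e => //; first by rewrite subr_gt0.
exists (e * h `^ b'); first by rewrite mulr_gt0 ?powR_gt0.
move=> a r r0 aM ad; have [rh|hr] := leP r h; last first.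
  apply: le_trans ad _; rewrite ler_wpM2l//; first exact: ltW.
  by rewrite ge0_ler_powR ?nnegrE//; apply/ltW.
apply: le_trans aM _.
move: r0; rewrite le_eqVlt => /predU1P[<-|r0].
  rewrite powR0 ?mulr0; first by rewrite mulr_ge0 ?powR_ge0// ltW.
  by rewrite gt_eqF// (le_lt_trans b'0).
have -> : r `^ b = r `^ (b - b') * r `^ b'.
  by rewrite -powRD ?subrK//; apply/implyP => _; rewrite gt_eqF.
by rewrite mulrA ler_wpM2r ?powR_ge0// hP// rh ltW.
Qed.

End powR_smallness.

(** * Bounds on derivatives by the Hölder norm *)

Section hoelder_bounds.
Context {R : realType} {n : nat} {alpha : R} {W : normedModType R}.
Local Notation E := (euclid R n.+1).
Local Notation k := (Num.truncn alpha).
Implicit Types (f g : hoelder n alpha W) (s : seq 'I_n.+1).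

Lemma hoelder_Ck f : Ck k f.
Proof. by have [] := hoelderP f. Qed.

Lemma mderiv_le_norm f l x : (mlen l <= k)%N -> `|mderiv l f x| <= `|f|.
Proof.
move=> lk; rewrite -lee_fin (hoelder_normE f).
apply: (@le_trans _ _ (deriv_sup k f)).
  by apply: ereal_sup_ubound; exists l, x.
by rewrite leeDl// deriv_hoelder_sup_ge0.
Qed.

Lemma mderiv_hoelder f l x y : mlen l = k ->
  `|mderiv l f x - mderiv l f y| <= `|f| * `|x - y| `^ (alpha - k%:R).
Proof.
move=> lk; have [->|xy] := eqVneq x y.
  by rewrite !subrr normr0 mulr_ge0// powR_ge0.
rewrite -ler_pdivrMr ?powR_gt0 ?normr_gt0 ?subr_eq0//.
rewrite -lee_fin (hoelder_normE f).
apply: (@le_trans _ _ (deriv_hoelder_sup k (alpha - k%:R) f)).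
  by apply: ereal_sup_ubound; exists l, x, y.
by rewrite leeDr// deriv_sup_ge0.
Qed.

Lemma pderiv_le_norm f s x : (size s <= k)%N -> `|pderiv s f x| <= `|f|.
Proof.
move=> sk; have [l ls ->] := pderiv_mderiv (hoelder_Ck f) sk.
by apply: mderiv_le_norm; rewrite ls.
Qed.

(** Below the top order, the bounded derivatives of the next order give a Lipschitz bound; only at
    the top order does the Hölder seminorm decide. *)
Definition modulus_exponent (j : nat) : R :=
  if (j < k)%N then 1 else alpha - k%:R.

Lemma pderiv_modulus f s x y : (size s <= k)%N ->
  `|pderiv s f x - pderiv s f y| <=
    n.+1%:R * `|f| * `|x - y| `^ modulus_exponent (size s).
Proof.
move=> sk; rewrite /modulus_exponent; case: ltnP => ks.
  rewrite powRr1//; apply: lipschitz_partial => z i; split.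
    by have [_ /(_ ks)] := hoelder_Ck f sk.
  exact: (pderiv_le_norm f (s := i :: s)).
have [l ls ->] := pderiv_mderiv (hoelder_Ck f) sk.
apply: (le_trans (mderiv_hoelder f _ _ _)).
  by apply/eqP; rewrite ls eqn_leq sk ks.
by rewrite ler_wpM2r ?powR_ge0// ler_peMl// ler1n.
Qed.

Lemma norm_basis_vec i : `|basis_vec i : E| = 1.
Proof.
rewrite [LHS]/Num.norm/= /euclid_norm (bigD1 (0, i))//= big1 => [|[a b] abi].
  by rewrite mxE !eqxx addr0 expr1n sqrtr1.
rewrite mxE/=; move: abi; rewrite -pair_eqE/= ord1 eqxx/= => /negbTE ->.
by rewrite expr0n.
Qed.

Lemma hoelder_enorm_le (f : E -> W) (a b : R) :
  (forall l x, (mlen l <= k)%N -> `|mderiv l f x| <= a) ->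
  (forall l x y, mlen l = k ->
    `|mderiv l f x - mderiv l f y| <= b * `|x - y| `^ (alpha - k%:R)) ->
  (hoelder_enorm alpha f <= (a + b)%:E)%E.
Proof.
move=> fa fb; rewrite EFinD; apply: leeD; apply: ge_ereal_sup.
  by move=> _ [l [x [lk ->]]]; rewrite lee_fin fa.
move=> _ [l [x [y [lk xy ->]]]]; rewrite lee_fin.
by rewrite ler_pdivrMr ?fb// powR_gt0// normr_gt0 subr_eq0.
Qed.

End hoelder_bounds.

Arguments modulus_exponent {R} alpha j.

(** * Interpolation between Hölder norms *)

Section hoelder_interpolation.
Context {R : realType} {n : nat} (alpha alpha' : R) (W : normedModType R).
Hypothesis alphas : 0 < alpha' < alpha.
Local Notation E := (euclid R n.+1).
Local Notation k := (Num.truncn alpha).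
Local Notation k' := (Num.truncn alpha').

Let alpha'0 : 0 <= alpha'. Proof. by case/andP: alphas => /ltW. Qed.
Let alpha0 : 0 <= alpha.
Proof. by case/andP: alphas => h1 h2; rewrite ltW// (lt_trans h1). Qed.

Lemma leq_truncn : (k' <= k)%N.
Proof. by apply: le_truncn; case/andP: alphas => _ /ltW. Qed.

(** At an integer [alpha] the exponent of order [k] is 0, but then [alpha' < alpha] forces [k' < k],
    and the orders up to [k'] have exponent 1. *)
Let exponent_lt j : (j <= k')%N ->
  0 < modulus_exponent alpha j /\
  (j = k' -> 0 <= alpha' - k'%:R < modulus_exponent alpha j).
Proof.
move=> jk'; rewrite /modulus_exponent.
have /andP[t0 t1] := truncn_itv alpha'0.
have a1 : alpha' - k'%:R < 1 by rewrite ltrBlDr -(natrD _ 1) add1n.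
have a0 : 0 <= alpha' - k'%:R by rewrite subr_ge0.
case: ltnP => [jk|kj]; first by split=> // _; rewrite a0 a1.
have kk : k = k' by apply/eqP; rewrite eqn_leq leq_truncn (leq_trans kj jk').
rewrite kk; have lt : alpha' - k'%:R < alpha - k'%:R.
  by rewrite ltrD2r; case/andP: alphas.
by split=> [|_]; [exact: le_lt_trans lt|rewrite a0 lt].
Qed.

(** A derivative is a difference quotient of step [h], up to an error governed by its own modulus of
    continuity. The step is fixed first, from the norm bound [M]; the quotient is then made small by
    the induction hypothesis. *)
Lemma small_pderiv j (M e : R) : (j <= k')%N -> 0 < e ->
  exists2 d : R, 0 < d & forall f : hoelder n alpha W, `|f| <= M ->
    (forall x, `|f x| <= d) ->
    forall s x, (size s <= j)%N -> `|pderiv s f x| <= e.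
Proof.
elim: j e => [|j ih] e jk e0.
  by exists e => // f fM fe s x; rewrite leqn0 => /eqP/size0nil ->; exact: fe.
have [b0 _] := exponent_lt jk.
have e20 : 0 < e / 2 by rewrite divr_gt0.
have [h h0 hP] := powR_small (n.+1%:R * M) b0 e20.
(* Two values of size [e h / 4], divided by [h], contribute [e / 2]; the modulus contributes the
   other half. *)
have e40 : 0 < e * h / 4 by rewrite divr_gt0// mulr_gt0.
have [d d0 dP] := ih _ (ltnW jk) e40.
have [d' d'0 d'P] := ih _ (ltnW jk) e0.
exists (Num.min d d'); first by rewrite lt_min d0.
move=> f fM fdd' s x.
have fd y : `|f y| <= d by apply: le_trans (fdd' y) _; rewrite ge_min lexx.
have fd' y : `|f y| <= d'.
  by apply: le_trans (fdd' y) _; rewrite ge_min lexx orbT.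
rewrite leq_eqVlt ltnS => /predU1P[|sj]; last exact: d'P.
case: s => [//|i s] [sj].
have sk : (size (i :: s) <= k)%N.
  by rewrite /= sj (leq_trans jk)// leq_truncn.
have [_ /(_ sk) ds] := hoelder_Ck f (ltnW sk).
have := @mean_value_le _ _ _ (pderiv s f) x (basis_vec i) h
  (pderiv (i :: s) f x) (e / 2).
rewrite gtr0_norm// => mv.
have {}mv : `|pderiv s f (x + h *: basis_vec i) - pderiv s f x -
    h *: pderiv (i :: s) f x| <= e / 2 * h.
  apply: mv => u uh; split; first exact: ds.
  apply: (le_trans (@pderiv_modulus _ _ _ _ f (i :: s) (x + u *: basis_vec i) x sk)).
  rewrite addrAC subrr add0r normrZ norm_basis_vec mulr1.
  rewrite /= sj; apply: le_trans (hP `|u| _); last by rewrite uh normr_ge0.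
  by rewrite ler_wpM2r ?powR_ge0// ler_wpM2l.
rewrite -(ler_pM2r h0) mulrC -{1}(gtr0_norm h0) -normrZ.
set g := pderiv s f in mv *.
set D := h *: pderiv _ _ _ in mv *.
have -> : D = g (x + h *: basis_vec i) - g x - (g (x + h *: basis_vec i) - g x - D).
  have cancel (X Y : W) : X = Y - (Y - X) by zmod.
  exact: cancel.
have g1 := dP f fM fd s (x + h *: basis_vec i) (eq_leq sj).
have g2 := dP f fM fd s x (eq_leq sj).
apply: (le_trans (ler_normB _ _)).
have := le_trans (ler_normB (g (x + h *: basis_vec i)) (g x)) (lerD g1 g2).
by move: mv; set p := `|_|; set q := `|_|; lra.
Qed.

Lemma hoelder_interpolation (M e : R) : 0 < e ->
  exists2 d : R, 0 < d & forall f : hoelder n alpha W, `|f| <= M ->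
    (forall x, `|f x| <= d) -> (hoelder_enorm alpha' f <= e%:E)%E.
Proof.
move=> e0.
have e20 : 0 < e / 2 by rewrite divr_gt0.
have [_ /(_ erefl) bk] := exponent_lt (leqnn k').
have [c c0 cP] := powR_interpolation (n.+1%:R * M) bk e20.
(* The part [e / 2] serves the sup of the derivatives. The part [c / 2] makes differences of top
   derivatives at most [c], as required for the Hölder quotient. *)
have ec0 : 0 < Num.min (e / 2) (c / 2) by rewrite lt_min e20 divr_gt0.
have [d d0 dP] := small_pderiv M (leqnn k') ec0.
have {}dP (f : hoelder n alpha W) : `|f| <= M -> (forall x, `|f x| <= d) ->
    forall l x, (mlen l <= k')%N -> `|mderiv l f x| <= Num.min (e / 2) (c / 2).
  by move=> fM fd l x lk; apply: dP => //; rewrite size_mseq.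
exists d => // f fM fd.
rewrite [e]splitr; apply: hoelder_enorm_le => [l x lk|l x y lk].
  have := dP f fM fd l x lk.
  by rewrite le_min => /andP[].
apply: cP => //.
  have := @pderiv_modulus _ _ _ _ f (mseq l) x y.
  rewrite size_mseq lk leq_truncn => /(_ isT) h; apply: le_trans h _.
  by rewrite ler_wpM2r ?powR_ge0// ler_wpM2l.
have h z : `|mderiv l f z| <= c / 2.
  have := dP f fM fd l z (eq_leq lk).
  by rewrite le_min => /andP[].
by rewrite [c]splitr (le_trans (ler_normB _ _))// lerD.
Qed.

End hoelder_interpolation.

(** * Embedding into weaker Hölder spaces *)

Section hoelder_lower.
Context {R : realType} {n : nat} {alpha alpha' : R} {W : normedModType R}.
Hypothesis alphas : 0 < alpha' < alpha.
Local Notation E := (euclid R n.+1).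
Local Notation k := (Num.truncn alpha).
Local Notation k' := (Num.truncn alpha').

Lemma Ck_leq j l (f : E -> W) : (j <= l)%N -> Ck l f -> Ck j f.
Proof.
move=> jl fl s sj; have [cf df] := fl s (leq_trans sj jl).
by split=> // sj'; apply: df; exact: leq_trans jl.
Qed.

(** Interpolation with both constants equal to 1 applies to the multiple of [f] of norm [min 1 d],
    whose values are automatically bounded by [d]; homogeneity undoes the scaling. *)
Lemma hoelder_embedding : exists2 C : R, 0 < C &
  forall f : hoelder n alpha W, (hoelder_enorm alpha' f <= (C * `|f|)%:E)%E.
Proof.
have [d d0 dP] := @hoelder_interpolation R n _ _ W alphas 1 1 ltr01.
pose c := Num.min 1 d.
have c0 : 0 < c by rewrite lt_min ltr01.
exists c^-1; first by rewrite invr_gt0.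
move=> f; have [f0|f0] := eqVneq `|f| 0.
  have -> : (f : E -> W) = 0 *: (f : E -> W).
    apply/funext => x; apply/eqP; rewrite -subr_eq0 !fctE scale0r subr0.
    by rewrite -normr_le0 -f0; exact: hoelder_norm_sup.
  apply: le_trans (@hoelder_enorm_comp _ _ _ _
    ( *:%R 0 : {linear W -> W}) 0 _ _ _ _ _) _ => //.
  - by move=> v; rewrite /= scale0r normr0 mul0r.
  - exact: Ck_leq (leq_truncn alphas) (hoelder_Ck f).
  - by rewrite mul0e lee_fin f0 mulr0.
have fp : 0 < `|f| by rewrite lt_neqAle eq_sym f0/=.
pose g := (c / `|f|) *: f.
have gc : `|g| = c by rewrite normrZ gtr0_norm ?divr_gt0// divfK.
have g1 : (hoelder_enorm alpha' g <= 1%:E)%E.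
  apply: dP; first by rewrite gc ge_min lexx.
  move=> x; apply: (le_trans (hoelder_norm_sup g x)).
  by rewrite -[hoelder_norm g]/(`|g|) gc ge_min lexx orbT.
have -> : (f : E -> W) = (`|f| / c) *: (g : E -> W).
  apply/funext => x; rewrite /g !fctE scalerA.
  have -> : `|f| / c * (c / `|f|) = 1 by field; rewrite !gt_eqF.
  by rewrite scale1r.
apply: le_trans (@hoelder_enorm_comp _ _ _ _
    ( *:%R (`|f| / c) : {linear W -> W}) (`|f| / c) _ _ _ _ _) _ => //.
- by move=> v; rewrite /= normrZ gtr0_norm// divr_gt0.
- by rewrite divr_ge0// ltW.
- exact: Ck_leq (leq_truncn alphas) (hoelder_Ck g).
- apply: (@le_trans _ _ ((`|f| / c)%:E * 1%:E)%E).
    by rewrite lee_wpmul2l// lee_fin divr_ge0// ltW.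
  by rewrite -EFinM mulr1 lee_fin mulrC.
Qed.

Fact lower_subproof (f : hoelder n alpha W) :
  (f : E -> W) \in @hoelder_pred R n alpha' W.
Proof.
rewrite inE; split; first exact: Ck_leq (leq_truncn alphas) (hoelder_Ck f).
by have [C _ CP] := hoelder_embedding; rewrite (le_lt_trans (CP f))// ltry.
Qed.

Definition lower (f : hoelder n alpha W) : hoelder n alpha' W :=
  Hoelder (lower_subproof f).

Fact lower_linear : linear lower.
Proof. by move=> a f g; apply/val_inj. Qed.

HB.instance Definition _ :=
  GRing.isLinear.Build R (hoelder n alpha W) (hoelder n alpha' W) _ lower
    lower_linear.

Lemma lower_le (f : hoelder n alpha W) (e : R) :
  (hoelder_enorm alpha' f <= e%:E)%E -> `|lower f| <= e.
Proof. by rewrite -lee_fin [`|_|%:E](hoelder_normE (lower f)). Qed.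

Lemma lower_bounded : exists2 C : R, 0 < C &
  forall f : hoelder n alpha W, `|lower f| <= C * `|f|.
Proof.
have [C C0 CP] := hoelder_embedding; exists C => // f; exact: lower_le.
Qed.

Lemma lower_small (M e : R) : 0 < e ->
  exists2 d : R, 0 < d & forall f : hoelder n alpha W, `|f| <= M ->
    (forall x, `|f x| <= d) -> `|lower f| <= e.
Proof.
move=> e0; have [d d0 dP] := @hoelder_interpolation R n _ _ W alphas M e e0.
by exists d => // f fM fd; apply/lower_le/dP.
Qed.

End hoelder_lower.

(** * Completeness of Hölder spaces *)

Section sequential_completeness.
Context {R : realType}.

Lemma cvg_seqP (W : normedModType R) (u : nat -> W) (l : W) :
  u @ \oo --> l <-> forall e : R, 0 < e ->
    exists N, forall i, (N <= i)%N -> `|u i - l| <= e.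
Proof.
split=> [/cvgrPdist_le ul e e0|ul].
  have [N _ NP] := ul e e0; exists N => i Ni; rewrite distrC; exact: NP.
apply/cvgrPdist_le => e e0; have [N NP] := ul e e0.
by exists N => // i Ni; rewrite distrC; exact: NP.
Qed.

Definition cauchy_sequence (W : normedModType R) (u : nat -> W) :=
  forall e : R, 0 < e -> exists N, forall i j, (N <= i)%N -> (N <= j)%N ->
    `|u i - u j| <= e.

(** A predicate rather than a structure, so that completeness passes from the values to the Hölder
    functions and, applied twice, to the space of areas. *)
Definition seq_complete (W : normedModType R) :=
  forall u : nat -> W, cauchy_sequence u -> cvgn u.

Lemma real_seq_complete : seq_complete R.
Proof.
move=> u uC; apply/cauchy_cvgP/cauchy_ballP => e e0.
have e20 : 0 < e / 2 by rewrite divr_gt0.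
have [N NP] := uC _ e20.
pose A := [set v | exists2 i, (N <= i)%N & v = u i].
have uA : (u @ \oo) A by exists N => // i Ni; exists i.
exists (A, A); first by split.
move=> [_ _] [[i Ni ->] [j Nj ->]]; rewrite -ball_normE/=.
by rewrite (@le_lt_trans _ _ (e / 2)) ?NP//; lra.
Qed.

Lemma emx_seq_complete m p : seq_complete (emx R m p).
Proof.
move=> u uC.
have ec i j : cvgn (fun k => (u k : 'M[R]_(m, p)) i j).
  apply: real_seq_complete => e e0; have [N NP] := uC e e0.
  exists N => k l Nk Nl; apply: le_trans (NP k l Nk Nl).
  by have := entry_le_norm (u k - u l) i j; rewrite !mxE.
pose l : emx R m p := \matrix_(i, j) limn (fun k => (u k : 'M[R]_(m, p)) i j).
apply/cvg_ex; exists l; apply/cvg_seqP => e e0.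
have c0 : 0 < (m * p)%:R + 1 :> R by rewrite ltr_wpDl.
have ec0 : 0 < e / ((m * p)%:R + 1) by rewrite divr_gt0.
have [N NP] : exists N, forall q : 'I_m * 'I_p, forall k, (N <= k)%N ->
    `|(u k : 'M[R]_(m, p)) q.1 q.2 - limn (fun k => (u k : 'M[R]_(m, p)) q.1 q.2)| <=
    e / ((m * p)%:R + 1).
  have /choice[f fP] q := (cvg_seqP _ _).1 (ec q.1 q.2) _ ec0.
  exists (\max_q f q) => q k qk; apply: fP.
  by apply: leq_trans qk; exact: leq_bigmax.
exists N => k Nk.
apply: (@le_trans _ _ ((m * p)%:R * (e / ((m * p)%:R + 1)))).
  apply: norm_le_entries; first exact: ltW.
  by move=> i j; have := NP (i, j) k Nk; rewrite /l !mxE.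
by rewrite mulrCA ler_piMr ?(ltW e0)// ler_pdivrMr// mul1r lerDl.
Qed.

End sequential_completeness.

Section hoelder_complete.
Context {R : realType} {n : nat} {alpha : R} {W : normedModType R}.
Local Notation E := (euclid R n.+1).
Local Notation k := (Num.truncn alpha).
Implicit Types (f g : hoelder n alpha W) (s : seq 'I_n.+1).

Lemma CkN j (f : E -> W) : Ck j f -> Ck j ((-1 : R) *: f).
Proof.
move=> fj; apply: (@Ck_comp _ _ _ _ ( *:%R (-1) : {linear W -> W}) 1) => // v.
by rewrite /= normrZ normrN1.
Qed.

Lemma CkB j (f g : E -> W) : Ck j f -> Ck j g -> Ck j (f - g).
Proof. by move=> fj gj; rewrite -scaleN1r; apply: CkD => //; exact: CkN. Qed.

Lemma pderivB j s (f g : E -> W) : Ck j f -> Ck j g -> (size s <= j)%N ->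
  pderiv s (f - g) = pderiv s f - pderiv s g.
Proof.
move=> fj gj sj; have gN := CkN gj.
have -> : f - g = f + (-1 : R) *: g by rewrite scaleN1r.
rewrite (pderivD fj gN)//; congr (_ + _).
rewrite -[RHS]scaleN1r.
apply: (@pderiv_comp _ _ _ _ ( *:%R (-1) : {linear W -> W}) 1 _ j) => // v.
by rewrite /= normrZ normrN1.
Qed.

Lemma hoelder_pderivB f g s x : (size s <= k)%N ->
  pderiv s (f - g) x = pderiv s f x - pderiv s g x.
Proof. by move=> sk; rewrite (pderivB (hoelder_Ck f) (hoelder_Ck g) sk). Qed.

(** All derivatives up to order [k] converge uniformly to functions [G s]. The mean value inequality
    identifies [G (i :: s)] as a derivative of [G s], and the Hölder quotients of [u j - u i] pass
    to the limit in [j] pointwise. *)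
Lemma hoelder_seq_complete : seq_complete W -> seq_complete (hoelder n alpha W).
Proof.
move=> Wc u uC.
have uC_ s x : (size s <= k)%N -> cvgn (fun i => pderiv s (u i) x).
  move=> sk; apply: Wc => e e0; have [N NP] := uC e e0.
  exists N => i j Ni Nj; rewrite -hoelder_pderivB//.
  by apply: le_trans (NP i j Ni Nj); exact: (pderiv_le_norm (u i - u j)).
pose G s x := limn (fun i => pderiv s (u i) x).
have GP e : 0 < e -> exists N, forall i s x, (N <= i)%N -> (size s <= k)%N ->
    `|pderiv s (u i) x - G s x| <= e.
  move=> e0; have [N NP] := uC e e0; exists N => i s x Ni sk.
  apply/ler_addgt0Pr => e' e'0.
  have [N' N'P] := (cvg_seqP _ _).1 (uC_ s x sk) e' e'0.
  pose j := maxn N N'.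
  rewrite -(subrK (pderiv s (u j) x) (pderiv s (u i) x)) -addrA.
  apply: (le_trans (ler_normD _ _)); apply: lerD; last first.
    by apply: N'P; rewrite leq_maxr.
  rewrite -hoelder_pderivB//.
  apply: le_trans (NP i j Ni (leq_maxl _ _)).
  exact: (pderiv_le_norm (u i - u j)).
have Gcont s : (size s <= k)%N -> continuous (G s).
  move=> sk x; apply/(@cvgrPdist_le _ W _ (nbhs x) _ (G s)) => e e0.
  have e30 : 0 < e / 3 by rewrite divr_gt0.
  have [N NP] := GP _ e30.
  have /cvgrPdist_le/(_ _ e30) := (hoelder_Ck (u N) sk).1 x.
  apply: filterS => y h.
  have hx := NP N s x (leqnn N) sk; have hy := NP N s y (leqnn N) sk.
  set a := pderiv _ _ _ in h hx; set b := pderiv _ _ _ in h hy.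
  have -> : G s x - G s y = (a - b) - (a - G s x) + (b - G s y).
    have zm (p q r t : W) : p - q = (r - t) - (r - p) + (t - q) by zmod.
    exact: zm.
  rewrite (le_trans (ler_normD _ _))//.
  have := ler_normB (a - b) (a - G s x).
  move: h hx hy; set p1 := `|_|; set p2 := `|_|; set p3 := `|_|.
  by set p4 := `|_|; lra.
have Gder s i x : (size s < k)%N ->
    derivable (G s) x (basis_vec i) /\ 'D_(basis_vec i) (G s) x = G (i :: s) x.
  move=> sk; apply/derivableP_eps => e e0.
  have e40 : 0 < e / 4 by rewrite divr_gt0.
  have [N NP] := GP _ e40.
  have /cvgrPdist_le/(_ _ e40)/nbhs_ballP[d /= d0 dP] := Gcont (i :: s) sk x.
  (* With [h] fixed, the values at the two end points are replaced by those of [u j] at a cost [e']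
     unrelated to [h], which tends to 0 afterwards. *)
  exists d => // h hd; apply/ler_addgt0Pr => e' e'0.
  have e'20 : 0 < e' / 2 by rewrite divr_gt0.
  have [N' N'P] := GP _ e'20; pose j := maxn N N'.
  have [_ /(_ sk) ds] := hoelder_Ck (u j) (ltnW sk).
  have mv : `|pderiv s (u j) (x + h *: basis_vec i) - pderiv s (u j) x -
      h *: G (i :: s) x| <= e * `|h|.
    apply: mean_value_le => t th; split; first exact: ds.
    have := NP j (i :: s) (x + t *: basis_vec i) (leq_maxl _ _) sk.
    have : `|G (i :: s) x - G (i :: s) (x + t *: basis_vec i)| <= e / 4.
      apply: dP; rewrite -ball_normE/= opprD addrA subrr sub0r normrN normrZ.
      by rewrite norm_basis_vec mulr1 (le_lt_trans th).
    rewrite distrC => h1 h2.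
    have := lerD h2 h1 => h3; apply: le_trans (le_trans _ h3) _; last by lra.
    apply: le_trans (ler_normD _ _); rewrite addrA subrK; exact: lexx.
  have n1 := N'P j s (x + h *: basis_vec i) (leq_maxr _ _) (ltnW sk).
  have n2 := N'P j s x (leq_maxr _ _) (ltnW sk).
  set a := pderiv s (u j) _ in mv n1; set b := pderiv s (u j) _ in mv n2.
  set Gi := h *: _ in mv *; set y := x + _ in n1 *.
  have -> : G s y - G s x - Gi = (a - b - Gi) - (a - G s y) + (b - G s x).
    have zm (p q r t g : W) : p - q - g = (r - t - g) - (r - p) + (t - q) by zmod.
    exact: zm.
  rewrite (le_trans (ler_normD _ _))//.
  have := ler_normB (a - b - Gi) (a - G s y).
  move: mv n1 n2; set p1 := `|a - b - _|; set p2 := `|_|; set p3 := `|_|.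
  by set p4 := `|_|; set p5 := e * _; lra.
pose g := G [::].
have gG s : (size s <= k)%N -> pderiv s g = G s.
  elim: s => [//|i s ih] sk /=; apply/funext => x; rewrite (ih (ltnW sk)).
  exact: (Gder s i x sk).2.
have gk : Ck k g.
  move=> s sk; rewrite gG//; split; first exact: Gcont.
  by move=> sk' i x; exact: (Gder s i x sk').1.
have genorm (e : R) : 0 < e -> exists N, forall i, (N <= i)%N ->
    (hoelder_enorm alpha (g - u i)%R <= e%:E)%E.
  move=> e0; have e20 : 0 < e / 2 by rewrite divr_gt0.
  have [N NP] := GP _ e20; have [N' N'P] := uC _ e20.
  exists (maxn N N') => i; rewrite geq_max => /andP[Ni N'i].
  rewrite [e]splitr; apply: hoelder_enorm_le => [l x lk|l x y lk].
    have sk : (size (mseq l) <= k)%N by rewrite size_mseq.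
    rewrite /mderiv (pderivB gk (hoelder_Ck (u i)) sk) !fctE gG// distrC.
    exact: NP.
  have sk : (size (mseq l) <= k)%N by rewrite size_mseq lk.
  rewrite /mderiv (pderivB gk (hoelder_Ck (u i)) sk) !fctE gG//.
  apply/ler_addgt0Pr => e' e'0.
  have e'20 : 0 < e' / 2 by rewrite divr_gt0.
  have [M MP] := GP _ e'20; pose j := maxn M N'.
  have n1 := MP j (mseq l) x (leq_maxl _ _) sk.
  have n2 := MP j (mseq l) y (leq_maxl _ _) sk.
  have := mderiv_hoelder (u j - u i) x y lk.
  rewrite /mderiv !hoelder_pderivB//.
  set r := `|x - y| `^ _; set t := `|u j - u i|.
  have tr : t * r <= e / 2 * r.
    by rewrite ler_wpM2r ?powR_ge0// N'P// leq_maxr.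
  set a := pderiv _ _ x in n1 *; set b := pderiv _ _ x.
  set c := pderiv _ _ y in n2 *; set d := pderiv _ _ y => h.
  have -> : G (mseq l) x - b - (G (mseq l) y - d) =
      (a - b - (c - d)) - (a - G (mseq l) x) + (c - G (mseq l) y).
    have zm (p q a' b' c' d' : W) : p - b' - (q - d') =
      (a' - b' - (c' - d')) - (a' - p) + (c' - q) by zmod.
    exact: zm.
  rewrite (le_trans (ler_normD _ _))//.
  have := ler_normB (a - b - (c - d)) (a - G (mseq l) x).
  move: h n1 n2 tr; set p1 := `|a - b - _|; set p2 := `|_|; set p3 := `|_|.
  by set p4 := `|_|; set p5 := t * r; set p6 := e / 2 * r; lra.
have gP : g \in @hoelder_pred R n alpha W.
  rewrite inE; have [N NP] := genorm _ ltr01.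
  (* The norm estimate concerns [g - u N] only; finiteness for [g] follows by adding [u N] back. *)
  have -> : g = (g - u N) + u N by rewrite subrK.
  apply: is_hoelderD; last exact: hoelderP.
  split; last by rewrite (le_lt_trans (NP N (leqnn N)))// ltry.
  exact: CkB gk (hoelder_Ck (u N)).
apply/cvg_ex; exists (Hoelder gP); apply/cvg_seqP => e e0.
have [N NP] := genorm e e0; exists N => i Ni; rewrite distrC.
have := NP i Ni; rewrite -(hoelder_normE (Hoelder gP - u i)) lee_fin.
exact.
Qed.

End hoelder_complete.

(** * Pointwise bounds for rough paths *)

Section rough_path_bounds.
Context {R : realType} {V W : normedModType R} {T gamma : R}.
Context {tens : V -> V -> W} {A : set V}.
Local Notation S := (rough_path T gamma tens A).
Implicit Types (X Y : S) (p : simplex T) (t : time T).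

Lemma gap_ge0 p : 0 <= gap p.
Proof. by rewrite /gap subr_ge0; case: p. Qed.

Lemma gap_le p : gap p <= T.
Proof.
case: p => -[[s hs] [t ht]] /= st; case/andP: (hs) => s0 _; case/andP: (ht) => _ tT.
by rewrite /gap/= lerBlDr (le_trans tT)// lerDl.
Qed.

Lemma gap0_increment (U : normedModType R) (x : time T -> U) p :
  gap p = 0 -> increment x p = 0.
Proof.
case: p => -[s t] st; rewrite /gap/increment/= => /eqP; rewrite subr_eq0 => /eqP ts.
by rewrite (val_inj ts : t = s) subrr.
Qed.

(** The seminorms ignore the diagonal. There Chen's relation with three equal times fixes the area,
    which extends the bounds below to zero gaps. *)
Lemma gap0_area X p : gap p = 0 -> X.2 p = - tens 0 0.
Proof.
case: p => -[s t] st; rewrite /gap/= => /eqP; rewrite subr_eq0 => /eqP ts.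
have {}ts : t = s := val_inj ts.
move: st; rewrite ts => st.
have [_ _ _ /(_ s s s st st)] := rough_pathP X.
rewrite !(gap0_increment _ (p := spx st)) ?/gap/= ?subrr// => <-.
by rewrite (_ : le_trans st st = st) ?subrr ?sub0r ?opprK.
Qed.

Lemma rough_path0 X t : sval t = 0 -> X.1 t = 0.
Proof. by have [_ + _ _] := rough_pathP X; exact. Qed.

Lemma increment_finite X : (holder_seminorm gamma (increment X.1) < +oo)%E.
Proof. by have [[]] := rough_pathP X. Qed.

Lemma area_finite X : (holder_seminorm (2 * gamma) X.2 < +oo)%E.
Proof. by have [_ _ []] := rough_pathP X. Qed.

Lemma rough_distE X Y : mdist X Y =
  fine (holder_seminorm gamma (increment X.1 - increment Y.1)) +
  fine (holder_seminorm (2 * gamma) (X.2 - Y.2)).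
Proof. by rewrite -incrementB. Qed.

Lemma rough_norm_increment X p :
  `|increment X.1 p| <= rough_norm gamma X * gap p `^ gamma.
Proof.
have [p0|p0] := ltP 0 (gap p).
  apply: le_trans (holder_seminorm_bound (increment_finite X) p0) _.
  by rewrite ler_wpM2r ?powR_ge0// lerDl fine_holder_seminorm_ge0.
rewrite gap0_increment ?normr0.
  by rewrite mulr_ge0 ?powR_ge0// addr_ge0 ?fine_holder_seminorm_ge0.
by apply/eqP; rewrite eq_le p0 gap_ge0.
Qed.

Lemma rough_norm_area X p : tens 0 0 = 0 ->
  `|X.2 p| <= rough_norm gamma X * gap p `^ (2 * gamma).
Proof.
move=> t0; have [p0|p0] := ltP 0 (gap p).
  apply: le_trans (holder_seminorm_bound (area_finite X) p0) _.
  by rewrite ler_wpM2r ?powR_ge0// lerDr fine_holder_seminorm_ge0.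
rewrite gap0_area ?t0 ?oppr0 ?normr0.
  by rewrite mulr_ge0 ?powR_ge0// addr_ge0 ?fine_holder_seminorm_ge0.
by apply/eqP; rewrite eq_le p0 gap_ge0.
Qed.

Lemma rough_dist_increment X Y p :
  `|increment X.1 p - increment Y.1 p| <= mdist X Y * gap p `^ gamma.
Proof.
have [f1 _] := holder_seminormB (increment_finite X) (increment_finite Y).
have [p0|p0] := ltP 0 (gap p).
  apply: le_trans (holder_seminorm_bound f1 p0) _.
  by rewrite rough_distE ler_wpM2r ?powR_ge0// lerDl fine_holder_seminorm_ge0.
rewrite !gap0_increment ?subrr ?normr0; last 2 first.
- by apply/eqP; rewrite eq_le p0 gap_ge0.
- by apply/eqP; rewrite eq_le p0 gap_ge0.
- by rewrite mulr_ge0 ?powR_ge0// mdist_ge0.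
Qed.

Lemma rough_dist_area X Y p :
  `|X.2 p - Y.2 p| <= mdist X Y * gap p `^ (2 * gamma).
Proof.
have [f1 _] := holder_seminormB (area_finite X) (area_finite Y).
have [p0|p0] := ltP 0 (gap p).
  apply: le_trans (holder_seminorm_bound f1 p0) _.
  by rewrite rough_distE ler_wpM2r ?powR_ge0// lerDr fine_holder_seminorm_ge0.
rewrite !gap0_area ?subrr ?normr0; last 2 first.
- by apply/eqP; rewrite eq_le p0 gap_ge0.
- by apply/eqP; rewrite eq_le p0 gap_ge0.
- by rewrite mulr_ge0 ?powR_ge0// mdist_ge0.
Qed.

Lemma increment_from0 X t : increment X.1 (from0 t) = X.1 t.
Proof. by rewrite /increment/= [X in _ - X]rough_path0 ?subr0. Qed.

Lemma rough_dist_path X Y t :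
  `|X.1 t - Y.1 t| <= mdist X Y * gap (from0 t) `^ gamma.
Proof. by rewrite -!increment_from0; exact: rough_dist_increment. Qed.

Lemma rough_dist_le X Y (e : R) : 0 <= e ->
  (forall p, 0 < gap p ->
    `|increment X.1 p - increment Y.1 p| <= e * gap p `^ gamma) ->
  (forall p, 0 < gap p -> `|X.2 p - Y.2 p| <= e * gap p `^ (2 * gamma)) ->
  mdist X Y <= e + e.
Proof.
move=> e0 XY1 XY2; rewrite rough_distE; apply: lerD.
  by apply: (holder_seminorm_le _ _).2.
by apply: (holder_seminorm_le _ _).2.
Qed.

Lemma rough_norm_dist X Y : rough_norm gamma X <= rough_norm gamma Y + mdist X Y.
Proof.
have n1 : fine (holder_seminorm gamma (increment X.1)) <=
   fine (holder_seminorm gamma (increment Y.1)) +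
   fine (holder_seminorm gamma (increment X.1 - increment Y.1)).
  apply: (holder_seminorm_le _ _).2.
    by rewrite addr_ge0// fine_holder_seminorm_ge0.
  move=> p p0; rewrite -[increment X.1 p](subrK (increment Y.1 p)) addrC.
  rewrite mulrDl (le_trans (ler_normD _ _))// lerD//.
    exact: holder_seminorm_bound (increment_finite Y) p0.
  apply: holder_seminorm_bound p0.
  exact: (holder_seminormB (increment_finite X) (increment_finite Y)).1.
have n2 : fine (holder_seminorm (2 * gamma) X.2) <=
   fine (holder_seminorm (2 * gamma) Y.2) +
   fine (holder_seminorm (2 * gamma) (X.2 - Y.2)).
  apply: (holder_seminorm_le _ _).2.
    by rewrite addr_ge0// fine_holder_seminorm_ge0.
  move=> p p0; rewrite -[X.2 p](subrK (Y.2 p)) addrC.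
  rewrite mulrDl (le_trans (ler_normD _ _))// lerD//.
    exact: holder_seminorm_bound (area_finite Y) p0.
  apply: holder_seminorm_bound p0.
  exact: (holder_seminormB (area_finite X) (area_finite Y)).1.
by rewrite rough_distE /rough_norm; lra.
Qed.

End rough_path_bounds.

(** * Completeness of rough path spaces *)

Section rough_path_complete.
Context {R : realType} {V W : normedModType R} {T gamma : R}.
Context {tens : V -> V -> W} {A : set V}.
Hypothesis gamma0 : 0 < gamma.
Hypothesis tensB : forall u v u' v',
  `|tens u v - tens u' v'| <= `|u - u'| * `|v| + `|u'| * `|v - v'|.
Hypothesis Aclosed : forall (u : nat -> V) l,
  (forall i, A (u i)) -> u @ \oo --> l -> A l.
Local Notation S := (rough_path T gamma tens A).

Lemma norm_lim_le (U : normedModType R) (u : nat -> U) (l a : U) (c : R) N :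
  u @ \oo --> l -> (forall j, (N <= j)%N -> `|a - u j| <= c) -> `|a - l| <= c.
Proof.
move=> /cvg_seqP ul uc; apply/ler_addgt0Pr => e e0.
have [M MP] := ul e e0.
rewrite -(subrK (u (maxn M N)) a) -addrA (le_trans (ler_normD _ _))//.
by rewrite lerD ?uc ?MP ?leq_maxl ?leq_maxr.
Qed.

Lemma tens_cvg (u v : nat -> V) a b : u @ \oo --> a -> v @ \oo --> b ->
  (fun i => tens (u i) (v i)) @ \oo --> tens a b.
Proof.
move=> ua vb; apply/cvgrPdist_le => e e0.
have h : (fun i => `|u i - a| * `|v i| + `|a| * `|v i - b|) @ \oo --> (0 : R).
  have -> : 0 = `|a - a| * `|b| + `|a| * `|b - b| :> R.
    by rewrite !subrr normr0 mul0r mulr0 addr0.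
  apply: cvgD; apply: cvgM.
  - by apply: cvg_norm; apply: cvgB => //; exact: cvg_cst.
  - exact: cvg_norm.
  - exact: cvg_cst.
  - by apply: cvg_norm; apply: cvgB => //; exact: cvg_cst.
have /cvgrPdist_le/(_ e e0) := h.
apply: filterS => i; rewrite sub0r normrN ger0_norm; last first.
  by rewrite addr_ge0// mulr_ge0.
by move=> hi; rewrite distrC (le_trans (tensB _ _ _ _)).
Qed.

Definition metric_seq_complete (M : metricType R) := forall u : nat -> M,
  (forall e : R, 0 < e -> exists N, forall i j, (N <= i)%N -> (N <= j)%N ->
    mdist (u i) (u j) <= e) ->
  exists l, forall e : R, 0 < e ->
    exists N, forall i, (N <= i)%N -> mdist (u i) l <= e.

(** The distance bounds each increment and each area, so both converge pointwise, and the Cauchy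
    bounds pass to the limit in one argument with the powers of the gap intact. Chen's relation
    survives because [tens] is continuous, the remaining constraints because they are closed. *)
Lemma rough_path_seq_complete : seq_complete V -> seq_complete W ->
  metric_seq_complete S.
Proof.
move=> Vc Wc X XC.
have small (beta : R) (p : simplex T) e : 0 < e ->
    exists2 d : R, 0 < d & d * gap p `^ beta <= e.
  move=> e0; have g0 : 0 < gap p `^ beta + 1 by rewrite ltr_wpDl// powR_ge0.
  exists (e / (gap p `^ beta + 1)); first by rewrite divr_gt0.
  rewrite mulrAC -mulrA ler_piMr ?(ltW e0)// ler_pdivrMr// mul1r lerDl//.
have X1 t : cvgn (fun i => (X i).1 t).
  apply: Vc => e e0; have [d d0 dP] := small gamma (from0 t) e e0.
  have [N NP] := XC d d0; exists N => i j Ni Nj.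
  apply: le_trans (rough_dist_path (X i) (X j) t) _.
  by apply: le_trans dP; rewrite ler_wpM2r ?powR_ge0// NP.
have X2 p : cvgn (fun i => (X i).2 p).
  apply: Wc => e e0; have [d d0 dP] := small (2 * gamma) p e e0.
  have [N NP] := XC d d0; exists N => i j Ni Nj.
  apply: le_trans (rough_dist_area (X i) (X j) p) _.
  by apply: le_trans dP; rewrite ler_wpM2r ?powR_ge0// NP.
pose Y : (time T -> V) * (simplex T -> W) :=
  (fun t => limn (fun i => (X i).1 t), fun p => limn (fun i => (X i).2 p)).
have incY p : (fun i => increment (X i).1 p) @ \oo --> increment Y.1 p.
  by apply: cvgB; exact: X1.
have close e : 0 < e -> exists N, forall i, (N <= i)%N -> forall p,
    `|increment (X i).1 p - increment Y.1 p| <= e * gap p `^ gamma /\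
    `|(X i).2 p - Y.2 p| <= e * gap p `^ (2 * gamma).
  move=> e0; have [N NP] := XC e e0; exists N => i Ni p; split.
    apply: (norm_lim_le (N := N) (incY p)) => j Nj.
    apply: le_trans (rough_dist_increment (X i) (X j) p) _.
    by rewrite ler_wpM2r ?powR_ge0// NP.
  apply: (norm_lim_le (N := N) (X2 p)) => j Nj.
  apply: le_trans (rough_dist_area (X i) (X j) p) _.
  by rewrite ler_wpM2r ?powR_ge0// NP.
have finite (U : normedModType R) beta (B C : simplex T -> U) :
    (holder_seminorm beta B < +oo)%E ->
    (forall p, `|B p - C p| <= 1 * gap p `^ beta) ->
    (holder_seminorm beta C < +oo)%E.
  move=> By BC.
  apply: (@holder_seminorm_le _ _ _ _ _ (fine (holder_seminorm beta B) + 1) _ _).1.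
    by rewrite addr_ge0// fine_holder_seminorm_ge0.
  move=> p p0; have -> : C p = B p - (B p - C p) by rewrite subKr.
  rewrite mulrDl (le_trans (ler_normB _ _))// lerD//.
  exact: holder_seminorm_bound By p0.
have YP : `[< is_rough_path gamma tens A Y >].
  apply/asboolP; split.
  - split=> [t|].
      apply: (Aclosed _ (X1 t)) => i.
      by have [[+ _] _ _ _] := rough_pathP (X i); exact.
    have [N NP] := close 1 ltr01.
    by apply: (finite _ _ _ _ (increment_finite (X N))) => p; exact: (NP _ (leqnn N) p).1.
  - move=> t t0; rewrite /Y/= (_ : (fun i => (X i).1 t) = fun=> 0) ?lim_cst//.
    by apply/funext => i; exact: rough_path0.
  - split=> [p|].
      apply: (@closed_cvg nat W \oo _ (fun i => (X i).2 p) (tensor_space tens A)).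
      - exact: closed_closure.
      - by apply: nearW => i; have [_ _ [+ _] _] := rough_pathP (X i); exact.
      - exact: X2.
    have [N NP] := close 1 ltr01.
    by apply: (finite _ _ _ _ (area_finite (X N))) => p; exact: (NP _ (leqnn N) p).2.
  - move=> s r t sr rt.
    have c1 := cvgB (cvgB (X2 (spx (le_trans sr rt))) (X2 (spx sr))) (X2 (spx rt)).
    have c2 := tens_cvg (incY (spx sr)) (incY (spx rt)).
    rewrite -[RHS](cvg_lim (@norm_hausdorff _ _) c2).
    rewrite -[LHS](cvg_lim (@norm_hausdorff _ _) (c1 _ _)).
    congr (limn _); apply/funext => i.
    by have [_ _ _ /(_ s r t sr rt)] := rough_pathP (X i).
exists (RoughPath YP) => e e0.
have e20 : 0 < e / 2 by rewrite divr_gt0.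
have [N NP] := close _ e20; exists N => i Ni.
rewrite [e]splitr; apply: rough_dist_le; first exact: ltW.
  by move=> p _; exact: (NP i Ni p).1.
by move=> p _; exact: (NP i Ni p).2.
Qed.

End rough_path_complete.

(** * Tensor products and supports of Hölder functions *)

Lemma tensorB (R : realType) d (u v u' v' : euclid R d) :
  tensor u v - tensor u' v' = tensor (u - u') v + tensor u' (v - v').
Proof.
have -> : tensor (u - u') v = tensor u v - tensor u' v.
  have := tensor_linearl v (-1) u' u.
  by rewrite !scaleN1r ![- _ + _]addrC.
by rewrite linearB/= addrA subrK.
Qed.

Section hoelder_tensor_bounds.
Context {R : realType} {n : nat} {alpha : R}.
Local Notation E := (euclid R n.+1).
Local Notation EE := (emx R n.+1 n.+1).
Implicit Types f g : hoelder n alpha E.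

Lemma norm_hoelder_tensor f g : `|hoelder_tensor f g| <= `|f| * `|g|.
Proof.
have gC u : `|tensor_comp g u| <= `|g| * `|u|.
  rewrite mulrC.
  have := @hoelder_enorm_comp _ _ _ _ (tensor u) `|u| _ alpha g _ (hoelder_Ck g).
  rewrite -!(hoelder_normE _) -[_ \o _]/(hoelder_fun (tensor_comp g u)).
  rewrite -!(hoelder_normE _) -EFinM lee_fin; apply=> // v.
  by rewrite norm_tensor.
have := @hoelder_enorm_comp _ _ _ _ (tensor_comp g) `|g| gC alpha f _ (hoelder_Ck f).
rewrite -[_ \o _]/(hoelder_fun (hoelder_tensor f g)).
rewrite -(hoelder_normE f) -(hoelder_normE (hoelder_tensor f g)) -EFinM lee_fin.
move=> h; rewrite [leRHS]mulrC.
exact: h (normr_ge0 g).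
Qed.

Lemma hoelder_tensorBl f f' g :
  hoelder_tensor (f - f') g = hoelder_tensor f g - hoelder_tensor f' g.
Proof.
apply/val_inj/funext => x; apply/val_inj/funext => y.
have := tensor_linearl (g y) (-1) (f' x) (f x).
by rewrite !scaleN1r ![- _ + _]addrC.
Qed.

Lemma hoelder_tensorBr f g g' :
  hoelder_tensor f (g - g') = hoelder_tensor f g - hoelder_tensor f g'.
Proof.
apply/val_inj/funext => x; apply/val_inj/funext => y.
by rewrite /= -[LHS]/(tensor (f x) (g y - g' y)) linearB.
Qed.

Lemma hoelder_tensorB f g f' g' :
  `|hoelder_tensor f g - hoelder_tensor f' g'| <=
    `|f - f'| * `|g| + `|f'| * `|g - g'|.
Proof.
have -> : hoelder_tensor f g - hoelder_tensor f' g' =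
    hoelder_tensor (f - f') g + hoelder_tensor f' (g - g').
  by rewrite hoelder_tensorBl hoelder_tensorBr addrA subrK.
by rewrite (le_trans (ler_normD _ _))// lerD// norm_hoelder_tensor.
Qed.

(** The ball is closed, so taking the closure of the set of nonzero points adds nothing outside it.
    In this form the condition passes to pointwise limits. *)
Lemma hoelder_supportedP (rho : R) f :
  hoelder_supported rho f <-> forall x, rho < `|x| -> f x = 0.
Proof.
split=> [fr x xr|fr x].
  apply: contrapT => /eqP fx; have := fr x (@subset_closure _ [set x | f x != 0] x fx).
  by move=> /= xr'; move: xr; rewrite ltNge xr'.
move=> xc; rewrite /= leNgt; apply/negP => xr.
have xr0 : 0 < `|x| - rho by rewrite subr_gt0.
have [y [/= /eqP fy]] := xc _ (nbhsx_ballx x _ xr0).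
rewrite -ball_normE/= => xy; apply: fy; apply: fr.
move: xy; have := ler_distD 0 x y; rewrite !subr0 sub0r normrN.
by have := lerB_dist x y; lra.
Qed.

Lemma hoelder_supported_closed (rho : R) (u : nat -> hoelder n alpha E) l :
  (forall i, hoelder_supported rho (u i)) -> u @ \oo --> l ->
  hoelder_supported rho l.
Proof.
move=> us /cvg_seqP ul; apply/hoelder_supportedP => x xr.
apply/eqP; rewrite -normr_le0; apply/ler_addgt0Pr => e e0; rewrite add0r.
have [N NP] := ul e e0; apply: le_trans (NP N (leqnn N)).
have := hoelder_norm_sup (u N - l) x.
have /hoelder_supportedP/(_ x xr) ux := us N.
by rewrite /= -[X in `|X|]/(u N x - l x) ux sub0r normrN.
Qed.

End hoelder_tensor_bounds.

Lemma hoelder_rough_path_complete (R : realType) (T gamma : R) n (alpha rho : R) :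
  0 < gamma -> metric_seq_complete (hoelder_rough_path T gamma n alpha rho).
Proof.
move=> gamma0; apply: rough_path_seq_complete => //.
- exact: hoelder_tensorB.
- exact: hoelder_supported_closed.
- exact/hoelder_seq_complete/emx_seq_complete.
- exact/hoelder_seq_complete/hoelder_seq_complete/emx_seq_complete.
Qed.

(** * Lowering the exponents of a rough path *)

Section hoelder_map.
Context {R : realType} {n : nat} {alpha : R} {V W : normedModType R}.
Variables (L : {linear V -> W}) (C : R).
Hypothesis C0 : 0 <= C.
Hypothesis LC : forall v, `|L v| <= C * `|v|.
Implicit Types f : hoelder n alpha V.

Fact hoelder_map_subproof f : (L \o f) \in @hoelder_pred R n alpha W.
Proof. by rewrite inE; apply: (is_hoelder_comp LC) => //; exact: hoelderP. Qed.

Definition hoelder_map f : hoelder n alpha W := Hoelder (hoelder_map_subproof f).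

Lemma norm_hoelder_map f : `|hoelder_map f| <= C * `|f|.
Proof.
have := hoelder_enorm_comp LC C0 (hoelder_Ck f).
rewrite -[_ \o _]/(hoelder_fun (hoelder_map f)).
by rewrite -!(hoelder_normE _) -EFinM lee_fin.
Qed.

End hoelder_map.

Section lower2.
Context {R : realType} {n : nat} {alpha alpha' : R}.
Hypothesis alphas : 0 < alpha' < alpha.
Local Notation E := (euclid R n.+1).
Local Notation EE := (emx R n.+1 n.+1).
Local Notation H a := (hoelder n a (hoelder n a EE)).

(** The map on values used in [lower2] needs an explicit bound, so a witness of the embedding
    constant is fixed by choice. *)
Definition lower_constant : R := sval (cid2 (@lower_bounded R n _ _ EE alphas)).

Lemma lower_constant_gt0 : 0 < lower_constant.
Proof. by rewrite /lower_constant; case: cid2. Qed.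

Lemma norm_lower_le f : `|@lower R n _ _ EE alphas f| <= lower_constant * `|f|.
Proof. by rewrite /lower_constant; case: cid2. Qed.

Definition lower2 (f : H alpha) : H alpha' :=
  lower alphas (hoelder_map (ltW lower_constant_gt0) norm_lower_le f).

Fact lower2_linear : linear lower2.
Proof.
by move=> a f g; apply/val_inj/funext => x; apply/val_inj/funext => y.
Qed.

HB.instance Definition _ := GRing.isLinear.Build R (H alpha) (H alpha') _ lower2
  lower2_linear.

Lemma lower2_tensor f g :
  lower2 (hoelder_tensor f g) = hoelder_tensor (lower alphas f) (lower alphas g).
Proof. by apply/val_inj/funext => x; apply/val_inj/funext => y. Qed.

Lemma lower2_bounded : exists2 C : R, 0 < C &
  forall f : H alpha, `|lower2 f| <= C * `|f|.
Proof.
have [C C0 CP] := @lower_bounded R n _ _ (hoelder n alpha' EE) alphas.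
exists (C * lower_constant); first by rewrite mulr_gt0// lower_constant_gt0.
move=> f; apply: le_trans (CP _) _; rewrite -mulrA ler_pM2l//.
exact: norm_hoelder_map.
Qed.

(** Interpolation in the outer variable asks for values that are small in the lowered inner norm,
    uniformly in [x]; its threshold [d1] is the target of the interpolation in the inner
    variable. *)
Lemma lower2_small (M e : R) : 0 < e ->
  exists2 d : R, 0 < d & forall f : H alpha, `|f| <= M ->
    (forall x y, `|f x y| <= d) -> `|lower2 f| <= e.
Proof.
move=> e0.
have [d1 d10 d1P] := @lower_small R n _ _ (hoelder n alpha' EE) alphas
  (lower_constant * M) e e0.
have [d2 d20 d2P] := @lower_small R n _ _ EE alphas M d1 d10.
exists d2 => // f fM fd; apply: d1P.
  apply: le_trans (norm_hoelder_map _ _ _) _.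
  by rewrite ler_pM2l// lower_constant_gt0.
by move=> x; apply: d2P => //; apply: le_trans (hoelder_norm_sup f x) fM.
Qed.

End lower2.

Section lower_rough.
Context {R : realType} {T : R} {n : nat} {rho gamma gamma' alpha alpha' : R}.
Hypothesis gammas : 0 < gamma' < gamma.
Hypothesis alphas : 0 < alpha' < alpha.
Local Notation E := (euclid R n.+1).
Local Notation EE := (emx R n.+1 n.+1).
Local Notation S := (hoelder_rough_path T gamma n alpha rho).
Local Notation S' := (hoelder_rough_path T gamma' n alpha' rho).

Definition lower_data (X : S) :
    (time T -> hoelder n alpha' E) *
    (simplex T -> hoelder n alpha' (hoelder n alpha' EE)) :=
  (fun t => lower alphas (X.1 t), fun p => lower2 alphas (X.2 p)).

Let gamma0 : 0 < gamma. Proof. by case/andP: gammas; exact: lt_trans. Qed.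

Lemma gap_powR_le (b b' : R) (p : simplex T) : 0 < b' <= b ->
  gap p `^ b <= T `^ (b - b') * gap p `^ b'.
Proof.
move=> /andP[b'0 bb']; have := gap_ge0 p; rewrite le_eqVlt => /predU1P[<-|p0].
  rewrite !powR0 ?mulr0// gt_eqF//; exact: lt_le_trans bb'.
have -> : gap p `^ b = gap p `^ (b - b') * gap p `^ b'.
  by rewrite -powRD ?subrK//; apply/implyP => _; rewrite gt_eqF.
rewrite ler_wpM2r ?powR_ge0// ge0_ler_powR ?subr_ge0// ?nnegrE ?gap_le//.
  exact: ltW.
exact: le_trans (ltW p0) (gap_le p).
Qed.

Lemma lower_increment (X : S) p :
  increment (lower_data X).1 p = lower alphas (increment X.1 p).
Proof. by rewrite /increment/= linearB. Qed.

Fact lower_rough_subproof (X : S) :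
  `[< is_rough_path gamma' (@hoelder_tensor _ n alpha')
        (@hoelder_supported _ n alpha' rho) (lower_data X) >].
Proof.
have [g'0 gg] := andP gammas.
have [[XA _] X0 [XT _] XC] := rough_pathP X.
have [C C0 CP] := @lower_bounded R n _ _ E alphas.
have [C2 C20 C2P] := @lower2_bounded R n _ _ alphas.
have nX0 : 0 <= rough_norm gamma X by rewrite addr_ge0 ?fine_holder_seminorm_ge0.
apply/asboolP; split.
- split; first exact: XA.
  apply: (@holder_seminorm_le _ _ _ _ _
    (C * (rough_norm gamma X * T `^ (gamma - gamma'))) _ _).1.
    by rewrite !mulr_ge0 ?powR_ge0// ltW.
  move=> p p0; rewrite lower_increment; apply: le_trans (CP _) _.
  rewrite -mulrA ler_pM2l// -mulrA.
  apply: (le_trans (rough_norm_increment X p)).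
  by rewrite ler_wpM2l// gap_powR_le// g'0 ltW.
- by move=> t t0; rewrite /= (X0 _ t0) linear0.
- split=> [p|].
    (* Lowering maps elementary tensors to elementary tensors, and an approximation within [e / C2]
       to one within [e]. *)
    move=> U U_; have := XT p.
    have [e /= e0 eU] := (nbhs_ballP _ _).1 U_.
    move=> /(_ (ball (X.2 p) (e / C2)) (nbhsx_ballx _ _ _)).
    rewrite divr_gt0// => /(_ isT)[_ [[k [f [g [fg ->]]]] Xfg]].
    exists (lower2 alphas (\sum_i hoelder_tensor (f i) (g i))); split.
      exists k, (fun i => lower alphas (f i)), (fun i => lower alphas (g i)).
      split; first by move=> i; have [fA gA] := fg i; split.
      by rewrite linear_sum; apply: eq_bigr => i _; exact: lower2_tensor.
    apply: eU; move: Xfg; rewrite -!ball_normE/= -linearB ltr_pdivlMr// mulrC.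
    exact: le_lt_trans (C2P _).
  apply: (@holder_seminorm_le _ _ _ _ _
    (C2 * (rough_norm gamma X * T `^ (2 * gamma - 2 * gamma'))) _ _).1.
    by rewrite !mulr_ge0 ?powR_ge0// ltW.
  move=> p p0; apply: le_trans (C2P _) _.
  rewrite -mulrA ler_pM2l// -mulrA.
  apply: (@le_trans _ _ (rough_norm gamma X * gap p `^ (2 * gamma))).
    apply: (rough_norm_area X p); apply/eqP; rewrite -normr_le0.
    by apply: le_trans (norm_hoelder_tensor 0 0) _; rewrite normr0 mul0r.
  by rewrite ler_wpM2l// gap_powR_le// !ler_pM2l// mulr_gt0//= ltW.
- move=> s u t su ut; rewrite !lower_increment -lower2_tensor -XC.
  by rewrite /= !linearB.
Qed.

Definition lower_rough (X : S) : S' := RoughPath (lower_rough_subproof X).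

Lemma field_of_lower X : field_of (lower_rough X) = field_of X.
Proof. by []. Qed.

Lemma lower_rough_lipschitz : exists2 C : R, 0 < C &
  forall X Y, mdist (lower_rough X) (lower_rough Y) <= C * mdist X Y.
Proof.
have [g'0 gg] := andP gammas.
have [C C0 CP] := @lower_bounded R n _ _ E alphas.
have [C2 C20 C2P] := @lower2_bounded R n _ _ alphas.
pose K := C * T `^ (gamma - gamma') + C2 * T `^ (2 * gamma - 2 * gamma') + 1.
have K0 : 0 < K by rewrite ltr_wpDl// addr_ge0// mulr_ge0 ?powR_ge0// ltW.
exists (K + K); first by rewrite addr_gt0.
move=> X Y; rewrite mulrDl; apply: rough_dist_le.
- by rewrite mulr_ge0 ?mdist_ge0// ltW.
- move=> p p0; rewrite !lower_increment -linearB.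
  apply: le_trans (CP _) _.
  apply: (@le_trans _ _ (C * (mdist X Y * (T `^ (gamma - gamma') * gap p `^ gamma')))).
    rewrite ler_pM2l//; apply: (le_trans (rough_dist_increment X Y p)).
    by rewrite ler_wpM2l ?mdist_ge0// gap_powR_le// g'0 ltW.
  rewrite [mdist X Y * _]mulrCA !mulrA ler_wpM2r ?powR_ge0//.
  rewrite ler_wpM2r ?mdist_ge0// /K -addrA lerDl addr_ge0//.
  by rewrite mulr_ge0 ?powR_ge0// ltW.
- move=> p p0; rewrite -linearB.
  apply: le_trans (C2P _) _.
  apply: (@le_trans _ _ (C2 * (mdist X Y *
      (T `^ (2 * gamma - 2 * gamma') * gap p `^ (2 * gamma'))))).
    rewrite ler_pM2l//; apply: (le_trans (rough_dist_area X Y p)).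
    by rewrite ler_wpM2l ?mdist_ge0// gap_powR_le// !ler_pM2l// mulr_gt0//= ltW.
  rewrite [mdist X Y * _]mulrCA !mulrA ler_wpM2r ?powR_ge0//.
  rewrite ler_wpM2r ?mdist_ge0// /K addrAC lerDr addr_ge0//.
  by rewrite mulr_ge0 ?powR_ge0// ltW.
Qed.

End lower_rough.

(** * Sampling points in time and space *)

Section grid.
Context {R : realType}.
Variables (T rho : R) (n : nat).
Hypothesis T0 : 0 < T.
Hypothesis rho0 : 0 < rho.
Local Notation E := (euclid R n.+1).

(** Indices up to [2 (m + 1)] let the mesh [rho / (m + 1)] cover the interval from [-rho] to [rho]
    in each coordinate. *)
Definition grid_index (m : nat) := {ffun 'I_n.+1 -> 'I_(m.+1.*2).+1}.

Definition grid_point m (g : grid_index m) : E :=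
  \row_i (rho * (g i)%:R / m.+1%:R - rho).

Lemma grid_point_near m (x : E) : `|x| <= rho ->
  exists g : grid_index m, `|x - grid_point g| <= n.+1%:R * (rho / m.+1%:R).
Proof.
move=> xr.
have m0 : 0 < m.+1%:R :> R by rewrite ltr0n.
pose a i := ((x : 'rV[R]_n.+1) 0 i + rho) * m.+1%:R / rho.
have xi i : - rho <= (x : 'rV[R]_n.+1) 0 i <= rho.
  by rewrite -ler_norml (le_trans (entry_le_norm _ _ _)).
have a0 i : 0 <= a i.
  rewrite /a divr_ge0 ?(ltW rho0)// mulr_ge0 ?(ltW m0)//.
  by have /andP[] := xi i; lra.
have ai i : (Num.truncn (a i) < (m.+1.*2).+1)%N.
  rewrite ltnS -(leq_add2r 1) addn1 truncn_lt_nat//.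
  rewrite /a ltr_pdivrMr// natrD -addnn natrD.
  have /andP[_ ] := xi i.
  set y := (x : 'rV_ _) _ _ => yr.
  apply: (@le_lt_trans _ _ ((rho + rho) * m.+1%:R)).
    by rewrite ler_wpM2r ?lerD2r// ltW.
  by rewrite mulrDl [ltRHS]mulrC mulrDr mulr1 mulrDr ltrDl.
exists [ffun i => Ordinal (ai i)].
have -> : n.+1%:R * (rho / m.+1%:R) = (1 * n.+1)%:R * (rho / m.+1%:R).
  by rewrite mul1n.
apply: norm_le_entries; first by rewrite divr_ge0// ltW.
move=> i j; rewrite ord1 !mxE ffunE/=.
have /andP[t1 t2] := truncn_itv (a0 j).
have xE : (x : 'rV[R]_n.+1) 0 j = rho * a j / m.+1%:R - rho.
  by rewrite /a; field; rewrite !gt_eqF.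
rewrite xE opprB addrA subrK -mulrBl -mulrBr normrM normrM.
rewrite (gtr0_norm rho0) (gtr0_norm (_ : 0 < m.+1%:R^-1)) ?invr_gt0//.
rewrite ler_pM2r ?invr_gt0// ler_piMr ?(ltW rho0)// ger0_norm ?subr_ge0//.
by rewrite lerBlDr -(natrD _ 1) add1n ltW.
Qed.

Definition grid_pair (m : nat) := (grid_index m * grid_index m)%type.

Definition grid_size (m : nat) := #|{: grid_pair m}|.

Lemma grid_size_gt0 m : (0 < grid_size m)%N.
Proof. by apply/card_gt0P; exists ([ffun=> ord0], [ffun=> ord0]). Qed.

(** Finite-dimensional distributions take strictly increasing times with one pair of points each, so
    no time can be reused for another pair: the samples run [m + 1] times through all pairs. *)
Definition sample_size (m : nat) := (m.+1 * grid_size m)%N.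

Definition sample_pair m (j : 'I_(sample_size m)) : grid_pair m :=
  enum_val (Ordinal (ltn_pmod j (grid_size_gt0 m))).

Fact sample_time_subproof m (j : 'I_(sample_size m)) :
  0 <= T * j%:R / (sample_size m)%:R <= T.
Proof.
have s0 : 0 < (sample_size m)%:R :> R by rewrite ltr0n muln_gt0/= grid_size_gt0.
apply/andP; split; first by rewrite divr_ge0// mulr_ge0// ltW.
by rewrite ler_pdivrMr// ler_wpM2l ?(ltW T0)// ler_nat ltnW.
Qed.

(* The times increase slowly enough for all pairs of points of the grid to be
   visited in every interval of length [T / m.+1]. *)
Definition sample_time m (j : 'I_(sample_size m)) : time T :=
  exist (fun t => is_true (0 <= t <= T)) _ (sample_time_subproof j).

Lemma sample_time_lt m (i j : 'I_(sample_size m)) : (i < j)%N ->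
  sval (sample_time i) < sval (sample_time j).
Proof.
move=> ij; have s0 : 0 < (sample_size m)%:R :> R.
  by rewrite ltr0n muln_gt0/= grid_size_gt0.
by rewrite /= ltr_pM2r ?invr_gt0// ltr_pM2l// ltr_nat.
Qed.

(** Run number [a] through the pairs takes place between the times [a T / (m + 1)] and
    [(a + 1) T / (m + 1)]; it is chosen so that this interval contains [t]. *)
Lemma sample_near m (t : time T) (q : grid_pair m) :
  exists2 j : 'I_(sample_size m), sample_pair j = q &
    `|sval (sample_time j) - sval t| <= T / m.+1%:R.
Proof.
case: t => t /= /andP[t0 tT].
have m0 : 0 < m.+1%:R :> R by rewrite ltr0n.
have g0 := grid_size_gt0 m.
have gR : 0 < (grid_size m)%:R :> R by rewrite ltr0n.
have [a [am at1 at2]] : exists a, [/\ (a <= m)%N, a%:R * T / m.+1%:R <= t &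
    t <= a.+1%:R * T / m.+1%:R].
  (* The last run is treated apart, because truncation at [t = T] would give the run [m + 1], which
     does not exist. *)
  have [tT'|tT'] := leP (m%:R * T / m.+1%:R) t.
    by exists m; split=> //; rewrite mulrAC divff ?gt_eqF// mul1r.
  have u0 : 0 <= t * m.+1%:R / T by rewrite divr_ge0// ?mulr_ge0// ltW.
  have /andP[u1 u2] := truncn_itv u0.
  exists (Num.truncn (t * m.+1%:R / T)); split.
  - rewrite -ltnS truncn_lt_nat// ltr_pdivrMr// -ltr_pdivlMr//.
    apply: lt_le_trans tT' _; rewrite ler_wpM2r ?invr_ge0 ?(ltW m0)//.
    by rewrite ler_wpM2r ?(ltW T0)// ler_nat.
  - by rewrite ler_pdivrMr// -ler_pdivlMr.
  - by rewrite ler_pdivlMr// -ler_pdivrMr// ltW.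
have qr : (enum_rank q < grid_size m)%N by rewrite /grid_size ltn_ord.
have jP : (a * grid_size m + enum_rank q < sample_size m)%N.
  rewrite /sample_size; apply: (@leq_trans (a.+1 * grid_size m)).
    by rewrite mulSn addnC ltn_add2r.
  by rewrite leq_mul2r ltnS am orbT.
exists (Ordinal jP).
  apply: enum_rank_inj; rewrite /sample_pair enum_valK.
  by apply/val_inj; rewrite /= modnMDl modn_small.
rewrite /= natrD natrM /sample_size natrM.
have -> : T * (a%:R * (grid_size m)%:R + (enum_rank q)%:R) /
    (m.+1%:R * (grid_size m)%:R) =
    a%:R * T / m.+1%:R + T / m.+1%:R * ((enum_rank q)%:R / (grid_size m)%:R).
  by field; rewrite !gt_eqF.
have c0 : 0 < T / m.+1%:R by rewrite divr_gt0.
have d0 : 0 <= (enum_rank q)%:R / (grid_size m)%:R :> R by rewrite divr_ge0.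
have d1 : (enum_rank q)%:R / (grid_size m)%:R <= 1 :> R.
  by rewrite ler_pdivrMr// mul1r ler_nat ltnW.
move: at1 at2; rewrite -(natr1 a) !mulrDl mul1r.
have := ler_wpM2l (ltW c0) d1; have := mulr_ge0 (ltW c0) d0.
rewrite mulr1; set p := a%:R * T / _; set c := T / _; set d := _ * (_ / _).
by move=> *; rewrite ler_norml; lra.
Qed.

Definition sample m (z : space_time_field T n) :
    {ptws 'I_(sample_size m) -> (E * emx R n.+1 n.+1)%type} :=
  fdd_vector (@sample_time m) (fun j => grid_point (sample_pair j).1)
    (fun j => grid_point (sample_pair j).2) z.

End grid.

Arguments sample {R T} rho {n} T0 m z.

(** * Supports and moduli of continuity on norm balls *)

Section hoelder_rough_path_bounds.
Context {R : realType} {T : R} {n : nat} {rho gamma alpha : R}.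
Hypothesis gamma0 : 0 < gamma.
Local Notation E := (euclid R n.+1).
Local Notation EE := (emx R n.+1 n.+1).
Local Notation S := (hoelder_rough_path T gamma n alpha rho).
Implicit Types X Y : S.

Lemma time_ext (s t : time T) : sval s = sval t -> s = t.
Proof. exact: val_inj. Qed.

(** The samples see areas started at time 0 only; Chen's relation recovers all others from them and
    the path. *)
Lemma area_from0 X (s t : time T) (st : sval s <= sval t) :
  X.2 (spx st) = X.2 (from0 t) - X.2 (from0 s) -
    hoelder_tensor (X.1 s) (increment X.1 (spx st)).
Proof.
have [_ _ _ XC] := rough_pathP X.
have := XC (exist (fun r => is_true (0 <= r <= T)) 0 (time0_subproof s)) s t
  (from0_subproof s) st.
rewrite -/(from0 s) increment_from0 => <-.
(* The two copies of time 0 carry different proofs of their bounds and agree as elements of a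
   subtype. *)
set p := spx (le_trans _ _); have -> : from0 t = p.
  by apply/val_inj; congr pair; apply/time_ext.
have zm (U : zmodType) (a b c : U) : a = b - c - (b - c - a) by zmod.
exact: zm.
Qed.

(** For an elementary tensor one of the two factors vanishes. Evaluation at a point is bounded by
    the norm, so the closure inherits the property. *)
Lemma tensor_space_support (w : hoelder n alpha (hoelder n alpha EE)) x y :
  tensor_space (@hoelder_tensor _ n alpha) (hoelder_supported rho) w ->
  (rho < `|x|) || (rho < `|y|) -> w x y = 0.
Proof.
move=> wA xy; apply/eqP; rewrite -normr_le0; apply/ler_addgt0Pr => e e0.
rewrite add0r.
have [_ [[k [f [g [fg ->]]]]]] := wA _ (nbhsx_ballx w _ e0).
set v := \sum_i _; rewrite -ball_normE/= => wv.
have v0 : v x y = 0.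
  rewrite /v.
  have -> : (\sum_i hoelder_tensor (f i) (g i)) x y =
      \sum_i hoelder_tensor (f i) (g i) x y.
    by elim/big_ind2 : _ => // _ a _ b <- <-.
  apply: big1 => i _; rewrite hoelder_tensorE.
  have [/hoelder_supportedP fA /hoelder_supportedP gA] := fg i.
  case/orP: xy => [/fA ->|/gA ->]; last by rewrite linear0.
  by rewrite /tensor trmx0 mul0mx.
apply: le_trans (ltW wv).
apply: le_trans (hoelder_norm_sup (w - v) x).
apply: le_trans (hoelder_norm_sup ((w - v) x) y).
by rewrite -[X in _ <= `|X|]/(w x y - v x y) v0 subr0.
Qed.

Lemma path_support X t x : rho < `|x| -> X.1 t x = 0.
Proof.
have [[XA _] _ _ _] := rough_pathP X; have /hoelder_supportedP := XA t; exact.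
Qed.

Lemma area_support X p x y : (rho < `|x|) || (rho < `|y|) -> X.2 p x y = 0.
Proof.
have [_ _ [XT _] _] := rough_pathP X; exact: tensor_space_support.
Qed.

Lemma gap_powR_leT (b : R) (p : simplex T) : 0 <= b -> gap p `^ b <= T `^ b.
Proof.
move=> b0; apply: ge0_ler_powR; rewrite ?nnegrE ?gap_ge0 ?gap_le//.
exact: le_trans (gap_ge0 p) (gap_le p).
Qed.

Context (M : R).
Hypothesis M0 : 0 <= M.

Lemma path_bound X t : rough_norm gamma X <= M -> `|X.1 t| <= M * T `^ gamma.
Proof.
move=> XM; rewrite -(increment_from0 X t).
apply: le_trans (rough_norm_increment X _) _.
by rewrite ler_pM ?powR_ge0 ?gap_powR_leT ?(ltW gamma0)// addr_ge0 ?fine_holder_seminorm_ge0.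
Qed.

Lemma increment_bound X p : rough_norm gamma X <= M ->
  `|increment X.1 p| <= M * gap p `^ gamma.
Proof.
move=> XM; apply: le_trans (rough_norm_increment X _) _.
by rewrite ler_wpM2r// powR_ge0.
Qed.

Lemma area_bound X p : rough_norm gamma X <= M ->
  `|X.2 p| <= M * gap p `^ (2 * gamma).
Proof.
move=> XM; apply: (le_trans (rough_norm_area X p _)).
  apply/eqP; rewrite -normr_le0.
  by apply: le_trans (norm_hoelder_tensor 0 0) _; rewrite normr0 mul0r.
by rewrite ler_wpM2r// powR_ge0.
Qed.

Lemma ordered_times (P : time T -> time T -> Prop) :
  (forall s t, P s t -> P t s) ->
  (forall s t, sval s <= sval t -> P s t) -> forall s t, P s t.
Proof.
move=> Ps P1 s t; have [st|/ltW ts] := leP (sval s) (sval t); first exact: P1.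
exact/Ps/P1.
Qed.

Lemma path_time_modulus X s t : rough_norm gamma X <= M ->
  `|X.1 s - X.1 t| <= M * `|sval s - sval t| `^ gamma.
Proof.
move=> XM; move: s t; apply: ordered_times => [s t|s t st].
  by rewrite distrC [`|sval s - _|]distrC.
have -> : `|sval s - sval t| = gap (spx st).
  by rewrite distrC ger0_norm ?subr_ge0.
by rewrite distrC; exact: (increment_bound (spx st) XM).
Qed.

Lemma area_time_modulus X s t : rough_norm gamma X <= M ->
  `|X.2 (from0 s) - X.2 (from0 t)| <=
    M * `|sval s - sval t| `^ (2 * gamma) +
    M * T `^ gamma * (M * `|sval s - sval t| `^ gamma).
Proof.
move=> XM; move: s t; apply: ordered_times => [s t|s t st].
  by rewrite distrC [`|sval s - _|]distrC.
have gE : `|sval s - sval t| = gap (spx st).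
  by rewrite distrC ger0_norm ?subr_ge0.
rewrite gE distrC.
have -> : X.2 (from0 t) - X.2 (from0 s) =
    X.2 (spx st) + hoelder_tensor (X.1 s) (increment X.1 (spx st)).
  by rewrite (area_from0 X st) subrK.
apply: le_trans (ler_normD _ _) _; apply: lerD; first exact: area_bound.
apply: le_trans (norm_hoelder_tensor _ _) _.
apply: ler_pM => //; [exact: path_bound|exact: increment_bound].
Qed.

Lemma hoelder_space_modulus (W : normedModType R) (f : hoelder n alpha W) x y :
  `|f x - f y| <= n.+1%:R * `|f| * `|x - y| `^ modulus_exponent alpha 0.
Proof. exact: (pderiv_modulus f (s := [::])). Qed.

End hoelder_rough_path_bounds.

(** * From close samples to close rough paths *)

Section coordinates.
Context {R : realType}.

Lemma norm_sub_le4 (U : normedModType R) (a b c d : U) (p q r : R) :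
  `|a - c| <= p -> `|b - d| <= q -> `|c - d| <= r -> `|a - b| <= p + q + r.
Proof.
move=> ac bd cd; have -> : a - b = (a - c) - (b - d) + (c - d) by zmod.
apply: le_trans (ler_normD _ _) _; apply: lerD => //.
by apply: le_trans (ler_normB _ _) _; apply: lerD.
Qed.

Lemma powR_small_seq (c b M e : R) : 0 <= c -> 0 < b -> 0 < e ->
  exists m0, forall m, (m0 <= m)%N -> forall r, 0 <= r <= c / m.+1%:R ->
    M * r `^ b <= e.
Proof.
move=> c0 b0 e0; have [h h0 hP] := powR_small M b0 e0.
exists (Num.truncn (c / h)) => m m0m r /andP[r0 rc]; apply: hP; rewrite r0/=.
apply: le_trans rc _; rewrite ler_pdivrMr ?ltr0n// mulrC -ler_pdivrMr//.
have /andP[_ /ltW t2] := truncn_itv (divr_ge0 c0 (ltW h0)).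
by apply: le_trans t2 _; rewrite ler_nat ltnS.
Qed.

(** Interpolation in time. Over short gaps the surplus exponent [b - b'] beats the embedding
    constant; over long gaps smallness in space suffices, with target [e h ^ b']. The predicate
    [small] stands for a sup bound on values, in one or in two space variables. *)
Lemma seminorm_small (V W : normedModType R) (L : V -> W) (small : V -> R -> Prop)
    (C T b b' K e : R) : 0 <= C -> 0 <= K ->
  (forall v, `|L v| <= C * `|v|) ->
  (forall K e, 0 < e -> exists2 d : R, 0 < d & forall v, `|v| <= K ->
     small v d -> `|L v| <= e) ->
  0 < b' < b -> 0 < e ->
  exists2 d : R, 0 < d & forall v r, 0 < r <= T -> `|v| <= K * r `^ b ->
    small v d -> `|L v| <= e * r `^ b'.
Proof.
move=> C0 K0 LC Ls /andP[b'0 bb'] e0.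
have bb'0 : 0 < b - b' by rewrite subr_gt0.
have [h h0 hP] := powR_small (C * K) bb'0 e0.
have eh0 : 0 < e * h `^ b' by rewrite mulr_gt0 ?powR_gt0.
have [d d0 dP] := Ls (K * T `^ b) _ eh0.
exists d => // v r /andP[r0 rT] vK vd; have [rh|/ltW hr] := leP r h.
  apply: le_trans (LC v) _; apply: (@le_trans _ _ (C * (K * r `^ b))).
    by rewrite ler_wpM2l.
  have -> : r `^ b = r `^ (b - b') * r `^ b'.
    by rewrite -powRD ?subrK//; apply/implyP => _; rewrite gt_eqF.
  by rewrite !mulrA ler_wpM2r ?powR_ge0// hP// rh ltW.
apply: (@le_trans _ _ (e * h `^ b')); last first.
  by rewrite ler_wpM2l ?(ltW e0)// ge0_ler_powR ?nnegrE ?(ltW b'0) ?(ltW h0) ?(ltW r0).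
apply: dP => //; apply: le_trans vK _; rewrite ler_wpM2l//.
by rewrite ge0_ler_powR ?nnegrE ?(ltW r0) ?(le_trans (ltW r0) rT)// ltW// (lt_trans b'0).
Qed.

Context {T : R} {n : nat} {rho gamma alpha : R}.
Hypothesis T0 : 0 < T.
Hypothesis rho0 : 0 < rho.
Hypothesis gamma0 : 0 < gamma.
Hypothesis alpha0 : 0 < alpha.
Local Notation E := (euclid R n.+1).
Local Notation EE := (emx R n.+1 n.+1).
Local Notation S := (hoelder_rough_path T gamma n alpha rho).

Definition samples_close m (d : R) (z z' : space_time_field T n) :=
  forall j, `|(sample rho T0 m z j).1 - (sample rho T0 m z' j).1| <= d /\
            `|(sample rho T0 m z j).2 - (sample rho T0 m z' j).2| <= d.

Lemma modulus_exponent0_gt0 : 0 < modulus_exponent alpha 0.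
Proof.
rewrite /modulus_exponent lt0n; case: eqVneq => //= k0.
by rewrite k0 subr0.
Qed.

(** On a norm ball the moduli in time and space are uniform, so any point can be moved to a sample
    point at cost [e / 3] for each of the two rough paths; closeness at the sample costs the last
    third. Moving an area takes four terms of size [e / 12]. Outside the ball of radius [rho] both
    fields vanish. *)
Lemma samples_close_field (M e : R) : 0 <= M -> 0 < e ->
  exists m0, exists2 d : R, 0 < d & forall m (X Y : S), (m0 <= m)%N ->
    rough_norm gamma X <= M -> rough_norm gamma Y <= M ->
    samples_close m d (field_of X) (field_of Y) ->
    (forall t x, `|X.1 t x - Y.1 t x| <= e) /\
    (forall t x y, `|X.2 (from0 t) x y - Y.2 (from0 t) x y| <= e).
Proof.
move=> M0 e0; have e120 : 0 < e / 12 by rewrite divr_gt0.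
have b0 := modulus_exponent0_gt0.
have g20 : 0 < 2 * gamma by rewrite mulr_gt0.
have c0 : 0 <= n.+1%:R * rho by rewrite mulr_ge0// ltW.
have [m1 P1] := powR_small_seq M (ltW T0) gamma0 e120.
have [m2 P2] := powR_small_seq M (ltW T0) g20 e120.
have [m3 P3] := powR_small_seq (M * T `^ gamma * M) (ltW T0) gamma0 e120.
have [m4 P4] := powR_small_seq (n.+1%:R * (M * T `^ gamma)) c0 b0 e120.
have [m5 P5] := powR_small_seq (n.+1%:R * (M * T `^ (2 * gamma))) c0 b0 e120.
exists (m1 + m2 + m3 + m4 + m5)%N, (e / 3); first by rewrite divr_gt0.
move=> m X Y mm XM YM XY.
have [mm1 mm2 mm3 mm4 mm5] :
  [/\ (m1 <= m), (m2 <= m), (m3 <= m), (m4 <= m) & (m5 <= m)]%N.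
  by clear -mm; split; lia.
have path_near (Z : S) t x s g : rough_norm gamma Z <= M ->
    `|sval s - sval t| <= T / m.+1%:R ->
    `|x - g| <= n.+1%:R * rho / m.+1%:R ->
    `|Z.1 t x - Z.1 s g| <= e / 6.
  move=> ZM st xg; rewrite -(subrK (Z.1 s x) (Z.1 t x)) -addrA.
  apply: le_trans (ler_normD _ _) _.
  have -> : e / 6 = e / 12 + e / 12 by field.
  apply: lerD.
    apply: le_trans (hoelder_norm_sup (Z.1 t - Z.1 s) x) _.
    apply: le_trans (path_time_modulus t s ZM) _.
    by apply: (P1 m mm1); rewrite normr_ge0 distrC.
  apply: le_trans (hoelder_space_modulus (Z.1 s) x g) _.
  apply: le_trans (P4 m mm4 `|x - g| _); last by rewrite normr_ge0.
  rewrite ler_wpM2r ?powR_ge0// ler_wpM2l//.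
  exact: path_bound.
have area_near (Z : S) t x y s g g' : rough_norm gamma Z <= M ->
    `|sval s - sval t| <= T / m.+1%:R ->
    `|x - g| <= n.+1%:R * rho / m.+1%:R ->
    `|y - g'| <= n.+1%:R * rho / m.+1%:R ->
    `|Z.2 (from0 t) x y - Z.2 (from0 s) g g'| <= e / 3.
  move=> ZM st xg yg.
  have -> : Z.2 (from0 t) x y - Z.2 (from0 s) g g' =
      (Z.2 (from0 t) x y - Z.2 (from0 s) x y) +
      ((Z.2 (from0 s) x y - Z.2 (from0 s) g y) +
      (Z.2 (from0 s) g y - Z.2 (from0 s) g g')).
    by rewrite addrA !subrKA.
  apply: le_trans (ler_normD _ _) _.
  have -> : e / 3 = (e / 12 + e / 12) + (e / 12 + e / 12) by field.
  have Zs : n.+1%:R * `|Z.2 (from0 s)| <= n.+1%:R * (M * T `^ (2 * gamma)).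
    rewrite ler_wpM2l//; apply: le_trans (area_bound (from0 s) ZM) _.
    by rewrite ler_wpM2l// gap_powR_leT// ltW.
  apply: lerD.
    apply: le_trans (hoelder_norm_sup ((Z.2 (from0 t) - Z.2 (from0 s)) x) y) _.
    apply: le_trans (hoelder_norm_sup (Z.2 (from0 t) - Z.2 (from0 s)) x) _.
    apply: le_trans (area_time_modulus gamma0 t s ZM) _.
    by apply: lerD; [apply: (P2 m mm2)|rewrite mulrA; apply: (P3 m mm3)];
      rewrite normr_ge0 distrC.
  apply: le_trans (ler_normD _ _) _; apply: lerD.
    apply: le_trans (hoelder_norm_sup (Z.2 (from0 s) x - Z.2 (from0 s) g) y) _.
    apply: le_trans (hoelder_space_modulus (Z.2 (from0 s)) x g) _.
    apply: le_trans (P5 m mm5 `|x - g| _); last by rewrite normr_ge0.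
    by rewrite ler_wpM2r ?powR_ge0.
  apply: le_trans (hoelder_space_modulus (Z.2 (from0 s) g) y g') _.
  apply: le_trans (P5 m mm5 `|y - g'| _); last by rewrite normr_ge0.
  rewrite ler_wpM2r ?powR_ge0//; apply: le_trans Zs; rewrite ler_wpM2l//.
  exact: hoelder_norm_sup.
have e0' := ltW e0.
split=> [t x|t x y].
  have [xr|xr] := leP `|x| rho; last by rewrite !path_support// subrr normr0.
  have [g xg] := grid_point_near rho0 m xr.
  have [j jg st] := sample_near T0 t (g, g).
  rewrite mulrA in xg.
  have [+ _] := XY j; rewrite /sample/= jg/= => XYj.
  have h1 := path_near X t x _ _ XM st xg.
  have h2 := path_near Y t x _ _ YM st xg.
  have e63 : e / 6 <= e / 3 by rewrite ler_pM2l// lef_pV2 ?posrE// ler_nat.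
  have -> : e = e / 3 + e / 3 + e / 3 by field.
  exact: norm_sub_le4 (le_trans h1 e63) (le_trans h2 e63) XYj.
have [xr|xr] := leP `|x| rho; last by rewrite !area_support ?xr// subrr normr0.
have [yr|yr] := leP `|y| rho; last by rewrite !area_support ?yr ?orbT// subrr normr0.
have [g xg] := grid_point_near rho0 m xr.
have [g' yg] := grid_point_near rho0 m yr.
have [j jg st] := sample_near T0 t (g, g').
rewrite mulrA in xg; rewrite mulrA in yg.
have [_] := XY j; rewrite /sample/= jg/= => XYj.
have h1 := area_near X t x y _ _ _ XM st xg yg.
have h2 := area_near Y t x y _ _ _ YM st xg yg.
have -> : e = e / 3 + e / 3 + e / 3 by field.
exact: norm_sub_le4 h1 h2 XYj.
Qed.

Lemma hoelder2_sub6 (a b c a' b' c' : hoelder n alpha (hoelder n alpha EE)) x y :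
  (a - b - c - (a' - b' - c')) x y =
  (a x y - a' x y) - (b x y - b' x y) - (c x y - c' x y).
Proof.
rewrite -[LHS]/(a x y - b x y - c x y - (a' x y - b' x y - c' x y)).
move: (a x y) (b x y) (c x y) (a' x y) (b' x y) (c' x y) => *; zmod.
Qed.

Context {gamma' alpha' : R}.
Hypothesis gammas : 0 < gamma' < gamma.
Hypothesis alphas : 0 < alpha' < alpha.

(** Close samples make increments and areas uniformly small in value; interpolation in space, then
    in time, turns this into smallness in the weaker metric. *)
Lemma samples_close_lower (M e : R) : 0 <= M -> 0 < e ->
  exists m0, exists2 d : R, 0 < d & forall m (X Y : S), (m0 <= m)%N ->
    rough_norm gamma X <= M -> rough_norm gamma Y <= M ->
    samples_close m d (field_of X) (field_of Y) ->
    mdist (lower_rough gammas alphas X) (lower_rough gammas alphas Y) <= e.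
Proof.
move=> M0 e0; have e20 : 0 < e / 2 by rewrite divr_gt0.
have g2s : 0 < 2 * gamma' < 2 * gamma.
  by case/andP: gammas => g1 g2; rewrite mulr_gt0//= ltr_pM2l.
have MM0 : 0 <= M + M by rewrite addr_ge0.
have [C1 C10 C1P] := @lower_bounded R n _ _ E alphas.
have [C2 C20 C2P] := @lower2_bounded R n _ _ alphas.
have [d1 d10 d1P] := @seminorm_small _ _ (lower alphas)
  (fun f d => forall x, `|f x| <= d) C1 T gamma gamma' (M + M) (e / 2) (ltW C10) MM0
  C1P (@lower_small R n _ _ E alphas) gammas e20.
have [d2 d20 d2P] := @seminorm_small _ _ (lower2 alphas)
  (fun f d => forall x y, `|f x y| <= d) C2 T (2 * gamma) (2 * gamma') (M + M) (e / 2)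
  (ltW C20) MM0 C2P (@lower2_small R n _ _ alphas) g2s e20.
(* In Chen's relation the two areas from time 0 give [2 eta], and the tensor gives
   [4 M T ^ gamma eta]: the path differs by [eta], its increments by [2 eta]. *)
pose K := 2 + 4 * (M * T `^ gamma).
have MT0 : 0 <= M * T `^ gamma by rewrite mulr_ge0// powR_ge0.
have K0 : 0 < K by rewrite ltr_pwDl// mulr_ge0.
pose eta := Num.min (d1 / 2) (d2 / K).
have eta0 : 0 < eta by rewrite lt_min !divr_gt0.
have [m0 [d d0 dP]] := samples_close_field M0 eta0.
exists m0, d => // m X Y mm XM YM /(dP m X Y mm XM YM)[XY1 XY2].
have eta1 : eta + eta <= d1.
  by rewrite -mulr2n -mulr_natr -ler_pdivlMr// ge_min lexx.
have incXY p x : `|increment X.1 p x - increment Y.1 p x| <= eta + eta.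
  rewrite /increment/=.
  have -> : (X.1 (sval p).2 - X.1 (sval p).1) x - (Y.1 (sval p).2 - Y.1 (sval p).1) x =
    (X.1 (sval p).2 x - Y.1 (sval p).2 x) - (X.1 (sval p).1 x - Y.1 (sval p).1 x).
    have zm (U : zmodType) (a b c c' : U) : a - b - (c - c') = (a - c) - (b - c') by zmod.
    exact: zm.
  by apply: le_trans (ler_normB _ _) _; apply: lerD; exact: XY1.
rewrite [e]splitr; apply: rough_dist_le; first exact: ltW.
  move=> p p0; rewrite !lower_increment -linearB.
  apply: d1P; first by rewrite p0 gap_le.
    apply: le_trans (ler_normB _ _) _; rewrite mulrDl.
    exact: lerD (increment_bound p XM) (increment_bound p YM).
  by move=> x; apply: le_trans eta1; exact: incXY.
move=> p p0; rewrite -linearB; apply: d2P; first by rewrite p0 gap_le.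
  apply: le_trans (ler_normB _ _) _; rewrite mulrDl.
  exact: lerD (area_bound p XM) (area_bound p YM).
move=> x y; apply: (@le_trans _ _ (eta * K)); last first.
  by rewrite -ler_pdivlMr// ge_min lexx orbT.
case: p p0 => -[s t] st p0.
rewrite -[exist _ (s, t) st]/(spx (st : sval s <= sval t)).
rewrite (area_from0 X st) (area_from0 Y st).
set f := increment X.1 _; set g := increment Y.1 _.
rewrite hoelder2_sub6 !hoelder_tensorE.
apply: le_trans (ler_normB _ _) _; rewrite /K mulrDr; apply: lerD.
  rewrite mulr_natr mulr2n.
  by apply: le_trans (ler_normB _ _) _; apply: lerD; exact: XY2.
rewrite tensorB.
apply: le_trans (ler_normD _ _) _; rewrite !norm_tensor.
have fb : `|f y| <= (M + M) * T `^ gamma.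
  apply: le_trans (hoelder_norm_sup f y) _.
  apply: le_trans (increment_bound (spx st) XM) _.
  apply: (@le_trans _ _ (M * T `^ gamma)); first by rewrite ler_wpM2l// gap_powR_leT// ltW.
  by rewrite ler_wpM2r ?powR_ge0// lerDl.
have Yb : `|Y.1 s x| <= M * T `^ gamma.
  by apply: le_trans (hoelder_norm_sup (Y.1 s) x) _; exact: path_bound.
have -> : eta * (4 * (M * T `^ gamma)) =
    eta * ((M + M) * T `^ gamma) + (M * T `^ gamma) * (eta + eta) by field.
apply: lerD.
  exact: ler_pM (normr_ge0 _) (normr_ge0 _) (XY1 s x) fb.
exact: ler_pM (normr_ge0 _) (normr_ge0 _) Yb (incXY (spx st) y).
Qed.

End coordinates.

(** * Means and integer random variables *)

Section means.
Context {R : realType} {d} {Omega : measurableType d} (P : probability Omega R).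
Implicit Types (g h : Omega -> R) (N : Omega -> nat).

Definition prob (A : set Omega) : R := fine (P A).

Lemma probE A : measurable A -> P A = (prob A)%:E.
Proof. by move=> mA; rewrite /prob fineK// fin_num_measure. Qed.

Lemma prob_ge0 A : 0 <= prob A.
Proof. by rewrite /prob fine_ge0. Qed.

Lemma prob_le A B : measurable A -> measurable B -> A `<=` B -> prob A <= prob B.
Proof.
by move=> mA mB AB; rewrite -lee_fin -!probE// le_measure ?inE.
Qed.

Lemma prob_le1 A : measurable A -> prob A <= 1.
Proof. by move=> mA; rewrite -lee_fin -probE// probability_le1. Qed.

Lemma prob_setT : prob setT = 1.
Proof. by rewrite /prob probability_setT. Qed.

Lemma prob_setU A B : measurable A -> measurable B -> [disjoint A & B] ->
  prob (A `|` B) = prob A + prob B.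
Proof.
move=> mA mB AB; apply: EFin_inj; rewrite EFinD -!probE//; last exact: measurableU.
by rewrite measureU//; apply/eqP; rewrite -disj_set2E.
Qed.

Lemma prob_setC A : measurable A -> prob (~` A) = 1 - prob A.
Proof.
move=> mA; apply: EFin_inj; rewrite -probE; last exact: measurableC.
by rewrite probability_setC// probE.
Qed.

Lemma bounded_mean_integrable g (C : R) : measurable_fun setT g ->
  (forall x, `|g x| <= C) -> P.-integrable setT (EFin \o g).
Proof.
move=> mg gC; apply: measurable_bounded_integrable => //.
  exact: le_lt_trans (probability_le1 P measurableT) (ltry _).
by exists C; split; [exact: num_real|move=> M CM x _; exact: le_trans (gC x) (ltW CM)].
Qed.

Lemma expectation_Rintegral g : P.-integrable setT (EFin \o g) ->
  'E_P[g]%E = (\int[P]_x g x)%:E.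
Proof.
by move=> ig; rewrite unlock /Rintegral fineK// integrable_fin_num.
Qed.

Lemma Rintegral_indic A : measurable A -> \int[P]_x (\1_A x) = prob A.
Proof. by move=> mA; rewrite /Rintegral /prob integral_indic// setIT. Qed.

Lemma indic_integrable A : measurable A -> P.-integrable setT (EFin \o (\1_A : Omega -> R)).
Proof.
move=> mA; apply: (@bounded_mean_integrable _ 1) => //.
by move=> x; rewrite indicE; case: (_ \in _); rewrite ?normr1 ?normr0.
Qed.

Lemma mean_close g h A (e c : R) : measurable A ->
  P.-integrable setT (EFin \o g) -> P.-integrable setT (EFin \o h) ->
  (forall x, `|g x - h x| <= e + c * \1_A x) ->
  `|\int[P]_x g x - \int[P]_x h x| <= e + c * prob A.
Proof.
move=> mA ig ih gh.
have igh : P.-integrable setT (EFin \o (g \- h)).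
  by have := integrableB measurableT ig ih.
have iA := indic_integrable mA.
have icA : P.-integrable setT (EFin \o (fun x => c * \1_A x)).
  by have := integrableZl measurableT c iA.
have ie : P.-integrable setT (EFin \o (fun=> e)).
  by apply: (@bounded_mean_integrable _ `|e|).
rewrite -RintegralB//.
apply: le_trans (le_normr_Rintegral measurableT igh) _.
have -> : e + c * prob A = \int[P]_x (e + c * \1_A x).
  rewrite RintegralD// RintegralZl// Rintegral_indic// Rintegral_cst//.
  by rewrite -/(prob setT) prob_setT mulr1.
apply: le_Rintegral => //.
- by have := integrable_norm igh.
- by have := integrableD measurableT ie icA.
- by move=> x _; exact: gh.
Qed.

Section nat_variable.
Variable N : Omega -> nat.
Hypothesis mN : forall w, measurable (N @^-1` [set w]).

Lemma nat_preimage_measurable B : measurable (N @^-1` B).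
Proof.
have -> : N @^-1` B = \bigcup_(w in B) (N @^-1` [set w]).
  by apply/seteqP; split=> [x Bx|x [w Bw /= Nw]]; [exists (N x)|rewrite /= Nw].
exact: bigcup_measurable.
Qed.

Lemma nat_comp_measurable (g : nat -> R) : measurable_fun setT (g \o N).
Proof. by move=> _ Y mY; rewrite setTI comp_preimage; exact: nat_preimage_measurable. Qed.

Lemma prob_nat_lt K :
  prob (N @^-1` [set w | (w < K)%N]) = \sum_(w < K) prob (N @^-1` [set (w : nat)]).
Proof.
elim: K => [|K ih].
  rewrite big_ord0 (_ : N @^-1` _ = set0) ?/prob ?measure0//.
  by apply/seteqP; split.
rewrite big_ord_recr/= -ih -prob_setU//.
- congr prob; apply/seteqP; split=> x /=; rewrite ltnS [(N x <= K)%N]leq_eqVlt.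
    by case/orP => [/eqP|]; [right|left].
  by case=> ->; rewrite ?eqxx ?orbT.
- exact: nat_preimage_measurable.
- by apply/disj_set2P/seteqP; split => // x /= [NK NE]; move: NK; rewrite NE ltnn.
Qed.

(** The truncated sum is the mean of [g (N x)] cut off where [N x] reaches [K], so the error is at
    most [C] times the mass cut off. *)
Lemma mean_nat (g : nat -> R) (C : R) K : (forall w, `|g w| <= C) ->
  `|\int[P]_x g (N x) - \sum_(w < K) g w * prob (N @^-1` [set (w : nat)])| <=
    C * (1 - \sum_(w < K) prob (N @^-1` [set (w : nat)])).
Proof.
move=> gC; have C0 : 0 <= C by apply: le_trans (gC 0%N).
have ig : P.-integrable setT (EFin \o (g \o N)).
  by apply: (@bounded_mean_integrable _ C) => [|x]; [exact: nat_comp_measurable|exact: gC].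
have iw w : P.-integrable setT (EFin \o (fun x => g w * \1_(N @^-1` [set w]) x)).
  by have := integrableZl measurableT (g w) (indic_integrable (mN w)).
have [ih hE] : P.-integrable setT
      (EFin \o (fun x => \sum_(w < K) g w * \1_(N @^-1` [set (w : nat)]) x)) /\
    \int[P]_x (\sum_(w < K) g w * \1_(N @^-1` [set (w : nat)]) x) =
    \sum_(w < K) g w * prob (N @^-1` [set (w : nat)]).
  elim: (K) => [|k [ik kE]].
    have -> : (fun x => \sum_(w < 0) g w * \1_(N @^-1` [set (w : nat)]) x) = cst 0.
      by apply/funext => x; rewrite big_ord0.
    rewrite big_ord0 Rintegral_cst// mul0r; split=> //.
    by apply: (@bounded_mean_integrable _ 0) => // x; rewrite /= normr0.
  have -> : (fun x => \sum_(w < k.+1) g w * \1_(N @^-1` [set (w : nat)]) x) =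
      (fun x => \sum_(w < k) g w * \1_(N @^-1` [set (w : nat)]) x +
        g k * \1_(N @^-1` [set k]) x).
    by apply/funext => x; rewrite big_ord_recr.
  split; first by have := integrableD measurableT ik (iw k).
  rewrite big_ord_recr/= -kE RintegralD// RintegralZl ?Rintegral_indic//.
  exact: indic_integrable.
rewrite -hE -prob_nat_lt -prob_setC; last exact: nat_preimage_measurable.
rewrite -[X in _ <= X]add0r; apply: mean_close => //.
  by apply: measurableC; exact: nat_preimage_measurable.
move=> x; rewrite add0r indicE.
have [xK|Kx] := ltnP (N x) K.
  rewrite (bigD1 (Ordinal xK))//= big1 => [|i].
    rewrite addr0 indicE mem_set//= mulr1 subrr normr0 mulr_ge0//.
  rewrite -val_eqE/= => iN; rewrite indicE memNset ?mulr0//=.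
  by move=> Ni; move: iN; rewrite Ni eqxx.
rewrite big1 => [|i _].
  rewrite subr0 mem_set ?mulr1; first exact: gC.
  by move=> /= NK; move: Kx; rewrite leqNgt NK.
rewrite indicE memNset ?mulr0//= => Ni.
by move: Kx; rewrite Ni leqNgt ltn_ord.
Qed.

End nat_variable.

End means.

Lemma ord_sum_cvg (R : realType) K (u : nat -> nat -> R) (l : nat -> R) :
  (forall w, (fun k => u k w) @ \oo --> l w) ->
  (fun k => \sum_(w < K) u k w) @ \oo --> \sum_(w < K) l w.
Proof.
move=> ul; elim: K => [|K ih].
  by under eq_fun do rewrite big_ord0; rewrite big_ord0; exact: cvg_cst.
under eq_fun do rewrite big_ord_recr/=.
by rewrite big_ord_recr/=; apply: cvgD.
Qed.

Section nat_convergence.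
Variables (R : realType) (d_ : nat -> measure_display).
Variable Omega_ : forall k, measurableType (d_ k).
Variable P_ : forall k, probability (Omega_ k) R.
Context {d} {Omega : measurableType d} (P : probability Omega R).
Variables (N_ : forall k, Omega_ k -> nat) (N : Omega -> nat).
Arguments N_ : clear implicits.
Hypothesis mN_ : forall k w, measurable (N_ k @^-1` [set w]).
Hypothesis mN : forall w, measurable (N @^-1` [set w]).

(* Scheffe: no mass escapes in the limit, because the limits of the masses of the
   points sum to one. *)
Lemma nat_mean_cvg (g : nat -> R) (C : R) : (forall w, `|g w| <= C) ->
  (forall w, (fun k => prob (P_ k) (N_ k @^-1` [set w])) @ \oo -->
     prob P (N @^-1` [set w])) ->
  (fun k => \int[P_ k]_x g (N_ k x)) @ \oo --> \int[P]_x g (N x).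
Proof.
move=> gC cvgN; have C0 : 0 <= C by apply: le_trans (gC 0%N).
have mass : (fun K => \sum_(w < K) prob P (N @^-1` [set (w : nat)])) @ \oo --> (1 : R).
  have : (fun K => P (N @^-1` [set w | (w < K)%N])) @ \oo -->
      P (\bigcup_K (N @^-1` [set w | (w < K)%N])).
    apply: nondecreasing_cvg_mu.
    - by move=> K; exact: nat_preimage_measurable.
    - by apply: bigcup_measurable => K _; exact: nat_preimage_measurable.
    - by move=> K L KL; apply/subsetPset => x /= xK; exact: leq_trans KL.
  have -> : \bigcup_K (N @^-1` [set w | (w < K)%N]) = setT.
    by apply/seteqP; split=> // x _; exists (N x).+1 => /=.
  rewrite probability_setT => /fine_cvgP[_]; apply: cvg_trans; apply: near_eq_cvg.
  by apply: nearW => K; rewrite /= -(prob_nat_lt P mN).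
apply/cvgrPdist_le => e e0.
(* The tails cost [C e / c] under the limit law and [2 C e / c] under the others, and the truncated
   sums differ by [e / c]; one more [C e / c] is to spare. *)
pose c := C * 4 + 1.
have c0 : 0 < c by rewrite ltr_wpDl// mulr_ge0.
have ec0 : 0 < e / c by rewrite divr_gt0.
have [K /(_ K (leqnn K)) KP] := (cvg_seqP _ _).1 mass _ ec0.
have sum1 : (fun k => \sum_(w < K) prob (P_ k) (N_ k @^-1` [set (w : nat)])) @ \oo -->
    \sum_(w < K) prob P (N @^-1` [set (w : nat)]).
  apply: (@ord_sum_cvg _ K (fun k w => prob (P_ k) (N_ k @^-1` [set w]))
    (fun w => prob P (N @^-1` [set w]))) => w.
  exact: cvgN.
have sum2 : (fun k => \sum_(w < K) g w * prob (P_ k) (N_ k @^-1` [set (w : nat)])) @ \oo -->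
    \sum_(w < K) g w * prob P (N @^-1` [set (w : nat)]).
  apply: (@ord_sum_cvg _ K (fun k w => g w * prob (P_ k) (N_ k @^-1` [set w]))
    (fun w => g w * prob P (N @^-1` [set w]))) => w.
  by apply: cvgM; [exact: cvg_cst|exact: cvgN].
have /cvgrPdist_le/(_ _ ec0) s1 := sum1.
have /cvgrPdist_le/(_ _ ec0) s2 := sum2.
near=> k.
have h1 : `|\sum_(w < K) prob P (N @^-1` [set (w : nat)]) -
    \sum_(w < K) prob (P_ k) (N_ k @^-1` [set (w : nat)])| <= e / c.
  by near: k.
have h2 : `|\sum_(w < K) g w * prob P (N @^-1` [set (w : nat)]) -
    \sum_(w < K) g w * prob (P_ k) (N_ k @^-1` [set (w : nat)])| <= e / c.
  by near: k.
have h3 := mean_nat P mN K gC.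
have h4 := mean_nat (P_ k) (mN_ k) K gC.
move: KP h1 h2 h3 h4.
set a := \sum_(_ < _) prob P _; set b := \sum_(_ < _) prob (P_ k) _.
set u := \sum_(_ < _) _ * prob P _; set v := \sum_(_ < _) _ * prob (P_ k) _.
set s := \int[P]_x _; set t := \int[P_ k]_x _ => KP h1 h2 h3 h4.
have := norm_sub_le4 h3 h4 h2.
have a1 : 1 - a <= e / c by apply: le_trans KP; rewrite distrC; exact: ler_norm.
have b1 : 1 - b <= e / c + e / c.
  have := le_trans (ler_norm _) h1; move: a1; clear; lra.
have Ca := ler_wpM2l C0 a1; have Cb := ler_wpM2l C0 b1.
move=> h; apply: le_trans h _.
have eE : e = C * (e / c) + C * (e / c + e / c) + (C * (e / c) + e / c).
  by rewrite /c; field; rewrite gt_eqF.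
rewrite [leRHS]eE.
apply: lerD; first exact: lerD.
by rewrite lerDr mulr_ge0// ltW.
Unshelve. all: by end_near. Qed.

End nat_convergence.

(** * Extraction of subsequences *)

Section extraction.
Context {R : realType}.

Lemma subsequence_trans (f g : nat -> nat) :
  {homo f : i j / (i < j)%N} -> {homo g : i j / (i < j)%N} ->
  {homo (f \o g) : i j / (i < j)%N}.
Proof. by move=> fh gh i j ij; apply/fh/gh. Qed.

Lemma subsequence_ge (f : nat -> nat) i : {homo f : i j / (i < j)%N} -> (i <= f i)%N.
Proof. by move=> fh; elim: i => // i ih; apply: leq_ltn_trans ih (fh _ _ _). Qed.

Lemma increasing_choice (Q : nat -> nat -> Prop) :
  (forall j N, exists2 i, (N <= i)%N & Q j i) ->
  exists f : nat -> nat, {homo f : i j / (i < j)%N} /\ forall j, Q j (f j).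
Proof.
move=> QP.
have [h hP] : exists h : nat -> nat -> nat,
    forall j N, (N <= h j N)%N /\ Q j (h j N).
  have /choice[h hP] : forall jN : nat * nat, exists i, (jN.2 <= i)%N /\ Q jN.1 i.
    by move=> [j N]; have [i Ni ji] := QP j N; exists i.
  by exists (fun j N => h (j, N)) => j N; exact: (hP (j, N)).
pose f := fix f j := if j is i.+1 then h i.+1 (f i).+1 else h 0%N 0%N.
exists f; split; last by case=> [|j]; exact: (hP _ _).2.
by apply: homo_ltn => [|j]; [exact: ltn_trans|exact: (hP j.+1 (f j).+1).1].
Qed.

Lemma inv_small (e : R) : 0 < e ->
  exists N, forall m, (N <= m)%N -> m.+1%:R^-1 < e.
Proof.
move=> e0; have e'0 : 0 < e^-1 by rewrite invr_gt0.
have /andP[_ t] := truncn_itv (ltW e'0).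
exists (Num.truncn e^-1) => m Nm; rewrite -[ltRHS]invrK ltf_pV2 ?posrE//.
by apply: lt_le_trans t _; rewrite ler_nat.
Qed.

(** A cluster point in a compact product of segments replaces the nested choice of subsequences: the
    index number [j] is chosen so that the first [j] coordinates are within [1 / (j + 1)] of it. *)
Lemma diagonal_extraction (u : nat -> nat -> R) :
  (forall k, exists C, forall i, `|u k i| <= C) ->
  exists f : nat -> nat, {homo f : i j / (i < j)%N} /\
    forall k, cvgn (fun i => u k (f i)).
Proof.
move=> /choice[C CP].
pose A k : set R := `[- C k, C k]%classic.
have cA : compact [set x : prod_topology (fun _ : nat => R) | forall k, A k (x k)].
  by apply: tychonoff => k; exact: segment_compact.
pose v i : prod_topology (fun _ : nat => R) := fun k => u k i.
have vA : (v @ \oo) [set x : prod_topology (fun _ : nat => R) | forall k, A k (x k)].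
  by exists 0%N => // i _ k; rewrite /A/= in_itv/= -ler_norml; exact: CP.
have [a [_ av]] := cA (v @ \oo) _ vA.
have aU j (r : R) : 0 < r ->
    nbhs a [set x : prod_topology (fun _ : nat => R) |
      forall k, (k < j)%N -> `|x k - a k| < r].
  move=> r0; elim: j => [|j ih]; first by apply: filterS filterT.
  have aj : nbhs a [set x : prod_topology (fun _ : nat => R) | `|x j - a j| < r].
    have pj : nbhs a ((fun x => x j) @^-1` ball (a j) r).
      exact: (@proj_continuous nat (fun=> R) j a _ (nbhsx_ballx (a j) r r0)).
    by apply: filterS pj => x; rewrite /ball/= distrC.
  apply: filterS (filterI ih aj) => x [xj xjj] k; rewrite ltnS leq_eqVlt.
  by case/predU1P => [->|]; [exact: xjj|exact: xj].
have close j N : exists2 i, (N <= i)%N &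
    forall k, (k < j)%N -> `|u k i - a k| < j.+1%:R^-1.
  have vN : (v @ \oo) (v @` [set i | (N <= i)%N]).
    by exists N => // i Ni; exists i.
  have j0 : 0 < j.+1%:R^-1 :> R by rewrite invr_gt0.
  by have [_ [[i Ni <-] xU]] := av _ _ vN (aU j _ j0); exists i.
have [f [fh fP]] := increasing_choice close.
exists f; split=> // k; apply/cvg_ex; exists (a k); apply/cvgrPdist_le => e e0.
have [N0 N0P] := inv_small e0.
exists (maxn k.+1 N0) => // i /=; rewrite geq_max => /andP[ki Ni].
rewrite distrC; apply: ltW; apply: lt_trans (fP i k ki) _.
exact: N0P.
Qed.

End extraction.

(** * Realising a law of infinite words on the unit interval *)

Section nested_intervals.
Context {R : realType}.
Variable p : seq nat -> R.
Hypothesis p0 : forall w, 0 <= p w.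
Hypothesis p_nil : p [::] = 1.
Hypothesis p_sum : forall w : seq nat,
  (fun K => \sum_(i < K) p (rcons w (i : nat))) @ \oo --> p w.
Arguments p_sum : clear implicits.

(* The interval of the word [w] is [low w, low w + p w[; it is the disjoint union of
   the intervals of the words [rcons w i], placed from left to right. *)
Definition offset (w : seq nat) i : R := \sum_(j < i) p (rcons w (j : nat)).

Definition low w : R := \sum_(k < size w) offset (take k w) (nth 0%N w k).

Lemma low_rcons w i : low (rcons w i) = low w + offset w i.
Proof.
rewrite /low size_rcons big_ord_recr/=; congr (_ + _).
  apply: eq_bigr => k _; rewrite nth_rcons ltn_ord -cats1 take_cat.
  by rewrite ltn_ord.
by rewrite nth_rcons ltnn eqxx -cats1 take_size_cat.
Qed.

Lemma offsetS w i : offset w i.+1 = offset w i + p (rcons w i).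
Proof. by rewrite /offset big_ord_recr. Qed.

Lemma offset_le w i j : (i <= j)%N -> offset w i <= offset w j.
Proof.
move=> /subnK <-; elim: (j - i)%N => // k ih.
by rewrite addSn offsetS (le_trans ih)// lerDl.
Qed.

Lemma offset_le_mass w i : offset w i <= p w.
Proof.
have := nondecreasing_cvgn_le (_ : nondecreasing_seq (offset w)) (cvgP _ (p_sum w)) i.
by rewrite (cvg_lim _ (p_sum w))//; apply=> j k; exact: offset_le.
Qed.

Definition in_interval w t := low w <= t < low w + p w.

Definition child w t : nat :=
  xget 0%N [set i | low w + offset w i <= t < low w + offset w i.+1].

Lemma child_unique w t i :
  low w + offset w i <= t < low w + offset w i.+1 -> child w t = i.
Proof.
move=> hi; apply: xget_unique => // j /andP[j1 j2]; case/andP: hi => i1 i2.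
apply/eqP; rewrite eqn_leq; apply/andP; split; rewrite leqNgt; apply/negP.
  move=> ij; have := le_lt_trans (le_trans (_ : _ <= _) j1) i2.
  have := offset_le w ij; rewrite -(lerD2l (low w)) => h /(_ _ h).
  by rewrite ltxx.
move=> ji; have := le_lt_trans (le_trans (_ : _ <= _) i1) j2.
have := offset_le w ji; rewrite -(lerD2l (low w)) => h /(_ _ h).
by rewrite ltxx.
Qed.

(** The child masses sum to [p w] with nothing lost, so some offset passes [t]; the least such
    offset closes the interval of the wanted child. *)
Lemma childP w t : in_interval w t -> in_interval (rcons w (child w t)) t.
Proof.
move=> /andP[wt tw].
have [K tK] : exists K, t < low w + offset w K.
  have e0 : 0 < low w + p w - t by rewrite subr_gt0.
  have e20 : 0 < (low w + p w - t) / 2 by rewrite divr_gt0.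
  have [K /(_ K (leqnn K))] := (cvg_seqP _ _).1 (p_sum w) _ e20.
  rewrite -/(offset w K) distrC => /(le_trans (ler_norm _)) h.
  by exists K; lra.
have ex : exists K, t < low w + offset w K by exists K.
case: (ex_minnP ex) => -[|i]; first by rewrite /offset big_ord0 addr0 ltNge wt.
move=> ti imin.
have it : low w + offset w i <= t.
  by rewrite leNgt; apply/negP => /imin; rewrite ltnn.
rewrite (@child_unique w t i) ?it//.
by rewrite /in_interval low_rcons it/= -addrA -offsetS.
Qed.

Lemma in_interval_rcons w i t : in_interval (rcons w i) t ->
  in_interval w t /\ child w t = i.
Proof.
rewrite /in_interval low_rcons -addrA -offsetS => h; split; last exact: child_unique.
case/andP: h => h1 h2; apply/andP; split.
  by apply: le_trans h1; rewrite lerDl; apply: sumr_ge0 => j _.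
by apply: lt_le_trans h2 _; rewrite lerD2l offset_le_mass.
Qed.

Lemma low_bounds w : 0 <= low w /\ low w + p w <= 1.
Proof.
elim/last_ind: w => [|w i [l0 l1]].
  by rewrite /low big_ord0 add0r p_nil.
rewrite low_rcons; split.
  by rewrite addr_ge0//; apply: sumr_ge0 => j _.
by apply: le_trans l1; rewrite -addrA -offsetS lerD2l offset_le_mass.
Qed.

Fixpoint word (t : R) (k : nat) : seq nat :=
  if k is j.+1 then rcons (word t j) (child (word t j) t) else [::].

Lemma word_in_interval t k : 0 <= t < 1 -> in_interval (word t k) t.
Proof.
move=> t01; elim: k => [|k ih] /=; last exact: childP.
by rewrite /in_interval /low big_ord0 add0r p_nil.
Qed.

Lemma word_eq t w : 0 <= t < 1 -> word t (size w) = w <-> in_interval w t.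
Proof.
move=> t01; split=> [<-|]; first exact: word_in_interval.
elim/last_ind: w => [//|w i ih] /in_interval_rcons[/ih wt ti].
by rewrite size_rcons /= wt ti.
Qed.

(** The uniform law is a measure on the whole line; the points outside the unit interval form a null
    set and read the word of 0. *)
Definition clamp (t : R) : R := if 0 <= t < 1 then t else 0.

Definition letter (t : R) (k : nat) : nat := child (word (clamp t) k) (clamp t).

Lemma mkseq_letter t k : mkseq (letter t) k = word (clamp t) k.
Proof. by elim: k => // k ih; rewrite mkseqS ih. Qed.

Local Notation P01 := (uniform_prob (@ltr01 R)).

Lemma uniform_itv (a b : R) : 0 <= a -> a <= b -> b <= 1 -> P01 `[a, b[ = (b - a)%:E.
Proof.
move=> a0 ab b1; rewrite /uniform_prob.
rewrite (eq_integral (cst 1%:E)); last first.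
  move=> x; rewrite inE/= in_itv/= => /andP[ax xb].
  by rewrite /uniform_pdf (le_trans a0 ax) (le_trans (ltW xb) b1) subr0 invr1.
rewrite integral_cst//= lebesgue_measure_itv/= mul1e lte_fin.
move: ab; rewrite le_eqVlt => /predU1P[->|ab]; first by rewrite ltxx subrr.
by rewrite ab.
Qed.

Lemma uniform_outside (A : set R) : measurable A -> A `<=` ~` `[0, 1[%classic ->
  P01 A = 0%E.
Proof.
move=> mA A01; apply/eqP; rewrite eq_le measure_ge0 andbT.
apply: (@le_trans _ _ (P01 (~` `[0, 1[%classic))).
  by apply: le_measure => //; rewrite inE//; apply: measurableC; exact: measurable_itv.
rewrite probability_setC; last exact: measurable_itv.
rewrite [X in (_ - X)%E](_ : _ = 1%:E) ?subee//.
by apply: etrans (uniform_itv _ _ _) _ => //; rewrite subr0.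
Qed.

(** Inside the unit interval, exactly the interval of [w] reads [w], and its length is [p w]. The
    rest, [B], consists of clamped points and has mass 0. *)
Lemma word_preimage w : measurable [set t : R | mkseq (letter t) (size w) = w] /\
  P01 [set t : R | mkseq (letter t) (size w) = w] = (p w)%:E.
Proof.
have [l0 l1] := low_bounds w.
pose I := `[low w, low w + p w[%classic.
pose B : set R := [set t | (~~ (0 <= t < 1)) /\ word 0 (size w) = w].
have mB : measurable B.
  have [w0|w0] := pselect (word 0 (size w) = w); last first.
    by rewrite (_ : B = set0)//; apply/seteqP; split => // t [].
  rewrite (_ : B = ~` `[0, 1[%classic); first by apply: measurableC; exact: measurable_itv.
  apply/seteqP; split => t /=; rewrite in_itv/=; first by move=> [/negP].
  by move/negP.
have E : [set t : R | mkseq (letter t) (size w) = w] = I `|` B.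
  apply/seteqP; split=> t; rewrite /= mkseq_letter /clamp.
    case: ifPn => t01; last by right.
    by move/(word_eq w t01) => h; left; rewrite /I/= in_itv.
  case=> [|[t01 w0]]; last by rewrite (negbTE t01).
  rewrite /I/= in_itv/= => It.
  have t01 : 0 <= t < 1.
    case/andP: It => h1 h2; apply/andP; split; first exact: le_trans h1.
    exact: lt_le_trans l1.
  by rewrite t01; apply/word_eq.
have mI : measurable I by exact: measurable_itv.
rewrite E; split; first exact: measurableU.
have PI : P01 I = (p w)%:E.
  by rewrite uniform_itv ?lerDl// addrAC subrr add0r.
have PB : P01 B = 0%E.
  by apply: uniform_outside => // t [/negP t01 _]; rewrite /= in_itv.
transitivity (P01 I + P01 B)%E; last by rewrite PI PB adde0.
apply: measureU => //.
apply/seteqP; split=> // t [/=]; rewrite /I/= in_itv/= => /andP[h1 h2] [/negP t01 _].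
by apply: t01; rewrite (le_trans l0 h1) (lt_le_trans h2 l1).
Qed.

End nested_intervals.

(** * Limits of laws of infinite words *)

Definition has_prefix (T : Type) (q : T -> nat -> nat) (w : seq nat) : set T :=
  [set x | mkseq (q x) (size w) = w].

Section prefixes.
Context {R : realType} {d} {Omega : measurableType d} (P : probability Omega R).
Variable q : Omega -> nat -> nat.
Hypothesis mq : forall j w, measurable [set x | q x j = w].

Lemma has_prefix_rcons w i :
  has_prefix q (rcons w i) = has_prefix q w `&` [set x | q x (size w) = i].
Proof.
apply/seteqP; split=> x; rewrite /has_prefix/= size_rcons mkseqS.
  by move/rcons_inj => [-> ->].
by move=> [-> ->].
Qed.

Lemma measurable_has_prefix w : measurable (has_prefix q w).
Proof.
elim/last_ind: w => [|w i ih].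
  by rewrite (_ : has_prefix q [::] = setT)//; apply/seteqP; split.
by rewrite has_prefix_rcons; exact: measurableI.
Qed.

Lemma measurable_letter_lt j K : measurable [set x | (q x j < K)%N].
Proof.
exact: (@nat_preimage_measurable _ _ (q ^~ j) (mq j) [set w | (w < K)%N]).
Qed.

Lemma sum_has_prefix w K : \sum_(i < K) prob P (has_prefix q (rcons w (i : nat))) =
  prob P (has_prefix q w `&` [set x | (q x (size w) < K)%N]).
Proof.
elim: K => [|K ih].
  rewrite big_ord0 (_ : _ `&` _ = set0) ?/prob ?measure0//.
  by apply/seteqP; split=> x // [].
rewrite big_ord_recr/= ih has_prefix_rcons -prob_setU.
- congr prob; rewrite -setIUr; congr setI.
  apply/seteqP; split=> x /=; rewrite ltnS [(q x (size w) <= K)%N]leq_eqVlt.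
    by case=> ->; rewrite ?eqxx ?orbT.
  by case/orP => [/eqP|]; [right|left].
- by apply: measurableI; [exact: measurable_has_prefix|exact: measurable_letter_lt].
- by apply: measurableI; [exact: measurable_has_prefix|].
- apply/disj_set2P/seteqP; split => // x /= [[_ NK] [_ NE]].
  by move: NK; rewrite NE ltnn.
Qed.

End prefixes.

Section limit_words.
Variables (R : realType) (d_ : nat -> measure_display).
Variable Omega_ : forall k, measurableType (d_ k).
Variable P_ : forall k, probability (Omega_ k) R.
Variable q : forall k, Omega_ k -> nat -> nat.
Arguments q : clear implicits.
Hypothesis mq : forall k j w, measurable [set x | q k x j = w].
Hypothesis tight : forall j (e : R), 0 < e -> exists N, forall k,
  prob (P_ k) [set x | (N <= q k x j)%N] <= e.

(** There are countably many finite words, so one subsequence makes all prefix masses converge.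
    Tightness of each letter keeps the limits additive, which is what the nested intervals
    require. *)
Lemma limit_word : exists f : nat -> nat, {homo f : i j / (i < j)%N} /\
  exists q' : R -> nat -> nat, (forall w, measurable (has_prefix q' w)) /\
    forall w, (fun k => prob (P_ (f k)) (has_prefix (q (f k)) w)) @ \oo -->
      prob (uniform_prob (@ltr01 R)) (has_prefix q' w).
Proof.
(* Numbers that code no word repeat the empty word, which does no harm. *)
pose u i k := prob (P_ k) (has_prefix (q k) (odflt [::] (unpickle i))).
have mp k w : measurable (has_prefix (q k) w) by apply: measurable_has_prefix.
have [|f [fh fu]] := @diagonal_extraction R u.
  by move=> i; exists 1 => k; rewrite ger0_norm ?prob_ge0 ?prob_le1.
have fw w : cvgn (fun k => prob (P_ (f k)) (has_prefix (q (f k)) w)).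
  by have := fu (pickle w); rewrite /u pickleK.
pose p w := limn (fun k => prob (P_ (f k)) (has_prefix (q (f k)) w)).
have p0 w : 0 <= p w.
  by apply: limr_ge => //; apply: nearW => k; exact: prob_ge0.
have p_nil : p [::] = 1.
  rewrite /p (_ : (fun k => _) = cst 1) ?lim_cst//.
  apply/funext => k; rewrite (_ : has_prefix _ _ = setT) ?prob_setT//.
  by apply/seteqP; split.
(* The mass missing from the first [K] children is at most that of a large letter, which is small
   uniformly in [k], hence also in the limit. *)
have p_sum (w : seq nat) : (fun K => \sum_(i < K) p (rcons w (i : nat))) @ \oo --> p w.
  apply/cvg_seqP => e e0; have [N NP] := tight (size w) e0.
  exists N => K NK.
  have c : (fun k => \sum_(i < K) prob (P_ (f k)) (has_prefix (q (f k)) (rcons w (i : nat)))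
      - prob (P_ (f k)) (has_prefix (q (f k)) w)) @ \oo -->
      \sum_(i < K) p (rcons w (i : nat)) - p w.
    apply: cvgB; last exact: fw.
    apply: (@ord_sum_cvg _ K (fun k i => prob (P_ (f k)) (has_prefix (q (f k)) (rcons w i)))
      (fun i => p (rcons w i))) => i; exact: fw.
  rewrite -normrN -[X in `|X|]sub0r; apply: (norm_lim_le (N := 0%N) c) => k _.
  rewrite sub0r opprB sum_has_prefix//.
  have mlt : measurable [set x | (q (f k) x (size w) < K)%N].
    by apply: measurable_letter_lt.
  rewrite (_ : prob _ (has_prefix _ w) =
      prob (P_ (f k)) (has_prefix (q (f k)) w `&` [set x | (q (f k) x (size w) < K)%N]) +
      prob (P_ (f k)) (has_prefix (q (f k)) w `&` ~` [set x | (q (f k) x (size w) < K)%N])).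
    rewrite addrAC subrr add0r ger0_norm ?prob_ge0//.
    apply: le_trans (NP (f k)); apply: prob_le.
    - by apply: measurableI => //; exact: measurableC.
    - exact: (@nat_preimage_measurable _ _ (fun x => q (f k) x (size w))
        (mq (f k) (size w)) [set v | (N <= v)%N]).
    - by move=> x [_ /= /negP]; rewrite -leqNgt; exact: leq_trans.
  rewrite -prob_setU.
  - by rewrite -setIUr setUv setIT.
  - exact: measurableI.
  - by apply: measurableI => //; exact: measurableC.
  - by apply/disj_set2P; rewrite setIACA setICr setI0.
exists f; split=> //; exists (letter p); split.
  by move=> w; exact: (word_preimage p0 p_nil p_sum w).1.
move=> w; rewrite (_ : prob (uniform_prob _) _ = p w); first exact: fw.
have [_ wE] := word_preimage p0 p_nil p_sum w.
have := congr1 fine wE; rewrite /prob/=; exact.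
Qed.

End limit_words.

(** * Decoding words by approximation *)

Section discretisation.
Variables (S : choiceType) (B : nat -> set S) (q : S -> nat -> nat).
Variables (near_letter : nat -> S -> nat -> Prop) (x0 : S).
Hypothesis near_q : forall m x, near_letter m x (q x m).
Hypothesis B_homo : forall M M', (M <= M')%N -> B M `<=` B M'.

(** Membership in the smallest possible ball puts the representative in [B M] as soon as [B M] has
    any element near [w], although [rep] does not know [M]. *)
Definition rep_set (m w : nat) : set S := [set x | near_letter m x w /\
  exists2 M, B M x & forall M' y, B M' y -> near_letter m y w -> (M <= M')%N].

Definition rep (m w : nat) : S := xget x0 (rep_set m w).

Lemma repP m w M x : B M x -> near_letter m x w ->
  near_letter m (rep m w) w /\ B M (rep m w).
Proof.
move=> Mx xw.
have ex : exists M, `[< exists2 y, B M y & near_letter m y w >].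
  by exists M; apply/asboolP; exists x.
case: (ex_minnP ex) => M0 /asboolP[y M0y yw] min.
have [|rw [M1 M1r M1min]] := @xgetPex _ x0 (rep_set m w).
  exists y; split=> //; exists M0 => // M' z M'z zw.
  by apply: min; apply/asboolP; exists z.
by split=> //; apply: B_homo M1r; exact: M1min Mx xw.
Qed.

(** The element behind a prefix may change with its length: a limit word need not be the word of any
    element, but a common ball survives the limit, almost surely. *)
Definition good (xi : nat -> nat) : Prop :=
  exists M, forall k, exists2 x, B M x & mkseq (q x) k = mkseq xi k.

Definition approx (xi : nat -> nat) (k : nat) : S := rep k (xi k).

Lemma mkseq_eq_nth (f g : nat -> nat) j k : mkseq f k = mkseq g k ->
  (j < k)%N -> f j = g j.
Proof. by move=> fg jk; rewrite -(nth_mkseq 0%N f jk) fg nth_mkseq. Qed.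

(** A prefix long enough to hold both letters comes from one element, which links the
    representatives at levels [j] and [k]. *)
Lemma good_approx xi M j k :
  (forall k, exists2 x, B M x & mkseq (q x) k = mkseq xi k) ->
  exists x, [/\ B M x, near_letter j x (xi j) & near_letter k x (xi k)].
Proof.
move=> /(_ (maxn j k).+1)[x Mx xxi]; exists x; split=> //.
  by rewrite -(mkseq_eq_nth xxi) ?ltnS ?leq_maxl.
by rewrite -(mkseq_eq_nth xxi) ?ltnS ?leq_maxr.
Qed.

Lemma good_bounded xi M : (forall k, exists2 x, B M x & mkseq (q x) k = mkseq xi k) ->
  forall k, near_letter k (approx xi k) (xi k) /\ B M (approx xi k).
Proof.
move=> xiM k; have [x [Mx kx _]] := good_approx k k xiM.
exact: repP Mx kx.
Qed.

Variables (R : realType) (S' : metricType R) (e : S -> S').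
Hypothesis S'_complete : metric_seq_complete S'.
Hypothesis q_bounded : forall M m, exists N, forall x, B M x -> (q x m < N)%N.
Hypothesis near_close : forall M (eps : R), 0 < eps -> exists m0, forall m x y w,
  (m0 <= m)%N -> B M x -> B M y -> near_letter m x w -> near_letter m y w ->
  mdist (e x) (e y) <= eps.

Lemma approx_cauchy xi : good xi -> exists l, forall eps : R, 0 < eps ->
  exists N, forall i, (N <= i)%N -> mdist (e (approx xi i)) l <= eps.
Proof.
move=> [M xiM]; apply: S'_complete => eps eps0.
have eps20 : 0 < eps / 2 by rewrite divr_gt0.
have [m0 mP] := near_close M eps20.
exists m0 => i j mi mj.
have [x [Mx ix jx]] := good_approx i j xiM.
have [ia Mi] := good_bounded xiM i; have [ja Mj] := good_bounded xiM j.
rewrite [eps]splitr (le_trans (metric_triangle _ (e x) _))//.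
by apply: lerD; [exact: mP ia ix|exact: mP jx ja].
Qed.

Definition limit_point (xi : nat -> nat) : S' :=
  if pselect (good xi) is left gxi then sval (cid (approx_cauchy gxi)) else e x0.

Lemma limit_pointP xi : good xi -> forall eps : R, 0 < eps ->
  exists N, forall i, (N <= i)%N -> mdist (e (approx xi i)) (limit_point xi) <= eps.
Proof.
by move=> gxi; rewrite /limit_point; case: pselect => // g; case: cid.
Qed.

Lemma limit_point_bad xi : ~ good xi -> limit_point xi = e x0.
Proof. by move=> gxi; rewrite /limit_point; case: pselect. Qed.

(** It will be applied to the letters [w] of the decoded field, which may differ from those of [xi]
    because rounding is discontinuous. Being near the approximants is enough to recover the same
    limit. *)
Lemma rep_limit_point xi (w : nat -> nat) : good xi ->
  (forall m, exists K, forall k, (K <= k)%N -> near_letter m (approx xi k) (w m)) ->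
  forall eps : R, 0 < eps -> exists m0, forall m, (m0 <= m)%N ->
    mdist (e (rep m (w m))) (limit_point xi) <= eps.
Proof.
move=> gxi wP eps eps0; have eps20 : 0 < eps / 2 by rewrite divr_gt0.
have [M xiM] := gxi.
have [m0 mP] := near_close M eps20; have [N NP] := limit_pointP gxi eps20.
exists m0 => m mm; have [K KP] := wP m; pose k := maxn K N.
have km := KP k (leq_maxl _ _).
have [_ Mk] := good_bounded xiM k.
have [rm Mr] := repP Mk km.
rewrite [eps]splitr (le_trans (metric_triangle _ (e (approx xi k)) _))//.
by apply: lerD; [exact: mP rm km|apply: NP; rewrite leq_maxr].
Qed.

Lemma continuous_mdist (f : S' -> R) (l : S') (eps : R) :
  {for l, continuous f} -> 0 < eps ->
  exists2 d : R, 0 < d & forall y, mdist y l < d -> `|f y - f l| < eps.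
Proof.
move=> /cvgrPdist_lt fc eps0; have /nbhs_ballP[d /= d0 dP] := fc _ eps0.
exists d => // y yl; rewrite distrC; apply: dP.
by rewrite ballEmdist/= metric_sym.
Qed.

(** Sequential compactness of balls in the weaker metric. Along a subsequence every letter
    converges; letters are integers, so they are eventually constant, and a common letter at a fine
    level forces closeness. *)
Lemma bounded_letters_cauchy M (x_ : nat -> S) : (forall i, B M (x_ i)) ->
  exists f : nat -> nat, {homo f : i j / (i < j)%N} /\
    exists l, forall eps : R, 0 < eps -> exists N, forall i, (N <= i)%N ->
      mdist (e (x_ (f i))) l <= eps.
Proof.
move=> Mx.
have [|f [fh fu]] := @diagonal_extraction R (fun k i => (q (x_ i) k)%:R).
  move=> k; have [N NP] := q_bounded M k; exists N%:R => i.
  by rewrite ger0_norm// ler_nat ltnW// NP.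
exists f; split=> //; apply: S'_complete => eps eps0.
have [m mP] := near_close M eps0.
(* Two letters within 1/4 of the limit differ by less than 1, hence are equal. *)
have e20 : 0 < 4^-1 :> R by rewrite invr_gt0.
have /cvg_ex[l /cvg_seqP/(_ _ e20)[N NP]] := fu m.
exists N => i j Ni Nj; apply: (mP m _ _ (q (x_ (f i)) m)) => //.
suff -> : q (x_ (f i)) m = q (x_ (f j)) m by exact: near_q.
have {}NP : `|(q (x_ (f i)) m)%:R - (q (x_ (f j)) m)%:R| < 1 :> R.
  have -> : (q (x_ (f i)) m)%:R - (q (x_ (f j)) m)%:R =
    ((q (x_ (f i)) m)%:R - l) - ((q (x_ (f j)) m)%:R - l) :> R by ring.
  apply: (@le_lt_trans _ _ (4^-1 + 4^-1)); last by lra.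
  by apply: le_trans (ler_normB _ _) _; apply: lerD; exact: NP.
have [ij|ji|//] := ltngtP (q (x_ (f i)) m) (q (x_ (f j)) m).
- move: NP; rewrite distrC ger0_norm ?subr_ge0 ?ler_nat 1?ltnW//.
  by rewrite ltrBlDl -(natrD _ _ 1) ltr_nat addn1 ltnS leqNgt ij.
- move: NP; rewrite ger0_norm ?subr_ge0 ?ler_nat 1?ltnW//.
  by rewrite ltrBlDl -(natrD _ _ 1) ltr_nat addn1 ltnS leqNgt ji.
Qed.

(** The function [f] is merely continuous; uniformity on a ball comes from compactness. A sequence
    of counterexamples has a convergent subsequence, its representatives have the same limit, and
    continuity at that limit is contradicted. *)
Lemma uniform_rep (f : S' -> R) M (eps : R) : continuous f -> 0 < eps ->
  exists m0, forall m x, (m0 <= m)%N -> B M x ->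
    `|f (e x) - f (e (rep m (q x m)))| <= eps.
Proof.
move=> fc eps0; apply: contrapT => no.
have /choice[mx mxP] : forall i, exists mx : nat * S, [/\ (i <= mx.1)%N, B M mx.2 &
    eps < `|f (e mx.2) - f (e (rep mx.1 (q mx.2 mx.1)))|].
  move=> i; apply: contrapT => noi; apply: no; exists i => m x im Mx.
  by rewrite leNgt; apply/negP => lt; apply: noi; exists (m, x).
have [|g [gh [l gl]]] := @bounded_letters_cauchy M (fun i => (mx i).2).
  by move=> i; have [] := mxP i.
have eps20 : 0 < eps / 2 by rewrite divr_gt0.
have [d d0 dP] := continuous_mdist (fc l) eps20.
have d30 : 0 < d / 3 by rewrite divr_gt0.
have [N NP] := gl _ d30; have [m0 mP] := near_close M d30.
pose i := g (maxn N m0); have [im Mi lt] := mxP i.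
have d1 : mdist (e (mx i).2) l <= d / 3 by apply: NP; rewrite leq_maxl.
have [nr Mr] := repP Mi (near_q (mx i).1 (mx i).2).
have d2 : mdist (e (rep (mx i).1 (q (mx i).2 (mx i).1))) (e (mx i).2) <= d / 3.
  apply: mP nr (near_q _ _) => //; apply: leq_trans im.
  by apply: leq_trans (subsequence_ge _ gh); rewrite leq_maxr.
have h1 : `|f (e (mx i).2) - f l| < eps / 2.
  by apply: dP; apply: le_lt_trans d1 _; lra.
have h2 : `|f (e (rep (mx i).1 (q (mx i).2 (mx i).1))) - f l| < eps / 2.
  apply: dP; apply: le_lt_trans (metric_triangle _ (e (mx i).2) _) _.
  by apply: le_lt_trans (lerD d2 d1) _; lra.
move: lt; rewrite ltNge => /negP; apply.
set a := f _; set b := f _.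
have -> : a - b = (a - f l) - (b - f l) by ring.
apply: le_trans (ler_normB _ _) _; rewrite [eps]splitr.
by apply: lerD; exact: ltW.
Qed.

End discretisation.

(** * Borel measurability and bounded convergence *)

Section borel.
Context {R : realType} {d} {Omega : measurableType d}.

Lemma borel_open (S : topologicalType) (Y : Omega -> S) :
  (forall O, open O -> measurable (Y @^-1` O)) -> borel_measurable Y.
Proof.
move=> YO A sA; apply: (sA [set A | measurable (Y @^-1` A)]); split; last exact: YO.
split.
- by rewrite /= preimage_set0.
- by move=> C mC; rewrite /= setTD -preimage_setC; exact: measurableC.
- by move=> F mF; rewrite /= preimage_bigcup; exact: bigcupT_measurable.
Qed.

Lemma borel_preimage_open (S : topologicalType) (Y : Omega -> S) O :
  borel_measurable Y -> open O -> measurable (Y @^-1` O).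
Proof. by move=> mY oO; apply: mY; exact: sub_sigma_algebra. Qed.

Lemma borel_comp (S S' : topologicalType) (Y : Omega -> S) (f : S -> S') :
  borel_measurable Y -> continuous f -> borel_measurable (f \o Y).
Proof.
move=> mY fc; apply: borel_open => O oO; rewrite comp_preimage.
by apply: borel_preimage_open => //; apply: open_comp => // x _; exact: fc.
Qed.

Lemma borel_measurable_fun (Y : Omega -> R) : borel_measurable Y ->
  measurable_fun setT Y.
Proof.
move=> mY; apply: (measurability _ (RGenOInfty.measurableE R)).
move=> _ [_ [x ->] <-]; by rewrite setTI; apply: borel_preimage_open.
Qed.

Context (P : probability Omega R).

Lemma bounded_mean_cvg (h_ : nat -> Omega -> R) (h : Omega -> R) (C : R) (A : set Omega) :
  (forall k, measurable_fun setT (h_ k)) -> measurable_fun setT h ->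
  (forall k x, `|h_ k x| <= C) -> (forall x, `|h x| <= C) ->
  measurable A -> prob P (~` A) = 0 -> (forall x, A x -> (fun k => h_ k x) @ \oo --> h x) ->
  (fun k => \int[P]_x h_ k x) @ \oo --> \int[P]_x h x.
Proof.
move=> mh_ mh h_C hC mA A0 hA.
have ih := bounded_mean_integrable P mh hC.
have [] := @dominated_convergence _ _ _ P setT measurableT
  (fun k x => (h_ k x)%:E) (EFin \o h) (cst C%:E).
- by move=> k; apply/measurable_EFinP.
- exact/measurable_EFinP.
- exists (~` A); split; [exact: measurableC| |].
    by apply: etrans (probE P (measurableC mA)) _; rewrite A0.
  move=> x /= hx Ax; apply: hx => _; apply: cvg_EFin; last exact: hA.
  by apply: nearW.
- by apply: (bounded_mean_integrable P (C := `|C|)).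
- by apply: aeW => x k _; rewrite lee_fin.
move=> _ _ c; apply: fine_cvg; apply: cvg_trans c _.
by rewrite /Rintegral fineK ?integrable_fin_num.
Qed.

End borel.

Lemma real_lim_le (R : realType) (u : nat -> R) (l c : R) :
  u @ \oo --> l -> (forall i, u i <= c) -> l <= c.
Proof.
move=> /cvg_seqP ul uc; apply/ler_addgt0Pr => e e0.
have [N /(_ N (leqnn N)) NP] := ul e e0.
by have := ler_norm (l - u N); rewrite distrC in NP; have := uc N; lra.
Qed.

(** * Convergence in law to the decoded limit word *)

Section tight_limit.
Variables (S : choiceType) (B : nat -> set S) (q : S -> nat -> nat).
Variables (near_letter : nat -> S -> nat -> Prop) (x0 : S).
Hypothesis near_q : forall m x, near_letter m x (q x m).
Hypothesis B_homo : forall M M', (M <= M')%N -> B M `<=` B M'.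
Variables (R : realType) (d_ : nat -> measure_display).
Variable Omega_ : forall k, measurableType (d_ k).
Variable P_ : forall k, probability (Omega_ k) R.
Variable X_ : forall k, Omega_ k -> S.
Arguments X_ : clear implicits.
Hypothesis mq : forall k j w, measurable [set x | q (X_ k x) j = w].
Hypothesis mB : forall k M, measurable [set x | B M (X_ k x)].
Hypothesis tight : forall e : R, 0 < e -> exists M, forall k,
  prob (P_ k) (~` [set x | B M (X_ k x)]) <= e.
Variables (d : measure_display) (Omega : measurableType d) (P : probability Omega R).
Variable q' : Omega -> nat -> nat.
Hypothesis mq' : forall w, measurable (has_prefix q' w).
Hypothesis q_q' : forall w,
  (fun k => prob (P_ k) (has_prefix (fun x => q (X_ k x)) w)) @ \oo -->
    prob P (has_prefix q' w).

(** Prefixes are turned into integers, so that the convergence of means of integer variables applies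
    to functions of a prefix. *)
Let code (l : seq nat) : nat := pickle l.
Let decode (n : nat) : seq nat := odflt [::] (unpickle n).

Let codeK : cancel code decode.
Proof. by move=> l; rewrite /decode /code pickleK. Qed.

Lemma code_preimage (T : Type) (u : T -> nat -> nat) k n :
  (fun x => code (mkseq (u x) k)) @^-1` [set n] =
    if (code (decode n) == n) && (size (decode n) == k) then has_prefix u (decode n)
    else set0.
Proof.
apply/seteqP; split=> x /=.
  move=> <-; rewrite codeK eqxx size_mkseq eqxx/= /has_prefix/=.
  by rewrite size_mkseq.
by case: ifP => // /andP[/eqP nE /eqP sk]; rewrite /has_prefix/= sk => ->.
Qed.

Lemma measurable_code k n : measurable ((fun x => code (mkseq (q' x) k)) @^-1` [set n]).
Proof. by rewrite code_preimage; case: ifP. Qed.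

Lemma measurable_code_ i k n :
  measurable ((fun x => code (mkseq (q (X_ i x)) k)) @^-1` [set n]).
Proof.
by rewrite code_preimage; case: ifP => // _; exact: measurable_has_prefix.
Qed.

Lemma prefix_preimage_measurable k (A : set (seq nat)) :
  measurable [set x | A (mkseq (q' x) k)].
Proof.
have -> : [set x | A (mkseq (q' x) k)] =
    (fun x => code (mkseq (q' x) k)) @^-1` (decode @^-1` A).
  by apply/seteqP; split=> x /=; rewrite codeK.
exact: nat_preimage_measurable (measurable_code k) _.
Qed.

Lemma letter_preimage_measurable k (A : set nat) : measurable [set x | A (q' x k)].
Proof.
have := prefix_preimage_measurable k.+1 [set l | A (nth 0%N l k)].
congr measurable; apply/seteqP; split=> x /=; by rewrite nth_mkseq.
Qed.

Lemma prefix_mean_cvg k (g : seq nat -> R) (C : R) : (forall l, `|g l| <= C) ->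
  (fun i => \int[P_ i]_x g (mkseq (q (X_ i x)) k)) @ \oo -->
    \int[P]_x g (mkseq (q' x) k).
Proof.
move=> gC.
have := @nat_mean_cvg _ _ _ P_ _ _ P (fun i x => code (mkseq (q (X_ i x)) k))
  (fun x => code (mkseq (q' x) k)) (fun i => measurable_code_ i k)
  (measurable_code k) (g \o decode) C (fun n => gC (decode n)).
have -> : (fun i => \int[P_ i]_x (g \o decode) (code (mkseq (q (X_ i x)) k))) =
    (fun i => \int[P_ i]_x g (mkseq (q (X_ i x)) k)).
  by apply/funext => i; apply: eq_Rintegral => x _; rewrite /= codeK.
have -> : \int[P]_x (g \o decode) (code (mkseq (q' x) k)) = \int[P]_x g (mkseq (q' x) k).
  by apply: eq_Rintegral => x _; rewrite /= codeK.
apply=> n; rewrite code_preimage.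
under eq_fun do rewrite code_preimage.
case: ifP => _; first exact: q_q'.
by rewrite /prob !measure0; under eq_fun do rewrite measure0; exact: cvg_cst.
Qed.

Let near_prefix M k (l : seq nat) := exists2 x, B M x & mkseq (q x) k = l.

Let bad M k : set Omega := [set x | ~ near_prefix M k (mkseq (q' x) k)].

Let measurable_bad M k : measurable (bad M k).
Proof. exact: (prefix_preimage_measurable k (fun l => ~ near_prefix M k l)). Qed.

(** A prefix realised by no element of [B M] can occur for [X_ k] only off the event [B M], and the
    mass of a set of prefixes of fixed length converges. *)
Lemma bad_small M (eps : R) : (forall k, prob (P_ k) (~` [set x | B M (X_ k x)]) <= eps) ->
  forall k, prob P (bad M k) <= eps.
Proof.
move=> Me k; pose g l : R := \1_[set l | ~ near_prefix M k l] l.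
have g1 l : `|g l| <= 1.
  by rewrite /g indicE; case: (_ \in _); rewrite ?normr1 ?normr0.
have -> : prob P (bad M k) = \int[P]_x g (mkseq (q' x) k).
  by rewrite -Rintegral_indic//; apply: eq_Rintegral => x _; rewrite /g !indicE.
have c := prefix_mean_cvg (k := k) g1.
apply: (real_lim_le c) => i.
have mp : measurable [set x | ~ near_prefix M k (mkseq (q (X_ i x)) k)].
  have -> : [set x | ~ near_prefix M k (mkseq (q (X_ i x)) k)] =
    (fun x => code (mkseq (q (X_ i x)) k)) @^-1` (decode @^-1` [set l | ~ near_prefix M k l]).
    by apply/seteqP; split=> x /=; rewrite codeK.
  exact: nat_preimage_measurable (measurable_code_ i k) _.
have -> : \int[P_ i]_x g (mkseq (q (X_ i x)) k) =
    prob (P_ i) [set x | ~ near_prefix M k (mkseq (q (X_ i x)) k)].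
  by rewrite -Rintegral_indic//; apply: eq_Rintegral => x _; rewrite /g !indicE.
apply: le_trans (Me i); apply: prob_le => //; first exact: measurableC.
by move=> x /= nx Mx; apply: nx; exists (X_ i x).
Qed.

Lemma goodE : [set x | good B q (q' x)] = \bigcup_M \bigcap_k ~` bad M k.
Proof.
apply/seteqP; split=> x.
  by move=> [M xM]; exists M => // k _ /=; apply; exact: xM.
by move=> [M _ xM]; exists M => k; apply: contrapT; exact: xM.
Qed.

Lemma measurable_good : measurable [set x | good B q (q' x)].
Proof.
rewrite goodE; apply: bigcupT_measurable => M; apply: bigcapT_measurable => k.
by apply: measurableC; exact: measurable_bad.
Qed.

(** For fixed [M] the bad events increase with the prefix length, so the bound for each length holds
    for their union, which contains every word that is not good. *)
Lemma prob_not_good : prob P (~` [set x | good B q (q' x)]) = 0.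
Proof.
apply/eqP; rewrite eq_le prob_ge0 andbT; apply/ler_addgt0Pr => eps eps0.
rewrite add0r; have [M Me] := tight eps0.
have mU : measurable (\bigcup_k bad M k) by exact: bigcupT_measurable.
apply: (@le_trans _ _ (prob P (\bigcup_k bad M k))).
  apply: prob_le => //; first by apply: measurableC; exact: measurable_good.
  move=> x nx; apply: contrapT => nbad; apply: nx; exists M => k.
  by apply: contrapT => xk; apply: nbad; exists k.
have c : (prob P \o bad M) @ \oo --> prob P (\bigcup_k bad M k).
  apply: fine_cvg; rewrite -probE//.
  apply: (nondecreasing_cvg_mu (mu := P)) => // j k jk.
  apply/subsetPset => x nx [y My yk]; apply: nx; exists y => //.
  have := congr1 (take j) yk.
  by rewrite /mkseq -!map_take take_iota (minn_idPl jk).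
by apply: (real_lim_le c) => k; exact: bad_small.
Qed.

Section limit_law.
Variables (S' : metricType R) (e : S -> S').
Hypothesis S'_complete : metric_seq_complete S'.
Hypothesis q_bounded : forall M m, exists N, forall x, B M x -> (q x m < N)%N.
Hypothesis near_close : forall M (eps : R), 0 < eps -> exists m0, forall m x y w,
  (m0 <= m)%N -> B M x -> B M y -> near_letter m x w -> near_letter m y w ->
  mdist (e x) (e y) <= eps.

Let Y (x : Omega) : S' :=
  limit_point x0 near_q B_homo S'_complete near_close (q' x).

Let rep' := rep B near_letter x0.

(** Off the good words the value is the default of [limit_point], which makes the convergence to [Y]
    hold everywhere and not just almost surely. *)
Let Y_ k (x : Omega) : S' :=
  if pselect (good B q (q' x)) then e (rep' k (q' x k)) else e x0.

Let Y_cvg x (eps : R) : 0 < eps -> exists N, forall k, (N <= k)%N ->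
  mdist (Y_ k x) (Y x) <= eps.
Proof.
move=> eps0; rewrite /Y_; case: pselect => gx; last first.
  by exists 0%N => k _; rewrite /Y limit_point_bad// mdistxx ltW.
exact: limit_pointP gx _ eps0.
Qed.

Let measurable_Y_ k (A : set S') : measurable (Y_ k @^-1` A).
Proof.
have mg := measurable_good.
have -> : Y_ k @^-1` A =
    ([set x | good B q (q' x)] `&` [set x | A (e (rep' k (q' x k)))]) `|`
    (~` [set x | good B q (q' x)] `&` [set x | A (e x0)]).
  apply/seteqP; split=> x; rewrite /Y_ /=; case: pselect => gx /=.
  - by left.
  - by right.
  - by case=> -[].
  - by case=> -[].
apply: measurableU; apply: measurableI => //.
- exact: (letter_preimage_measurable k [set w | A (e (rep' k w))]).
- exact: measurableC.
- have [Ax|Ax] := pselect (A (e x0)).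
    by rewrite (_ : [set x | _] = setT)//; apply/seteqP; split.
  by rewrite (_ : [set x | _] = set0)//; apply/seteqP; split.
Qed.

(** Under [Y_ k], a function of the event [good] and of one letter, preimages of arbitrary sets are
    measurable. The limit lies in [O] exactly when, for some [j], the approximations eventually keep
    a ball of radius [1 / (j + 1)] inside [O]. *)
Lemma limit_point_borel : borel_measurable Y.
Proof.
apply: borel_open => O oO.
pose O_ j : set S' := [set y | ball y j.+1%:R^-1 `<=` O].
have -> : Y @^-1` O = \bigcup_j \bigcup_N \bigcap_(k in [set k | (N <= k)%N]) (Y_ k @^-1` O_ j).
  apply/seteqP; split=> x /=.
    move=> Ox; have /nbhs_ballP[r /= r0 rO] : nbhs (Y x) O by exact: open_nbhs_nbhs.
    have r20 : 0 < r / 2 by rewrite divr_gt0.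
    have [j jP] := inv_small r20; have [N NP] := Y_cvg x r20.
    exists j => //; exists N => // k Nk z; rewrite ballEmdist/= => xz.
    apply: rO; rewrite ballEmdist/= [r]splitr.
    apply: le_lt_trans (metric_triangle _ (Y_ k x) _) _.
    apply: ler_ltD; first by rewrite metric_sym; exact: NP.
    exact: lt_trans xz (jP _ (leqnn _)).
  move=> [j _ [N _ jN]].
  have j0 : 0 < j.+1%:R^-1 / 2 :> R by rewrite divr_gt0// invr_gt0.
  have [K KP] := Y_cvg x j0.
  apply: (jN (maxn N K) (leq_maxl _ _)); rewrite ballEmdist/=.
  apply: le_lt_trans (KP _ (leq_maxr _ _)) _.
  by rewrite ltr_pdivrMr// ltr_pMr ?invr_gt0// ltr1n.
apply: bigcupT_measurable => j; apply: bigcupT_measurable => N.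
apply: bigcap_measurable => [|k _]; first by exists N => /=.
exact: measurable_Y_.
Qed.

Hypothesis meX : forall k, borel_measurable (e \o X_ k).

Lemma rep_mean_cvg (f : S' -> R) (C : R) : continuous f -> (forall y, `|f y| <= C) ->
  (fun m => \int[P]_x f (e (rep' m (q' x m)))) @ \oo --> \int[P]_x f (Y x).
Proof.
move=> fc fC.
apply: (bounded_mean_cvg (h_ := fun m x => f (e (rep' m (q' x m)))) (C := C)
  _ _ _ _ measurable_good prob_not_good) => //.
- move=> k _ A mA; rewrite setTI.
  exact: (letter_preimage_measurable k [set w | A (f (e (rep' k w)))]).
- apply: borel_measurable_fun; apply: (borel_comp (f := f)) => //.
  exact: limit_point_borel.
- move=> x gx; apply/cvg_seqP => eps eps0.
  have [dl dl0 dP] := continuous_mdist (fc (Y x)) eps0.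
  have dl20 : 0 < dl / 2 by rewrite divr_gt0.
  have [N NP] := limit_pointP x0 near_q B_homo S'_complete near_close gx dl20.
  exists N => k Nk; apply/ltW/dP; apply: le_lt_trans (NP k Nk) _.
  by rewrite ltr_pdivrMr// ltr_pMr// ltr1n.
Qed.

(** At a fixed fine level [m], the test function is replaced by its value at the representative of
    letter [m], with an error that is uniform in [k] up to the small mass outside a ball. Means of
    functions of a letter converge in [k], and their limits converge in [m] to the mean under the
    limit. *)
Lemma limit_point_weak_cvg : weak_cvg P_ (fun k => e \o X_ k) P Y.
Proof.
move=> f fc [C fC].
have C0 : 0 <= C by apply: le_trans (fC (e x0)).
have mX k : measurable_fun setT (f \o (e \o X_ k)).
  by apply: borel_measurable_fun; apply: borel_comp.
have mY : measurable_fun setT (f \o Y).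
  by apply: borel_measurable_fun; apply: borel_comp => //; exact: limit_point_borel.
have iX k := bounded_mean_integrable (P_ k) (mX k) (fun x => fC _).
have iY := bounded_mean_integrable P mY (fun x => fC _).
rewrite (expectation_Rintegral iY).
under eq_fun do rewrite (expectation_Rintegral (iX _)).
apply: cvg_EFin; first exact: nearW.
apply/cvg_seqP => eps eps0.
(* Replacement costs [eps / c] on the ball and at most [2 C eps / c] off it; the two limits cost
   [eps / c] each, and one is to spare. *)
pose c := 4 + 2 * C.
have c0 : 0 < c by rewrite ltr_pwDl// mulr_ge0.
have ec0 : 0 < eps / c by rewrite divr_gt0.
have [M MP] := tight ec0.
have [m0 m0P] := uniform_rep x0 near_q B_homo S'_complete q_bounded near_close M fc ec0.
have [m1 m1P] := (cvg_seqP _ _).1 (rep_mean_cvg fc fC) _ ec0.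
pose m := maxn m0 m1.
pose g l : R := f (e (rep' m (nth 0%N l m))).
have gC l : `|g l| <= C by exact: fC.
have [K KP] := (cvg_seqP _ _).1 (prefix_mean_cvg (k := m.+1) gC) _ ec0.
exists K => k Kk.
have h1 := m1P m (leq_maxr _ _).
have h2 := KP k Kk.
have E1 : \int[P]_x g (mkseq (q' x) m.+1) = \int[P]_x f (e (rep' m (q' x m))).
  by apply: eq_Rintegral => x _; rewrite /g nth_mkseq.
have mA : measurable (~` [set x | B M (X_ k x)]) by exact: measurableC.
have ig : (P_ k).-integrable setT (EFin \o (fun x => g (mkseq (q (X_ k x)) m.+1))).
  apply: (@bounded_mean_integrable _ _ _ _ _ C) => // _ A sA; rewrite setTI.
  have -> : (fun x => g (mkseq (q (X_ k x)) m.+1)) @^-1` A =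
    (fun x => q (X_ k x) m) @^-1` [set w | A (f (e (rep' m w)))].
    by apply/seteqP; split=> x /=; rewrite /g nth_mkseq.
  exact: nat_preimage_measurable (mq k m) _.
have := mean_close mA (iX k) ig (e := eps / c) (c := 2 * C).
have h x : `|(f \o (e \o X_ k)) x - g (mkseq (q (X_ k x)) m.+1)| <=
    eps / c + 2 * C * \1_(~` [set x | B M (X_ k x)]) x.
  rewrite /g nth_mkseq// indicE.
  have [Mx|Mx] := pselect (B M (X_ k x)).
    by rewrite memNset ?mulr0 ?addr0; [exact: m0P (leq_maxl _ _) Mx|by move=> /(_ Mx)].
  rewrite mem_set// mulr1; apply: le_trans (ler_normB _ _) _.
  rewrite mulrDl mul1r; apply: (@le_trans _ _ (C + C)); first by apply: lerD; exact: fC.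
  by rewrite lerDr ltW.
move=> /(_ h) h3.
have h4 : 2 * C * prob (P_ k) (~` [set x | B M (X_ k x)]) <= 2 * C * (eps / c).
  by rewrite ler_wpM2l ?mulr_ge0.
rewrite E1 in h2.
move: h1 h2 (le_trans h3 (lerD (lexx _) h4)).
set a := \int[P_ k]_x _; set b := \int[P_ k]_x _.
set u := \int[P]_x _; set v := \int[P]_x _ => h1 h2 {}h3.
rewrite -[X in `|X|]/(b - v).
have -> : b - v = (b - a) + ((a - u) + (u - v)) by ring.
have eE : eps = (eps / c + 2 * C * (eps / c)) + (eps / c + eps / c) + eps / c.
  by rewrite /c; field; rewrite gt_eqF.
rewrite [leRHS]eE -[leRHS]addrA; apply: le_trans (ler_normD _ _) _; apply: lerD => //.
apply: le_trans (ler_normD _ _) _.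
apply: le_trans (lerD h2 h1) _.
by rewrite lerDl ltW.
Qed.

End limit_law.

End tight_limit.

(** * Rounded samples as letters *)

Section letters.
Context {R : realType} {n : nat}.
Local Notation E := (euclid R n.+1).
Local Notation EE := (emx R n.+1 n.+1).

Definition entry_index (J : nat) : finType :=
  ('I_J * ('I_n.+1 + 'I_n.+1 * 'I_n.+1))%type.

Definition entry J (v : 'I_J -> E * EE) (i : entry_index J) : R :=
  match i.2 with
  | inl a => ((v i.1).1 : 'rV[R]_n.+1) 0 a
  | inr (a, b) => ((v i.1).2 : 'M[R]_n.+1) a b
  end.

Definition letter_of J m (v : 'I_J -> E * EE) : nat :=
  pickle [ffun i : entry_index J => Num.floor (m.+1%:R * entry v i)].

Definition letter_value J (w : nat) : {ffun entry_index J -> int} :=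
  odflt [ffun=> 0] (unpickle w).

(** Rounding errs by at most [1 / (m + 1)]. The doubled tolerance makes the relation stable under
    small perturbations of [v]. *)
Definition near_entries J m (v : 'I_J -> E * EE) (w : nat) : Prop :=
  forall i, `|entry v i - (letter_value J w i)%:~R / m.+1%:R| <= 2 / m.+1%:R.

Lemma letter_of_close J m (v : 'I_J -> E * EE) i :
  `|entry v i - (letter_value J (letter_of m v) i)%:~R / m.+1%:R| <= m.+1%:R^-1.
Proof.
have m0 : 0 < m.+1%:R :> R by rewrite ltr0n.
rewrite /letter_value /letter_of pickleK/= ffunE.
have /andP[] := floor_itv (m.+1%:R * entry v i).
rewrite intrD => h1 h2.
set f := (Num.floor _)%:~R in h1 h2 *; set a := entry v i in h1 h2 *.
have -> : a - f / m.+1%:R = (m.+1%:R * a - f) * m.+1%:R^-1 by field; rewrite gt_eqF.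
rewrite normrM [X in _ * X]gtr0_norm ?invr_gt0// ler_piMl ?invr_ge0//.
by rewrite ger0_norm ?subr_ge0// lerBlDl ltW.
Qed.

Lemma near_letter_of J m (v : 'I_J -> E * EE) : near_entries m v (letter_of m v).
Proof.
move=> i; apply: le_trans (letter_of_close m v i) _.
by rewrite ler_peMl ?ler1n// invr_ge0.
Qed.

(** Here the slack is spent: one half on the rounding of the limit, the other on the distance to
    it. *)
Lemma near_letter_lim J m (v_ : nat -> 'I_J -> E * EE) (v : 'I_J -> E * EE) :
  (forall i, (fun k => entry (v_ k) i) @ \oo --> entry v i) ->
  exists K, forall k, (K <= k)%N -> near_entries m (v_ k) (letter_of m v).
Proof.
move=> v_v.
have m0 : 0 < m.+1%:R^-1 :> R by rewrite invr_gt0.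
have /choice[K KP] i := (cvg_seqP _ _).1 (v_v i) _ m0.
exists (\max_i K i) => k Kk i.
have h1 := KP i k (leq_trans (leq_bigmax i) Kk).
rewrite -(subrK (entry v i) (entry (v_ k) i)) -addrA.
apply: le_trans (ler_normD _ _) _.
by rewrite [2 / _]mulrDl !mul1r; apply: lerD => //; exact: letter_of_close.
Qed.

Lemma near_entries_close J m (v v' : 'I_J -> E * EE) w j :
  near_entries m v w -> near_entries m v' w ->
  `|(v j).1 - (v' j).1| <= (n.+1 * n.+1)%:R * (4 / m.+1%:R) /\
  `|(v j).2 - (v' j).2| <= (n.+1 * n.+1)%:R * (4 / m.+1%:R).
Proof.
move=> vw v'w; have c0 : 0 <= 4 / m.+1%:R :> R by rewrite divr_ge0.
have vv' i : `|entry v i - entry v' i| <= 4 / m.+1%:R.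
  have -> : 4 / m.+1%:R = 2 / m.+1%:R + 2 / m.+1%:R :> R by rewrite -mulrDl -natrD.
  set l : R := (letter_value J w i)%:~R / m.+1%:R.
  have -> : entry v i - entry v' i = (entry v i - l) - (entry v' i - l) by ring.
  by apply: le_trans (ler_normB _ _) _; apply: lerD; [exact: vw|exact: v'w].
split.
  apply: (@le_trans _ _ ((1 * n.+1)%:R * (4 / m.+1%:R))).
    apply: norm_le_entries => // a b; rewrite ord1.
    by have := vv' (j, inl b); rewrite /entry/= !mxE.
  by rewrite ler_wpM2r// ler_nat leq_mul.
apply: norm_le_entries => // a b.
by have := vv' (j, inr (a, b)); rewrite /entry/= !mxE.
Qed.

(** The rounded entries lie between [-L] and [L], so only finitely many tables occur, and the
    largest of their codes bounds the letter. *)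
Lemma letter_of_bounded J m (K : R) : exists N, forall v : 'I_J -> E * EE,
  (forall i, `|entry v i| <= K) -> (letter_of m v < N)%N.
Proof.
pose L := (Num.truncn (m.+1%:R * `|K|)).+1.
pose shift (g : {ffun entry_index J -> 'I_(L + L).+1}) : {ffun entry_index J -> int} :=
  [ffun i => (g i)%:Z - L%:Z].
exists (\max_g pickle (shift g)).+1 => v vK; rewrite ltnS /letter_of.
have fl i : - L%:Z <= Num.floor (m.+1%:R * entry v i) <= L%:Z.
  have aL : `|m.+1%:R * entry v i| < L%:R.
    have /andP[_] := truncn_itv (mulr_ge0 (ler0n R m.+1) (normr_ge0 K)).
    apply: le_lt_trans; rewrite normrM ger0_norm// ler_wpM2l//.
    exact: le_trans (vK i) (ler_norm _).
  move: aL; rewrite ltr_norml => /andP[/ltW h1 /ltW h2].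
  have /andP[f1 f2] := floor_itv (m.+1%:R * entry v i).
  apply/andP; split; last by rewrite -(ler_int R) -pmulrn (le_trans f1).
  by rewrite -ltzD1 -(ltr_int R) mulrNz -pmulrn; apply: le_lt_trans f2.
have gP i : (`|(Num.floor (m.+1%:R * entry v i) + L%:Z)%R| < (L + L).+1)%N.
  have /andP[f1 f2] := fl i; clear -f1 f2; lia.
pose g : {ffun entry_index J -> 'I_(L + L).+1} := [ffun i => Ordinal (gP i)].
have -> : [ffun i : entry_index J => Num.floor (m.+1%:R * entry v i)] = shift g.
  apply/ffunP => i; rewrite !ffunE/=.
  have /andP[f1 f2] := fl i; clear -f1 f2; lia.
exact: leq_bigmax.
Qed.

Lemma entry_letter_measurable d (Omega : measurableType d) J m
    (V : Omega -> 'I_J -> E * EE) :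
  (forall i, measurable_fun setT (fun x => entry (V x) i)) ->
  forall w, measurable [set x | letter_of m (V x) = w].
Proof.
move=> mV w.
have [[g gw]|no] := pselect (exists g : {ffun entry_index J -> int}, pickle g = w); last first.
  rewrite (_ : [set x | _] = set0)//; apply/seteqP; split=> // x /= xw.
  by apply: no; eexists; exact: xw.
have -> : [set x | letter_of m (V x) = w] =
    \bigcap_(i in [set: entry_index J])
      ((fun x => entry (V x) i) @^-1`
        `[(g i)%:~R / m.+1%:R, (g i + 1)%:~R / m.+1%:R[%classic).
  have m0 : 0 < m.+1%:R :> R by rewrite ltr0n.
  apply/seteqP; split=> x /=.
    rewrite -gw /letter_of => /(pcan_inj pickleK) gE i _ /=.
    rewrite -gE ffunE in_itv/= ler_pdivrMr// ltr_pdivlMr// mulrC.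
    exact: floor_itv.
  move=> xg; rewrite -gw /letter_of; congr pickle; apply/ffunP => i; rewrite ffunE.
  apply: floor_def; have := xg i I; rewrite /= in_itv/= ler_pdivrMr// ltr_pdivlMr//.
  by rewrite mulrC.
apply: fin_bigcap_measurable => // i _.
by rewrite -[X in measurable X]setTI; apply: mV => //; exact: measurable_itv.
Qed.

End letters.

(** * Continuity of evaluations and measurability of letters *)

Section lipschitz_maps.
Context {R : realType}.

Lemma mdist_lipschitz_continuous (S : metricType R) (f : S -> R) (C : R) :
  (forall x y, `|f x - f y| <= C * mdist x y) -> continuous f.
Proof.
move=> fC x; apply/cvgrPdist_lt => eps eps0; apply/nbhs_ballP.
have C0 : 0 < `|C| + 1 by rewrite ltr_wpDl.
exists (eps / (`|C| + 1)); first by rewrite /= divr_gt0.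
move=> y; rewrite ballEmdist/= => xy; apply: le_lt_trans (fC x y) _.
apply: (@le_lt_trans _ _ ((`|C| + 1) * mdist x y)).
  by rewrite ler_wpM2r ?mdist_ge0// (le_trans (ler_norm C))// lerDl.
by rewrite mulrC -ltr_pdivlMr.
Qed.

Lemma mdist_lipschitz_continuousS (S S' : metricType R) (f : S -> S') (C : R) :
  0 < C -> (forall x y, mdist (f x) (f y) <= C * mdist x y) -> continuous f.
Proof.
move=> C0 fC x A /nbhs_ballP[r /= r0 rA]; apply/nbhs_ballP.
exists (r / C); first by rewrite /= divr_gt0.
move=> y; rewrite ballEmdist/= => xy; apply: rA; rewrite ballEmdist/=.
by apply: le_lt_trans (fC x y) _; rewrite mulrC -ltr_pdivlMr.
Qed.

Lemma entry_continuous (a b : nat) i j :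
  continuous (fun A : emx R a b => (A : 'M[R]_(a, b)) i j).
Proof.
move=> A; apply/(@cvgrPdist_lt _ R _ (nbhs A) _ (fun A : emx R a b => (A : 'M[R]_(a, b)) i j)).
move=> eps eps0; apply/nbhs_ballP; exists eps => // B; rewrite -ball_normE/=; apply: le_lt_trans.
by have := entry_le_norm (A - B) i j; rewrite !mxE.
Qed.

Context {n : nat}.
Local Notation E := (euclid R n.+1).
Local Notation EE := (emx R n.+1 n.+1).

Lemma ptws_entry_continuous J (i : entry_index J) :
  continuous (fun v : {ptws 'I_J -> (E * EE)%type} => entry v i).
Proof.
case: i => j c v.
have pj : (fun w : {ptws 'I_J -> (E * EE)%type} => w j) @ v --> v j.
  exact: (@proj_continuous _ (fun _ : 'I_J => (E * EE)%type) j v).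
case: c => [a|[a b]].
  have p1 : (fun w : {ptws 'I_J -> (E * EE)%type} => (w j).1) @ v --> (v j).1.
    exact: (cvg_comp _ _ pj (@cvg_fst _ _ _ _ _)).
  exact: (cvg_comp _ _ p1 (@entry_continuous _ _ 0 a (v j).1)).
have p2 : (fun w : {ptws 'I_J -> (E * EE)%type} => (w j).2) @ v --> (v j).2.
  exact: (cvg_comp _ _ pj (@cvg_snd _ _ _ _ _)).
exact: (cvg_comp _ _ p2 (@entry_continuous _ _ a b (v j).2)).
Qed.

Lemma letter_set_borel J m w :
  <<s @open {ptws 'I_J -> (E * EE)%type} >>
    [set v : {ptws 'I_J -> (E * EE)%type} | letter_of m v = w].
Proof.
(* The identity of the sample space with its Borel structure is treated as a random vector, so that
   the measurability of letters applies. *)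
pose Om := g_sigma_algebraType (@open {ptws 'I_J -> (E * EE)%type}).
have mE (i : entry_index J) : measurable_fun setT (fun v : Om => entry v i).
  apply: borel_measurable_fun; apply: borel_open => O oO.
  apply: sub_sigma_algebra; apply: open_comp => // v _.
  exact: ptws_entry_continuous.
exact: (entry_letter_measurable m mE w).
Qed.

End lipschitz_maps.

Lemma lipschitz_cvg (R : realType) (U : normedModType R) (S : metricType R)
    (u : nat -> U) (l : U) (y : nat -> S) (z : S) (C : R) : 0 <= C ->
  (forall eps : R, 0 < eps -> exists N, forall i, (N <= i)%N -> mdist (y i) z <= eps) ->
  (forall i, `|u i - l| <= C * mdist (y i) z) -> u @ \oo --> l.
Proof.
move=> C0 yz uy; apply/cvg_seqP => eps eps0.
have C1 : 0 < C + 1 by rewrite ltr_wpDl.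
have [N NP] := yz _ (divr_gt0 eps0 C1); exists N => i Ni; apply: le_trans (uy i) _.
apply: le_trans (ler_wpM2l C0 (NP i Ni)) _.
by rewrite mulrCA ler_piMr ?ltW// ltr_pdivrMr// mul1r ltrDl.
Qed.

Section field_letters.
Context {R : realType} {T : R} {n : nat} {rho gamma alpha : R}.
Hypothesis T0 : 0 < T.
Local Notation S := (hoelder_rough_path T gamma n alpha rho).

Lemma field_path_lipschitz (X Y : S) t x :
  `|(field_of X).1 t x - (field_of Y).1 t x| <= gap (from0 t) `^ gamma * mdist X Y.
Proof.
apply: le_trans (hoelder_norm_sup (X.1 t - Y.1 t) x) _.
rewrite [leRHS]mulrC; exact: (rough_dist_path X Y t).
Qed.

Lemma field_area_lipschitz (X Y : S) p x y :
  `|(field_of X).2 p x y - (field_of Y).2 p x y| <= gap p `^ (2 * gamma) * mdist X Y.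
Proof.
apply: le_trans (hoelder_norm_sup ((X.2 p - Y.2 p) x) y) _.
apply: le_trans (hoelder_norm_sup (X.2 p - Y.2 p) x) _.
rewrite [leRHS]mulrC; exact: (rough_dist_area X Y p).
Qed.

Lemma sample_entry_lipschitz m i : exists C : R, 0 <= C /\ forall X Y : S,
  `|entry (sample rho T0 m (field_of X)) i - entry (sample rho T0 m (field_of Y)) i| <=
    C * mdist X Y.
Proof.
case: i => j [a|[a b]].
  exists (gap (from0 (sample_time T0 j)) `^ gamma); split; first exact: powR_ge0.
  move=> X Y; apply: le_trans (field_path_lipschitz X Y _ (grid_point rho (sample_pair j).1)).
  rewrite /entry/=.
  have := entry_le_norm ((field_of X).1 (sample_time T0 j) (grid_point rho (sample_pair j).1) -
    (field_of Y).1 (sample_time T0 j) (grid_point rho (sample_pair j).1)) 0 a.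
  by rewrite !mxE.
exists (gap (from0 (sample_time T0 j)) `^ (2 * gamma)); split; first exact: powR_ge0.
move=> X Y; apply: le_trans (field_area_lipschitz X Y _ (grid_point rho (sample_pair j).1)
  (grid_point rho (sample_pair j).2)).
have := entry_le_norm ((field_of X).2 (from0 (sample_time T0 j))
    (grid_point rho (sample_pair j).1) (grid_point rho (sample_pair j).2) -
  (field_of Y).2 (from0 (sample_time T0 j))
    (grid_point rho (sample_pair j).1) (grid_point rho (sample_pair j).2)) a b.
by rewrite !mxE.
Qed.

Definition field_letter (z : space_time_field T n) (m : nat) : nat :=
  letter_of m (sample rho T0 m z).

Lemma field_letter_measurable d (Omega : measurableType d) (Y : Omega -> S) m w :
  borel_measurable Y -> measurable [set x | field_letter (field_of (Y x)) m = w].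
Proof.
move=> mY; apply: entry_letter_measurable => i; apply: borel_measurable_fun.
have [C [_ CP]] := sample_entry_lipschitz i.
exact: (borel_comp (f := fun X : S => entry (sample rho T0 m (field_of X)) i)
  mY (mdist_lipschitz_continuous CP)).
Qed.

End field_letters.

(** * Laws of random rough paths and their limits *)

Section rough_law.
Context {R : realType} {T : R} {n : nat} {rho gamma alpha : R}.
Hypothesis T0 : 0 < T.
Hypothesis rho0 : 0 < rho.
Hypothesis gamma0 : 0 < gamma.
Hypothesis alpha0 : 0 < alpha.
Local Notation E := (euclid R n.+1).
Local Notation EE := (emx R n.+1 n.+1).
Local Notation S := (hoelder_rough_path T gamma n alpha rho).

Local Notation field_letter := (@field_letter R T n rho T0).

Definition path_letter (X : S) (m : nat) : nat := field_letter (field_of X) m.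

Definition near_path (m : nat) (X : S) (w : nat) : Prop :=
  near_entries m (sample rho T0 m (field_of X)) w.

Lemma near_path_letter m X : near_path m X (path_letter X m).
Proof. exact: near_letter_of. Qed.

Definition norm_ball (M : nat) : set S := [set X | rough_norm gamma X <= M%:R].

Lemma norm_ball_homo M M' : (M <= M')%N -> norm_ball M `<=` norm_ball M'.
Proof. by move=> MM' X XM; apply: le_trans XM _; rewrite ler_nat. Qed.

Lemma rough_norm_continuous : continuous (fun X : S => rough_norm gamma X).
Proof.
apply: (@mdist_lipschitz_continuous _ _ _ 1) => X Y; rewrite mul1r ler_norml.
move: (rough_norm_dist X Y) (rough_norm_dist Y X) (metric_sym X Y).
move: (rough_norm gamma X) (rough_norm gamma Y) (mdist X Y) (mdist Y X) => a b c c'.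
by move=> h1 h2 cc; rewrite -cc in h2; apply/andP; split; lra.
Qed.

Lemma rough_norm_measurable d (Omega : measurableType d) (Y : Omega -> S) :
  borel_measurable Y -> measurable_fun setT (fun x => rough_norm gamma (Y x)).
Proof.
move=> mY; apply: borel_measurable_fun.
exact: (borel_comp (f := fun X : S => rough_norm gamma X) mY rough_norm_continuous).
Qed.

Lemma norm_ball_measurable d (Omega : measurableType d) (Y : Omega -> S) M :
  borel_measurable Y -> measurable [set x | norm_ball M (Y x)].
Proof.
move=> /rough_norm_measurable mY.
have := mY measurableT `]-oo, M%:R]%classic (measurable_itv _); rewrite setTI.
by congr measurable; apply/seteqP; split=> x /=; rewrite in_itv.
Qed.

Lemma path_letter_bounded M m : exists N, forall X, norm_ball M X -> (path_letter X m < N)%N.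
Proof.
pose K := M%:R * T `^ gamma + M%:R * T `^ (2 * gamma) : R.
have [N NP] := @letter_of_bounded R n (sample_size n m) m K.
have k1 : 0 <= M%:R * T `^ gamma :> R by rewrite mulr_ge0// powR_ge0.
have k2 : 0 <= M%:R * T `^ (2 * gamma) :> R by rewrite mulr_ge0// powR_ge0.
exists N => X XM; apply: NP => -[j [a|[a b]]].
  apply: le_trans (entry_le_norm _ _ _) _; rewrite /K.
  apply: le_trans (hoelder_norm_sup (X.1 (sample_time T0 j)) _) _.
  by apply: le_trans (path_bound gamma0 _ XM) _; rewrite lerDl.
apply: le_trans (entry_le_norm _ _ _) _; rewrite /K.
apply: le_trans (hoelder_norm_sup (X.2 (from0 (sample_time T0 j)) _) _) _.
apply: le_trans (hoelder_norm_sup (X.2 (from0 (sample_time T0 j))) _) _.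
apply: le_trans (area_bound _ XM) _; apply: (@le_trans _ _ (M%:R * T `^ (2 * gamma))).
  by rewrite ler_wpM2l// gap_powR_leT// mulr_ge0// ltW.
by rewrite lerDr.
Qed.

(** Markov's inequality, in the weakened linear form [(m + 1) P(A) <= C]. *)
Lemma moment_tight (d_ : nat -> measure_display) (Omega_ : forall k, measurableType (d_ k))
    (P_ : forall k, probability (Omega_ k) R) (X_ : forall k, Omega_ k -> S) (p : R) :
  (forall k, borel_measurable (X_ k)) -> 1 <= p ->
  (ereal_sup (range (fun k : nat =>
     'E_(P_ k)[fun omega => (rough_norm gamma (X_ k omega) `^ p)%R])) < +oo)%E ->
  forall eps : R, 0 < eps -> exists M, forall k,
    prob (P_ k) (~` [set x | norm_ball M (X_ k x)]) <= eps.
Proof.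
move=> mX p1 fin eps eps0.
have [C CP] : exists C : R, forall k,
    ('E_(P_ k)[fun omega => (rough_norm gamma (X_ k omega) `^ p)%R] <= C%:E)%E.
  move: fin; set s := ereal_sup _ => fin.
  have sP k : ('E_(P_ k)[fun omega => (rough_norm gamma (X_ k omega) `^ p)%R] <= s)%E.
    by apply: ereal_sup_ubound; exists k.
  move: s fin sP => [r| |] // _ sP; first by exists r.
  by exists 0 => k; apply: le_trans (sP k) _; rewrite leNye.
have [m mP] := inv_small (divr_gt0 eps0 (ltr_wpDl (normr_ge0 C) ltr01)).
exists m.+1 => k; set A := ~` _.
have mA : measurable A by apply: measurableC; apply: norm_ball_measurable.
have m0 : 0 < m.+1%:R :> R by rewrite ltr0n.
suff : m.+1%:R * prob (P_ k) A <= C.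
  rewrite mulrC -ler_pdivlMr// => /le_trans; apply.
  have {}mP : m.+1%:R^-1 < eps / (`|C| + 1) := mP m (leqnn m).
  rewrite ler_pdivrMr//; apply: le_trans (ler_norm C) _.
  move: mP; rewrite -[X in X < _]mul1r ltr_pdivrMr// mulrAC ltr_pdivlMr ?ltr_wpDl//.
  by rewrite mul1r => /ltW; apply: le_trans; rewrite lerDl.
rewrite -lee_fin EFinM -probE//; apply: le_trans (CP k); rewrite unlock.
apply: (@le_trans _ _ (\int[P_ k]_x (m.+1%:R * \1_A x)%:E)%E).
  rewrite (@integralZl_indic _ _ _ (P_ k) _ measurableT (fun=> A))//; last first.
    by move=> /lt_geF; rewrite ler0n.
  by rewrite integral_indic// setIT.
apply: ge0_le_integral => //.
- by apply/measurable_EFinP; apply: measurable_funM.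
- apply/measurable_EFinP; apply: (measurableT_comp (measurable_powR p)).
  exact: rough_norm_measurable.
move=> x _; rewrite lee_fin indicE; case: (asboolP (A x)) => [Ax|Ax]; last first.
  by rewrite memNset// mulr0 powR_ge0.
rewrite mem_set// mulr1.
have {}Ax : m.+1%:R < rough_norm gamma (X_ k x) by rewrite ltNge; apply/negP.
(* A norm of at least 1 is dominated by its power [p >= 1]. *)
have N1 : 1 <= rough_norm gamma (X_ k x).
  by apply: le_trans (ltW Ax); rewrite ler1n.
apply: le_trans (ltW Ax) _; rewrite -[leLHS]powRr1 ?(le_trans ler01)//.
exact: ler_powR.
Qed.

(* The limit does not mention exponents, hence is the same for all of them. *)
Definition field_limit (x0 : S) (xi : nat -> nat) : space_time_field T n :=
  if pselect (good norm_ball path_letter xi) then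
    (fun t x => limn (fun k => (field_of (approx norm_ball near_path x0 xi k)).1 t x),
     fun p x y => limn (fun k => (field_of (approx norm_ball near_path x0 xi k)).2 p x y))
  else field_of x0.

Section lowered.
Context {gamma' alpha' : R}.
Hypothesis gammas : 0 < gamma' < gamma.
Hypothesis alphas : 0 < alpha' < alpha.
Local Notation e := (@lower_rough R T n rho gamma gamma' alpha alpha' gammas alphas).

Lemma near_path_close M (eps : R) : 0 < eps -> exists m0, forall m (X Y : S) w,
  (m0 <= m)%N -> norm_ball M X -> norm_ball M Y -> near_path m X w -> near_path m Y w ->
  mdist (e X) (e Y) <= eps.
Proof.
move=> eps0.
have [m0 [d d0 dP]] := @samples_close_lower R T n rho gamma alpha T0 rho0 gamma0
  alpha0 gamma' alpha' gammas alphas M%:R eps (ler0n R M) eps0.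
have c0 : 0 < (n.+1 * n.+1)%:R * 4 :> R by rewrite mulr_gt0// ltr0n.
have [m1 m1P] := inv_small (divr_gt0 d0 c0).
exists (maxn m0 m1) => m X Y w; rewrite geq_max => /andP[mm0 mm1] XM YM Xw Yw.
apply: (dP m X Y mm0 XM YM) => j; have [h1 h2] := near_entries_close j Xw Yw.
have h3 : (n.+1 * n.+1)%:R * (4 / m.+1%:R) <= d.
  by rewrite mulrA mulrC -ler_pdivlMr// ltW// m1P.
by split; [exact: le_trans h1 h3|exact: le_trans h2 h3].
Qed.

Lemma lower_rough_continuous : continuous e.
Proof.
have [C C0 CP] := @lower_rough_lipschitz R T n rho _ _ _ _ gammas alphas.
exact: mdist_lipschitz_continuousS C0 CP.
Qed.

Local Notation S' := (hoelder_rough_path T gamma' n alpha' rho).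

Let gamma'0 : 0 < gamma'. Proof. by have /andP[] := gammas. Qed.

Definition path_limit (x0 : S) (xi : nat -> nat) : S' :=
  limit_point x0 near_path_letter norm_ball_homo
    (hoelder_rough_path_complete gamma'0) near_path_close xi.

Lemma path_limitP x0 xi : good norm_ball path_letter xi -> forall eps : R, 0 < eps ->
  exists N, forall i, (N <= i)%N ->
    mdist (e (approx norm_ball near_path x0 xi i)) (path_limit x0 xi) <= eps.
Proof. exact: limit_pointP. Qed.

(** Evaluations at times and points are Lipschitz for the weaker distance and unchanged by lowering,
    so the limit in the lowered space is the pointwise limit, whichever exponents were chosen. *)
Lemma field_path_limit x0 xi : field_of (path_limit x0 xi) = field_limit x0 xi.
Proof.
rewrite /field_limit; case: pselect => [gx|bx]; last first.
  by rewrite /path_limit limit_point_bad.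
have lP := path_limitP x0 gx.
rewrite [LHS]surjective_pairing; congr pair.
  apply/funext => t; apply/funext => x; apply/esym/cvg_lim; first exact: norm_hausdorff.
  exact: (lipschitz_cvg (u := fun k => (field_of (e (approx norm_ball near_path x0 xi k))).1 t x)
    (powR_ge0 _ _) lP (fun k => field_path_lipschitz _ _ t x)).
apply/funext => p; apply/funext => x; apply/funext => y; apply/esym/cvg_lim.
  exact: norm_hausdorff.
exact: (lipschitz_cvg (u := fun k => (field_of (e (approx norm_ball near_path x0 xi k))).2 p x y)
  (powR_ge0 _ _) lP (fun k => field_area_lipschitz _ _ p x y)).
Qed.

Lemma near_field_letter x0 xi m : good norm_ball path_letter xi ->
  exists K, forall k, (K <= k)%N ->
    near_path m (approx norm_ball near_path x0 xi k) (field_letter (field_limit x0 xi) m).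
Proof.
move=> gx; apply: near_letter_lim => i; rewrite -field_path_limit.
have [C [C0 CP]] := @sample_entry_lipschitz R T n rho gamma' alpha' T0 m i.
exact: (lipschitz_cvg (U := R) (u := fun k => entry (sample rho T0 m
  (field_of (e (approx norm_ball near_path x0 xi k)))) i) C0 (path_limitP x0 gx)
  (fun k => CP _ _)).
Qed.

Section mean_of_limit.
Variables (d : measure_display) (Omega : measurableType d) (P : probability Omega R).
Variables (x0 : S) (q' : Omega -> nat -> nat).
Hypothesis mq' : forall w, measurable (has_prefix q' w).
Hypothesis good_q' : prob P (~` [set x | good norm_ball path_letter (q' x)]) = 0.

Lemma path_limit_borel : borel_measurable (path_limit x0 \o q').
Proof. exact: limit_point_borel. Qed.

Lemma field_limit_letter_measurable m w :
  measurable [set x | field_letter (field_limit x0 (q' x)) m = w].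
Proof.
have := field_letter_measurable T0 m w path_limit_borel.
by congr measurable; apply/seteqP; split=> x /=; rewrite field_path_limit.
Qed.

(** The mean under the limit is expressed through the letters of the limit field rather than through
    [q']: these are functions of its samples. *)
Lemma letter_mean_cvg (f : S' -> R) (C : R) : continuous f -> (forall y, `|f y| <= C) ->
  (fun m => \int[P]_x f (e (rep norm_ball near_path x0 m
     (field_letter (field_limit x0 (q' x)) m)))) @ \oo -->
  \int[P]_x f (path_limit x0 (q' x)).
Proof.
move=> fc fC.
apply: (bounded_mean_cvg (h_ := fun m x => f (e (rep norm_ball near_path x0 m
  (field_letter (field_limit x0 (q' x)) m)))) (C := C) _ _ _ _
  (measurable_good norm_ball path_letter mq') good_q').
- move=> m; exact: (nat_comp_measurable (field_limit_letter_measurable m)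
    (fun w => f (e (rep norm_ball near_path x0 m w)))).
- apply: borel_measurable_fun.
  exact: (borel_comp (f := f) path_limit_borel fc).
- by move=> m x; exact: fC.
- by move=> x; exact: fC.
- move=> x gx; apply/cvg_seqP => eps eps0.
  have [dl dl0 dP] := continuous_mdist (fc (path_limit x0 (q' x))) eps0.
  have dl20 : 0 < dl / 2 by rewrite divr_gt0.
  have [N NP] := @rep_limit_point _ _ _ _ x0 near_path_letter norm_ball_homo _ _ _
    (hoelder_rough_path_complete gamma'0) near_path_close _ _ gx
    (fun m => near_field_letter x0 m gx) _ dl20.
  exists N => k Nk; apply/ltW/dP; apply: le_lt_trans (NP k Nk) _.
  by rewrite ltr_pdivrMr// ltr_pMr// ltr1n.
Qed.

End mean_of_limit.

(** At each level the letter of the field is a function of finitely many samples at increasing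
    times, so its law is the same on both sides; the level then tends to infinity. *)
Lemma equal_fdd_mean d1 (Omega1 : measurableType d1) (P1 : probability Omega1 R)
    (q1 : Omega1 -> nat -> nat) d2 (Omega2 : measurableType d2)
    (P2 : probability Omega2 R) (q2 : Omega2 -> nat -> nat) (x0 : S)
    (f : S' -> R) (C : R) :
  (forall w, measurable (has_prefix q1 w)) ->
  prob P1 (~` [set x | good norm_ball path_letter (q1 x)]) = 0 ->
  (forall w, measurable (has_prefix q2 w)) ->
  prob P2 (~` [set x | good norm_ball path_letter (q2 x)]) = 0 ->
  equal_fdd P1 (field_limit x0 \o q1) P2 (field_limit x0 \o q2) ->
  continuous f -> (forall y, `|f y| <= C) ->
  \int[P1]_x f (path_limit x0 (q1 x)) = \int[P2]_x f (path_limit x0 (q2 x)).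
Proof.
move=> mq1 g1 mq2 g2 fdd fc fC.
have c1 := letter_mean_cvg (x0 := x0) mq1 g1 fc fC.
have c2 := letter_mean_cvg (x0 := x0) mq2 g2 fc fC.
suff E m : \int[P1]_x f (e (rep norm_ball near_path x0 m
      (field_letter (field_limit x0 (q1 x)) m))) =
    \int[P2]_x f (e (rep norm_ball near_path x0 m
      (field_letter (field_limit x0 (q2 x)) m))).
  move: c1; under eq_fun do rewrite E; move=> c1.
  exact: (cvg_unique _ c1 c2).
(* Applied to a constant sequence of laws, the convergence of means is an equality of means. *)
have := @nat_mean_cvg R _ _ (fun=> P1) _ _ P2
  (fun _ x => field_letter (field_limit x0 (q1 x)) m)
  (fun x => field_letter (field_limit x0 (q2 x)) m)
  (fun _ => field_limit_letter_measurable x0 mq1 m)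
  (field_limit_letter_measurable x0 mq2 m)
  (fun w => f (e (rep norm_ball near_path x0 m w))) C (fun w => fC _).
move=> h; apply: cvg_unique (h _); [exact: norm_hausdorff|exact: cvg_cst|].
move=> w.
have := fdd _ (fun j : 'I_(sample_size n m) => sample_time T0 j)
  (fun j => grid_point rho (sample_pair j).1) (fun j => grid_point rho (sample_pair j).2)
  (fun i j ij => sample_time_lt T0 ij) _ (letter_set_borel m w).
by rewrite /prob => ->; exact: cvg_cst.
Qed.

End lowered.

Section limit_field.
Variables (d_ : nat -> measure_display) (Omega_ : forall k, measurableType (d_ k)).
Variable P_ : forall k, probability (Omega_ k) R.
Variable X_ : forall k, Omega_ k -> S.
Arguments X_ : clear implicits.
Hypothesis mX : forall k, borel_measurable (X_ k).
Hypothesis tight : forall eps : R, 0 < eps -> exists M, forall k,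
  prob (P_ k) (~` [set x | norm_ball M (X_ k x)]) <= eps.

Let mq k j w : measurable [set x | path_letter (X_ k x) j = w].
Proof. exact: field_letter_measurable. Qed.

Let mB k M : measurable [set x | norm_ball M (X_ k x)].
Proof. exact: norm_ball_measurable. Qed.

Lemma path_letter_limit : exists f : nat -> nat, {homo f : i j / (i < j)%N} /\
  exists q' : R -> nat -> nat, (forall w, measurable (has_prefix q' w)) /\
    forall w, (fun k => prob (P_ (f k))
        (has_prefix (fun x => path_letter (X_ (f k) x)) w)) @ \oo -->
      prob (uniform_prob (@ltr01 R)) (has_prefix q' w).
Proof.
apply: (limit_word (q := fun k x => path_letter (X_ k x))) => // j eps eps0.
have [M MP] := tight eps0; have [N NP] := path_letter_bounded M j.
exists N => k; apply: le_trans (MP k); apply: prob_le.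
- have -> : [set x | (N <= path_letter (X_ k x) j)%N] =
    (fun x => path_letter (X_ k x) j) @^-1` [set w | (N <= w)%N] by [].
  exact: nat_preimage_measurable (mq k j) _.
- exact: measurableC.
- by move=> x /= Nx /NP; rewrite ltnNge Nx.
Qed.

Variables (d : measure_display) (Omega : measurableType d) (P : probability Omega R).
Variables (x0 : S) (q' : Omega -> nat -> nat).
Hypothesis mq' : forall w, measurable (has_prefix q' w).
Hypothesis q_q' : forall w,
  (fun k => prob (P_ k) (has_prefix (fun x => path_letter (X_ k x)) w)) @ \oo -->
    prob P (has_prefix q' w).

Lemma prob_good_letters : prob P (~` [set x | good norm_ball path_letter (q' x)]) = 0.
Proof. exact: (prob_not_good mq mB tight mq' q_q'). Qed.

Lemma lower_weak_cvg gamma' alpha' (gammas : 0 < gamma' < gamma)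
    (alphas : 0 < alpha' < alpha) :
  weak_cvg P_ (fun k => @lower_rough R T n rho gamma gamma' alpha alpha' gammas alphas \o X_ k)
    P (path_limit gammas alphas x0 \o q').
Proof.
apply: (limit_point_weak_cvg (q := path_letter) mq mB tight mq' q_q').
  exact: path_letter_bounded.
move=> k; apply: borel_comp (mX k) _; exact: lower_rough_continuous.
Qed.

Lemma limit_field_weak_cvg : weak_cvg_minus rho gamma alpha P_
  (fun k x => field_of (X_ k x)) P (field_limit x0 \o q').
Proof.
move=> gamma' alpha' gammas alphas.
exists (fun k => @lower_rough R T n rho gamma gamma' alpha alpha' gammas alphas \o X_ k).
exists (path_limit gammas alphas x0 \o q'); split.
- move=> k; split; first by move=> x; exact: field_of_lower.
  by apply: borel_comp (mX k) _; exact: lower_rough_continuous.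
- split; first by move=> x; exact: field_path_limit.
  exact: path_limit_borel.
- exact: lower_weak_cvg.
Qed.

Lemma limit_field_minus : random_rough_path_minus rho gamma alpha (field_limit x0 \o q').
Proof.
move=> gamma' alpha' gammas alphas.
by have [_ [Y [_ Yq _]]] := limit_field_weak_cvg gammas alphas; exists Y.
Qed.

End limit_field.

End rough_law.

(** * Convergence of the whole sequence *)

Theorem proposition4p9 (R : realType) (n : nat) (T gamma alpha rho : R)
    (hT : 0 < T) (hgamma : 3^-1 < gamma <= 1) (halpha : 0 < alpha)
    (hrho : 0 < rho)
    (d_ : nat -> measure_display) (Omega_ : forall k, measurableType (d_ k))
    (P_ : forall k, probability (Omega_ k) R)
    (X_ : forall k, Omega_ k -> hoelder_rough_path T gamma n alpha rho)
    (hX : forall k, borel_measurable (X_ k))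
    (hmoment : exists p : R, 1 <= p /\
      (ereal_sup (range (fun k : nat =>
         'E_(P_ k)[fun omega => (rough_norm gamma (X_ k omega) `^ p)%R])) < +oo)%E)
    (hfdd : forall
      (d1 : measure_display) (Omega1 : measurableType d1)
      (P1 : probability Omega1 R) (Z1 : Omega1 -> space_time_field T n)
      (d2 : measure_display) (Omega2 : measurableType d2)
      (P2 : probability Omega2 R) (Z2 : Omega2 -> space_time_field T n),
      weak_limit_point_minus rho gamma alpha P_
        (fun k omega => field_of (X_ k omega)) P1 Z1 ->
      weak_limit_point_minus rho gamma alpha P_
        (fun k omega => field_of (X_ k omega)) P2 Z2 ->
      equal_fdd P1 Z1 P2 Z2) :
  exists (d : measure_display) (Omega : measurableType d)
         (P : probability Omega R) (Z : Omega -> space_time_field T n),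
    random_rough_path_minus rho gamma alpha Z /\
    weak_cvg_minus rho gamma alpha P_
      (fun k omega => field_of (X_ k omega)) P Z.
Proof.
have gamma0 : 0 < gamma by case/andP: hgamma => + _; apply: lt_trans; rewrite invr_gt0.
have [p [p1 pfin]] := hmoment.
have tight := moment_tight (rho := rho) (alpha := alpha) hX p1 pfin.
(* A probability space is not empty, which provides the default rough path. The same [x0] serves all
   subsequences, so that their decoded limits are comparable. *)
have [x _] : [set: Omega_ 0%N] !=set0.
  apply/set0P/eqP => O0; have := prob_setT (P_ 0%N).
  by rewrite O0 /prob measure0 => /eqP; rewrite eq_sym oner_eq0.
pose x0 := X_ 0%N x.
have extract phi : exists psi, {homo psi : i j / (i < j)%N} /\
    exists q' : R -> nat -> nat, (forall w, measurable (has_prefix q' w)) /\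
    forall w, (fun k => prob (P_ (phi (psi k)))
        (has_prefix (fun x => path_letter hT (X_ (phi (psi k)) x)) w)) @ \oo -->
      prob (uniform_prob (@ltr01 R)) (has_prefix q' w).
  apply: (path_letter_limit hT gamma0 (P_ := fun k => P_ (phi k))
    (X_ := fun k => X_ (phi k)) (fun k => hX (phi k))) => eps eps0.
  by have [M MP] := tight eps eps0; exists M => k; exact: MP.
have tight_sub (phi : nat -> nat) : forall eps : R, 0 < eps -> exists M, forall k,
    prob (P_ (phi k)) (~` [set x | norm_ball M (X_ (phi k) x)]) <= eps.
  by move=> eps eps0; have [M MP] := tight eps eps0; exists M => k; exact: MP.
have point phi (q' : R -> nat -> nat) : {homo phi : i j / (i < j)%N} ->
    (forall w, measurable (has_prefix q' w)) ->
    (forall w, (fun k => prob (P_ (phi k))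
        (has_prefix (fun x => path_letter hT (X_ (phi k) x)) w)) @ \oo -->
      prob (uniform_prob (@ltr01 R)) (has_prefix q' w)) ->
    weak_limit_point_minus rho gamma alpha P_ (fun k omega => field_of (X_ k omega))
      (uniform_prob (@ltr01 R)) (field_limit hT x0 \o q').
  move=> phih mq' cq'; split.
    exact: (limit_field_minus (T0 := hT) (P := uniform_prob (@ltr01 R))
      hrho gamma0 halpha (P_ := fun k => P_ (phi k))
      (X_ := fun k => X_ (phi k)) (fun k => hX (phi k)) (tight_sub phi) x0 mq' cq').
  exists phi; split => //.
  exact: (limit_field_weak_cvg (T0 := hT) (P := uniform_prob (@ltr01 R))
    hrho gamma0 halpha (P_ := fun k => P_ (phi k))
    (X_ := fun k => X_ (phi k)) (fun k => hX (phi k)) (tight_sub phi) x0 mq' cq').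
have [psi0 [psi0h [q0 [mq0 cq0]]]] := extract id.
have point0 := point _ _ psi0h mq0 cq0.
exists _, _, (uniform_prob (@ltr01 R)), (field_limit hT x0 \o q0).
split; first exact: point0.1.
move=> gamma' alpha' gammas alphas.
pose e := @lower_rough R T n rho gamma gamma' alpha alpha' gammas alphas.
pose L := path_limit hT hrho gamma0 halpha gammas alphas x0.
have meX k : borel_measurable (e \o X_ k).
  by apply: borel_comp (hX k) _; exact: lower_rough_continuous.
have mL : borel_measurable (L \o q0) by exact: path_limit_borel.
exists (fun k => e \o X_ k), (L \o q0); split.
- by move=> k; split=> // omega; exact: field_of_lower.
- by split=> // omega; exact: field_path_limit.
move=> f fc [C fC].
have iX k := bounded_mean_integrable (P_ k)
  (borel_measurable_fun (borel_comp (meX k) fc)) (fun x => fC _).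
have iL (q' : R -> nat -> nat) : (forall w, measurable (has_prefix q' w)) ->
    (uniform_prob (@ltr01 R)).-integrable setT (EFin \o (f \o (L \o q'))).
  move=> mq'; apply: (bounded_mean_integrable _ (C := C)) => [|y]; last exact: fC.
  by apply: borel_measurable_fun; apply: borel_comp fc; exact: path_limit_borel.
rewrite (expectation_Rintegral (iL q0 mq0)).
under eq_fun do rewrite (expectation_Rintegral (iX _)).
apply: cvg_EFin; first exact: nearW.
(* If the means stay away from the limit along [phi], a further subsequence still converges to some
   limit point; equal finite-dimensional distributions give it the mean of the first one, a
   contradiction. *)
apply/cvg_seqP => eps eps0; apply: contrapT => no.
have [|phi [phih phiP]] := @increasing_choice (fun _ i =>
    eps < `|\int[P_ i]_x (f \o (e \o X_ i)) x -
            \int[uniform_prob (@ltr01 R)]_x (f \o (L \o q0)) x|).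
  move=> _ N; apply: contrapT => noi; apply: no; exists N => i Ni.
  by rewrite leNgt; apply/negP => lt; apply: noi; exists i.
have [psi [psih [q1 [mq1 cq1]]]] := extract phi.
have phipsi := subsequence_trans phih psih.
have point1 := point _ _ phipsi mq1 cq1.
have fdd := hfdd _ _ _ _ _ _ _ _ point1 point0.
have good0 := prob_good_letters (T0 := hT) (P := uniform_prob (@ltr01 R))
  (X_ := fun k => X_ (psi0 k)) (fun k => hX (psi0 k)) (tight_sub psi0) mq0 cq0.
have good1 := prob_good_letters (T0 := hT) (P := uniform_prob (@ltr01 R))
  (X_ := fun k => X_ ((phi \o psi) k))
  (fun k => hX ((phi \o psi) k)) (tight_sub (phi \o psi)) mq1 cq1.
have E := equal_fdd_mean (T0 := hT) (P1 := uniform_prob (@ltr01 R))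
  (P2 := uniform_prob (@ltr01 R)) (x0 := x0) hrho gamma0 halpha gammas alphas
  mq1 good1 mq0 good0 fdd fc fC.
have wc : weak_cvg (fun k => P_ ((phi \o psi) k)) (fun k => e \o X_ ((phi \o psi) k))
    (uniform_prob (@ltr01 R)) (L \o q1).
  exact: (lower_weak_cvg (T0 := hT) (P := uniform_prob (@ltr01 R))
    (fun k => hX ((phi \o psi) k)) (tight_sub (phi \o psi)) mq1 cq1).
have := wc f fc (ex_intro _ C fC).
rewrite (expectation_Rintegral (iL q1 mq1)).
under eq_fun do rewrite (expectation_Rintegral (iX _)).
move=> /fine_cvg /cvg_seqP /(_ _ eps0)[N /(_ N (leqnn N))] /=.
by have := phiP (psi N); rewrite E => /lt_geF /= ->.
Qed.
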